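(* Let $\widetilde\mu$ be an infinitely divisible distribution on $\mathbb{R}^d$ with Lévy–Khintchine triplet $(\widetilde\Sigma,\widetilde\nu,\widetilde\gamma)$. The following are equivalent: (a) $\widetilde\mu\in G(\mathbb{R}^d)$; (b) $\widetilde\nu=\mathcal{A}_1(\nu)$ for some $\nu\in\mathfrak{M}_L^B(\mathbb{R}^d)\cap\mathfrak{M}_L^1(\mathbb{R}^d)$; (c) $\widetilde\nu=\mathcal{A}_1(\Upsilon^0(\rho))$ for some $\rho\in\mathfrak{M}_L^1(\mathbb{R}^d)$. In (b) or (c), the representing measure $\nu$, respectively $\rho$, is unique.
   Context: A Lévy measure on $\mathbb{R}^d$ is a measure $\nu$ with $\nu(\{0\})=0$ and $\int(1\wedge|x|^2)\nu(\mathrm{d}x)<\infty$; their class is $\mathfrak{M}_L(\mathbb{R}^d)$, and $\mathfrak{M}_L^1(\mathbb{R}^d)$ is the class of those with $\int(1\wedge|x|)\nu(\mathrm{d}x)<\infty$. A polar decomposition of $\nu\in\mathfrak{M}_L(\mathbb{R}^d)$ is a pair $(\lambda,\{\nu_\xi\})$, $\lambda$ a measure on the unit sphere $\mathbb{S}$, $\nu_\xi$ measures on $(0,\infty)$ with $\nu_\xi(E)$ measurable in $\xi$, $0<\nu_\xi((0,\infty))\le\infty$, and $\nu(B)=\int_{\mathbb{S}}\lambda(\mathrm{d}\xi)\int_0^\infty1_B(r\xi)\nu_\xi(\mathrm{d}r)$. $\mathfrak{M}_L^B(\mathbb{R}^d)$ (Lévy measures of the Goldie–Steutel–Bondesson class)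 is the class of $\nu\in\mathfrak{M}_L(\mathbb{R}^d)$ with a polar decomposition such that $\nu_\xi(\mathrm{d}r)=\ell_\xi(r)\mathrm{d}r$, $\ell_\xi(r)$ measurable in $(\xi,r)$ and completely monotone in $r>0$. $G(\mathbb{R}^d)$ (generalized type $G$ distributions) is the class of infinitely divisible $\mu$ on $\mathbb{R}^d$ whose Lévy measure has a polar decomposition with $\nu_\xi(\mathrm{d}r)=g_\xi(r^2)\mathrm{d}r$, where $g_\xi(u)$ is measurable in $(\xi,u)$ and completely monotone in $u\in(0,\infty)$. $a_1(r;s)=2\pi^{-1}(s-r^2)^{-1/2}$ for $0<r<s^{1/2}$, $0$ otherwise; $\mathcal{A}_1(\nu)(B)=\int_{\mathbb{R}^d\setminus\{0\}}\nu(\mathrm{d}x)\int_0^\infty a_1(r;|x|)1_B(rx/|x|)\mathrm{d}r$. $\Upsilon^0(\rho)(B)=\int_0^\infty\rho(u^{-1}B)e^{-u}\mathrm{d}u$. *)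

(* Defs.v *)
From HB Require Import structures.
From mathcomp Require Import all_boot all_order all_algebra.
From mathcomp Require Import all_classical all_reals all_analysis.
Set Implicit Arguments. Unset Strict Implicit. Unset Printing Implicit Defensive.
Import Order.TTheory GRing.Theory Num.Theory.
Import numFieldNormedType.Exports.
Local Open Scope classical_set_scope.
Local Open Scope ring_scope.

Definition Rpos (R : realType) : set R := `]0, +oo[%classic.
Arguments Rpos R : clear implicits.

Notation Rd R d := (g_sigma_algebraType (@open 'rV[R]_d)).

Definition dotv (R : realType) (d : nat) (z x : 'rV[R]_d) : R :=
  \sum_(i < d) z ord0 i * x ord0 i.
Definition enorm (R : realType) (d : nat) (x : 'rV[R]_d) : R :=
  Num.sqrt (\sum_(i < d) x ord0 i ^+ 2).

Definition sphere (R : realType) (d : nat) : set (Rd R d) :=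
  [set x | enorm x = 1].
Arguments sphere R d : clear implicits.


Definition levy_measure (R : realType) (d : nat)
    (nu : {measure set (Rd R d) -> \bar R}) : Prop :=
  nu [set 0] = 0%E /\
  (\int[nu]_x (Num.min 1 (enorm x ^+ 2))%:E < +oo)%E.

Definition levy_measure1 (R : realType) (d : nat)
    (nu : {measure set (Rd R d) -> \bar R}) : Prop :=
  levy_measure nu /\ (\int[nu]_x (Num.min 1 (enorm x))%:E < +oo)%E.

Definition completely_monotone (R : realType) (f : R -> R) : Prop :=
  (forall (n : nat) (r : R), 0 < r -> derivable (derive1n n f) r 1) /\
  (forall (n : nat) (r : R), 0 < r -> 0 <= (-1) ^+ n * derive1n n f r).

Definition polar_int (R : realType) (d : nat)
    (lam : {measure set (Rd R d) -> \bar R}) (ell : Rd R d -> R -> R)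
    (B : set (Rd R d)) : \bar R :=
  (\int[lam]_(xi in sphere R d)
     \int[lebesgue_measure]_(r in Rpos R)
        (@indic _ R B (r *: (xi : 'rV[R]_d) : Rd R d) * ell xi r)%:E)%E.

(* (lam, {nu_xi}) with nu_xi(dr) = ell(xi, r) dr is a polar decomposition of
   nu: lam is a measure on the sphere (a measure on R^d carried by S), each
   nu_xi is a (nonnegative) measure on (0,oo) with 0 < nu_xi((0,oo)) <= oo,
   and nu(B) = int_S lam(dxi) int_0^oo 1_B(r xi) nu_xi(dr). *)
Definition polar_decomp_density (R : realType) (d : nat)
    (nu lam : {measure set (Rd R d) -> \bar R}) (ell : Rd R d -> R -> R) : Prop :=
  lam (~` sphere R d) = 0%E /\
  (forall xi r, sphere R d xi -> 0 < r -> 0 <= ell xi r) /\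
  (forall xi, sphere R d xi ->
     (0 < \int[lebesgue_measure]_(r in Rpos R) (ell xi r)%:E)%E) /\
  (forall B, measurable B -> nu B = polar_int lam ell B).

Definition levy_B (R : realType) (d : nat)
    (nu : {measure set (Rd R d) -> \bar R}) : Prop :=
  levy_measure nu /\
  exists (lam : {measure set (Rd R d) -> \bar R}) (ell : Rd R d -> R -> R),
    polar_decomp_density nu lam ell /\
    measurable_fun (sphere R d `*` Rpos R)
      (fun p : Rd R d * R => ell p.1 p.2) /\
    (forall xi, sphere R d xi -> completely_monotone (ell xi)).

Definition levy_G (R : realType) (d : nat)
    (nu : {measure set (Rd R d) -> \bar R}) : Prop :=
  levy_measure nu /\
  exists (lam : {measure set (Rd R d) -> \bar R}) (g : Rd R d -> R -> R),
    polar_decomp_density nu lam (fun xi r => g xi (r ^+ 2)) /\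
    measurable_fun (sphere R d `*` Rpos R)
      (fun p : Rd R d * R => g p.1 p.2) /\
    (forall xi, sphere R d xi -> completely_monotone (g xi)).

Definition a1 (R : realType) (r s : R) : R :=
  if (0 < r) && (r < Num.sqrt s) then 2 / pi * (Num.sqrt (s - r ^+ 2))^-1
  else 0.

Definition A1 (R : realType) (d : nat) (nu : {measure set (Rd R d) -> \bar R})
    (B : set (Rd R d)) : \bar R :=
  (\int[nu]_(x in [set~ ((0%R : 'rV[R]_d) : Rd R d)])
     \int[lebesgue_measure]_(r in Rpos R)
       (a1 r (enorm x) *
        @indic _ R B ((r / enorm x) *: (x : 'rV[R]_d) : Rd R d))%:E)%E.

Definition Ups0 (R : realType) (d : nat) (rho : {measure set (Rd R d) -> \bar R})
    (B : set (Rd R d)) : \bar R :=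
  (\int[lebesgue_measure]_(u in Rpos R)
     (rho [set x : Rd R d | B (u *: (x : 'rV[R]_d) : Rd R d)] * (expR (- u))%:E))%E.

(* mu is infinitely divisible with Levy--Khintchine triplet (Sigma, nu, gamma):
   Sigma symmetric nonnegative definite, nu a Levy measure, and the
   characteristic function of mu equals exp(psi(z)) with
   psi(z) = -1/2 <z, Sigma z> + i<gamma,z>
            + int (e^{i<z,x>} - 1 - i<z,x> 1_{|x|<=1}(x)) nu(dx),
   written out in real and imaginary parts. *)
Definition LK_Re (R : realType) (d : nat) (Sigma : 'M[R]_d)
    (nu : {measure set (Rd R d) -> \bar R}) (z : 'rV[R]_d) : R :=
  - (dotv z (z *m Sigma)) / 2 +
  Rintegral nu setT (fun x : Rd R d => cos (dotv z x) - 1).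

Definition LK_Im (R : realType) (d : nat) (nu : {measure set (Rd R d) -> \bar R})
    (gamma z : 'rV[R]_d) : R :=
  dotv gamma z +
  Rintegral nu setT (fun x : Rd R d =>
    sin (dotv z x) - dotv z x * @indic _ R [set y : Rd R d | enorm y <= 1] x).

Definition ID_triplet (R : realType) (d : nat) (mu : probability (Rd R d) R)
    (Sigma : 'M[R]_d) (nu : {measure set (Rd R d) -> \bar R})
    (gamma : 'rV[R]_d) : Prop :=
  Sigma^T = Sigma /\
  (forall v : 'rV[R]_d, 0 <= dotv v (v *m Sigma)) /\
  levy_measure nu /\
  forall z : 'rV[R]_d,
    Rintegral mu setT (fun x : Rd R d => cos (dotv z x))
      = expR (LK_Re Sigma nu z) * cos (LK_Im nu gamma z) /\
    Rintegral mu setT (fun x : Rd R d => sin (dotv z x))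
      = expR (LK_Re Sigma nu z) * sin (LK_Im nu gamma z).

Definition in_G (R : realType) (d : nat) (mu : probability (Rd R d) R)
    (Sigma : 'M[R]_d) (nu : {measure set (Rd R d) -> \bar R})
    (gamma : 'rV[R]_d) : Prop :=
  ID_triplet mu Sigma nu gamma /\ levy_G nu.

(* Main.v *)
Require Import Defs.
From HB Require Import structures.
From mathcomp Require Import all_boot all_order all_algebra.
From mathcomp Require Import all_classical all_reals all_analysis.
From mathcomp Require Import measurable_realfun ring lra.
Set Implicit Arguments. Unset Strict Implicit. Unset Printing Implicit Defensive.
Import Order.TTheory GRing.Theory Num.Theory.
Import numFieldNormedType.Exports.
Local Open Scope classical_set_scope.
Local Open Scope ring_scope.

(** Write [dir x = x / |x|]. Substituting [u = r / |x|] in [Ups0 rho] gives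
   [ups(B) = int rho(dx) |x|^-1 int_0^oo e^(-r/|x|) 1_B(r dir x) dr],
   and integrating the kernel [a1] against this gives
   [A1 ups (B) = c int rho(dx) |x|^(-1/2) int_0^oo e^(-r^2/|x|) 1_B(r dir x) dr]
   with [c = (2/pi) int_0^oo e^-t t^(-1/2) dt]. So membership in the
   Goldie-Steutel-Bondesson class, resp. in G, is Bernstein's theorem applied
   along rays, measurably in the direction: [1/|x|] is the variable of the
   mixing measure of [l_xi], resp. of [g_xi].

   Bernstein's theorem itself is obtained from an urn. A completely monotone [f]
   has nonnegative iterated differences [q i j], with
   [q i j = q i.+1 j + q i j.+1], and these are transition weights of a Markov
   chain whose limiting frequency [Z], driven by one uniform variable [v], has
   [q 0 j = q 0 0 * int_0^1 Z(v)^j dv]. The limit is an explicit measurable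
   function of [q] and [v], hence of the direction. The same urn, fed with
   Radon-Nikodym densities of the measures [X^j (1 - X)^i] over the directions,
   [X = e^(-1/|x|)], disintegrates a measure without any topological kernel
   theorem. Uniqueness of [rho] comes from the moments of [X], read off
   by integrating the second formula over the shells
   [sqrt (j+1) <= |y| <= sqrt (j+2)]. *)

(** * Mixtures of measures *)

(** The condition [levy_measure1] on [rho] comes from comparisons along a ray. With [s = |x|], both
    [int_0^oo s^-1 min(1, r) e^(-r/s) dr] and [int_0^oo s^(-1/2) min(1, r^2) e^(-r^2/s) dr] are at
    least a positive multiple of [min(1, s)]. So integrability of [min(1, |y|)] under the first kind
    of mixture, or of [min(1, |y|^2)] under the second, forces integrability of [min(1, |x|)] under
    the mixing measure. Two obstacles shape the rest. The measure [lam] of a polar decomposition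
    carries no finiteness assumption, so an integral over it is never interchanged with another one:
    mixtures over [lam] are constructed as measures, and Tonelli is applied to Lebesgue and finite
    measures only. Moreover Bernstein's theorem allows the exponent [0], which would be [1/|x|] for
    no point [x]; it is excluded for almost every direction by the finite mass of a Lévy measure
    outside the unit ball. *)

Section bind_measure.
Context d d' (X : measurableType d) (T : measurableType d') (R : realType).
Variables (lam : {measure set X -> \bar R}) (K : X -> {measure set T -> \bar R}).
Hypothesis mK : forall B, measurable B -> measurable_fun [set: X] (K ^~ B).
Local Open Scope ereal_scope.

Definition bind_measure (B : set T) : \bar R := \int[lam]_x K x B.

Let bind0 : bind_measure set0 = 0.
Proof. by rewrite /bind_measure integral0_eq// => x _; rewrite measure0. Qed.

Let bind_ge0 B : 0 <= bind_measure B. Proof. exact: integral_ge0. Qed.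

Let bind_sigma_additive : semi_sigma_additive bind_measure.
Proof.
move=> U mU tU mUU; rewrite [X in _ --> X](_ : _ =
  \int[lam]_y (\sum_(n <oo) K y (U n))); last first.
  apply: eq_integral => V _.
  by apply/esym/cvg_lim => //; exact/measure_semi_sigma_additive.
apply/cvg_closeP; split.
  by apply: is_cvg_nneseries => n _ _; exact: integral_ge0.
by rewrite closeE// integral_nneseries// => n; exact: mK.
Qed.

HB.instance Definition _ := isMeasure.Build _ _ _ bind_measure
  bind0 bind_ge0 bind_sigma_additive.

Import HBNNSimple.

Let integral_bind_nnsfun (f : {nnsfun T >-> R}) :
  \int[bind_measure]_z (f z)%:E = \int[lam]_y (\int[K y]_z (f z)%:E).
Proof.
under [in LHS]eq_integral do rewrite fimfunE -fsumEFin//.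
rewrite ge0_integral_fsum//; last 2 first.
- by move=> r; exact/measurable_EFinP/measurableT_comp.
- by move=> r z _; rewrite EFinM nnfun_muleindic_ge0.
under [in RHS]eq_integral.
  move=> y _.
  under eq_integral.
    by move=> z _; rewrite fimfunE -fsumEFin//; over.
  rewrite /= ge0_integral_fsum//; last 2 first.
  - by move=> r; exact/measurable_EFinP/measurableT_comp.
  - by move=> r z _; rewrite EFinM nnfun_muleindic_ge0.
  under eq_fsbigr.
    move=> r _.
    rewrite (integralZl_indic _ (fun r => f @^-1` [set r]))//; last first.
      by move=> r0; rewrite preimage_nnfun0.
    rewrite integral_indic// setIT.
    over.
  over.
rewrite /= ge0_integral_fsum//; last 2 first.
- by move=> r; apply: measurable_funeM; exact: mK.
- move=> n y _.
  have := mulemu_ge0 (fun n => f @^-1` [set n]).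
  by apply; exact: preimage_nnfun0.
apply: eq_fsbigr => r _.
rewrite (integralZl_indic _ (fun r => f @^-1` [set r]))//; last first.
  exact: preimage_nnfun0.
rewrite /= integral_indic// setIT.
have [r0|r0] := leP 0%R r.
  by rewrite ge0_integralZl//; exact: mK.
rewrite preimage_nnfun0// measure0 mule0 integral0_eq// => y _.
by rewrite measure0 mule0.
Qed.

Let integral_bind f : (forall z, 0 <= f z) -> measurable_fun setT f ->
  \int[bind_measure]_z f z = \int[lam]_y (\int[K y]_z f z).
Proof.
move=> f0 mf.
pose f_ := nnsfun_approx measurableT mf.
transitivity (\int[bind_measure]_z (lim ((f_ n z)%:E @[n --> \oo]))).
  by apply/eq_integral => z _; apply/esym/cvg_lim => //=; exact: cvg_nnsfun_approx.
rewrite monotone_convergence//; last 3 first.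
- by move=> n; exact/measurable_EFinP.
- by move=> n z _; rewrite lee_fin.
- by move=> z _ a b ab; rewrite lee_fin; exact/lefP/nd_nnsfun_approx.
rewrite (_ : (fun _ => _) =
    (fun n => \int[lam]_y (\int[K y]_z (f_ n z)%:E)))//; last first.
  by apply/funext => n; rewrite integral_bind_nnsfun.
transitivity (\int[lam]_y lim ((\int[K y]_z (f_ n z)%:E) @[n --> \oo])).
  rewrite -monotone_convergence//; last 3 first.
  - move=> n; apply: measurable_fun_integral_kernel => //.
    + by move=> z; rewrite lee_fin.
    + exact/measurable_EFinP.
  - by move=> n y _; apply: integral_ge0 => // z _; rewrite lee_fin.
  - move=> y _ a b ab; apply: ge0_le_integral => //.
    + by move=> z _; rewrite lee_fin.
    + exact/measurable_EFinP.
    + exact/measurable_EFinP.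
    + by move=> z _; rewrite lee_fin; exact/lefP/nd_nnsfun_approx.
apply: eq_integral => y _; rewrite -monotone_convergence//; last 3 first.
- by move=> n; exact/measurable_EFinP.
- by move=> n z _; rewrite lee_fin.
- by move=> z _ a b ab; rewrite lee_fin; exact/lefP/nd_nnsfun_approx.
by apply: eq_integral => z _; apply/cvg_lim => //; exact: cvg_nnsfun_approx.
Qed.

(** The integral formula, proved for simple functions and then by monotone convergence at both
    levels, is the only access to the mixture used later. Neither [lam] nor the measures [K x] are
    subject to a finiteness condition. *)
Lemma bind_measure_exists : exists m : {measure set T -> \bar R},
  forall f, (forall z, 0 <= f z) -> measurable_fun setT f ->
    \int[m]_z f z = \int[lam]_y \int[K y]_z f z.
Proof. by exists bind_measure; exact: integral_bind. Qed.

End bind_measure.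

Section weighted_pushforward.
Context d d' (X : measurableType d) (T : measurableType d') (R : realType).
Local Open Scope ereal_scope.

Lemma integral_indicT (m : {measure set T -> \bar R}) (B : set T) :
  measurable B -> \int[m]_z (\1_B z)%:E = m B.
Proof. by move=> mB; rewrite integral_indic// setIT. Qed.

(** The image under [phi] of the measure with density [w], obtained as the mixture over [mu] of the
    point masses [w x] at [phi x]. *)
Lemma weighted_pushforward (mu : {measure set X -> \bar R}) (w : X -> R)
    (phi : X -> T) : (forall x, 0 <= w x)%R ->
    measurable_fun setT w -> measurable_fun setT phi ->
  exists m : {measure set T -> \bar R}, forall f : T -> \bar R,
    (forall z, 0 <= f z) -> measurable_fun setT f ->
    \int[m]_z f z = \int[mu]_x ((w x)%:E * f (phi x)).
Proof.
move=> w0 mw mphi.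
pose K x : {measure set T -> \bar R} := mscale (NngNum (w0 x)) (dirac (phi x)).
have mK B : measurable B -> measurable_fun [set: X] (K ^~ B).
  move=> mB; apply: emeasurable_funM; first exact/measurable_EFinP.
  rewrite (_ : (fun x => _) = fun x => (\1_(phi @^-1` B) x)%:E).
    apply/measurable_EFinP/measurable_indic.
    by rewrite -[_ @^-1` _]setTI; exact: mphi.
  by apply/funext => x; rewrite [LHS]diracE indicE.
have [m mE] := bind_measure_exists mu mK; exists m => f f0 mf.
rewrite mE//; apply: eq_integral => x _.
by rewrite ge0_integral_mscale// integral_dirac// diracT mul1e.
Qed.

End weighted_pushforward.

Section mixture.
Context d d1 d' (X : measurableType d) (Y : measurableType d1)
  (T : measurableType d') (R : realType).
Local Open Scope ereal_scope.

(** The fibre over [x] is a weighted pushforward of [mu], picked by choice. Its mass on a set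
    depends measurably on [x] by the measurability part of Tonelli's theorem, which is where [mu]
    has to be sigma-finite. *)
Lemma mixture_measure (lam : {measure set X -> \bar R})
    (mu : {sigma_finite_measure set Y -> \bar R}) (w : X * Y -> R)
    (phi : X * Y -> T) : (forall p, 0 <= w p)%R ->
    measurable_fun setT w -> measurable_fun setT phi ->
  exists m : {measure set T -> \bar R}, forall f : T -> \bar R,
    (forall z, 0 <= f z) -> measurable_fun setT f ->
    \int[m]_z f z = \int[lam]_x \int[mu]_y ((w (x, y))%:E * f (phi (x, y))).
Proof.
move=> w0 mw mphi.
have /choice[K KE] : forall x, exists m : {measure set T -> \bar R},
    forall f : T -> \bar R, (forall z, 0 <= f z) -> measurable_fun setT f ->
    \int[m]_z f z = \int[mu]_y ((w (x, y))%:E * f (phi (x, y))).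
  move=> x; apply: weighted_pushforward => //.
  - exact: measurableT_comp mw (measurable_pair1 _).
  - exact: measurableT_comp mphi (measurable_pair1 _).
have mK B : measurable B -> measurable_fun [set: X] (K ^~ B).
  move=> mB.
  have mB1 : measurable_fun [set: T] (fun z => (\1_B z)%:E : \bar R).
    exact/measurable_EFinP/measurable_indic.
  rewrite (_ : K ^~ B = fun x => \int[mu]_y ((w (x, y))%:E * (\1_B (phi (x, y)))%:E)).
    apply: (@measurable_fun_fubini_tonelli_F _ _ _ _ _ mu
      (fun p => (w p)%:E * (\1_B (phi p))%:E)).
      apply: emeasurable_funM; first exact/measurable_EFinP.
      exact: (measurableT_comp mB1 mphi).
    by move=> p; rewrite mule_ge0// lee_fin.
  by apply/funext => x; rewrite -integral_indicT// KE// => z; rewrite lee_fin.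
have [m mE] := bind_measure_exists lam mK; exists m => f f0 mf.
by rewrite mE//; apply: eq_integral => x _; rewrite KE.
Qed.

End mixture.

(** * Affine substitution and Tonelli's theorem for Lebesgue measure *)

Section affine.
Context {R : realType}.
Local Open Scope ereal_scope.
Local Notation leb := (@lebesgue_measure R).

(** The pushforward of [a] times Lebesgue measure by the affine map has the right value on half-open
    intervals, so it is Lebesgue measure. *)
Lemma lebesgue_integral_affine (a b : R) (f : R -> \bar R) : (0 < a)%R ->
    (forall x, 0 <= f x) -> measurable_fun setT f ->
  \int[leb]_x f x = a%:E * \int[leb]_x f (a * x + b)%R.
Proof.
move=> a0 f0 mf.
have mphi : measurable_fun [set: measurableTypeR R] (fun x => a * x + b : measurableTypeR R)%R.
  by apply: measurable_funD => //; apply: measurable_funM.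
have [m mE] := @weighted_pushforward _ _ (measurableTypeR R) (measurableTypeR R)
  R leb (cst a) _ (fun=> ltW a0) (measurable_cst _) mphi.
transitivity (\int[m]_x f x); last first.
  rewrite mE//= ge0_integralZl//; last by rewrite lee_fin ltW.
  exact: measurableT_comp mf mphi.
apply: eq_measure_integral => A mA _.
apply: lebesgue_measure_unique => //= _ [[c d]] _ <-.
rewrite -[RHS]integral_indicT//.
have mI : measurable_fun [set: measurableTypeR R] (fun x => (\1_`]c, d] x)%:E : \bar R).
  exact/measurable_EFinP/measurable_indic.
rewrite /= (mE _ _ mI)//=.
rewrite ge0_integralZl//; last 2 first.
- exact: (measurableT_comp mI mphi).
- by rewrite lee_fin ltW.
rewrite [X in _ = _ * X](_ : _ = leb `](c - b)%R / a, (d - b)%R / a]%classic)%R.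
  rewrite !lebesgue_measure_itv/= !lte_fin ltr_pM2r ?invr_gt0// ltrD2r.
  case: ifPn => cd; last by rewrite mule0.
  by rewrite -!EFinD -EFinM; congr EFin; field; exact: lt0r_neq0.
rewrite -[RHS]integral_indicT//.
apply: eq_integral => x _; rewrite !indicE; congr (_%:R%:E); congr nat_of_bool.
rewrite !mem_setE !in_itv/= ler_pdivlMr// ltr_pdivrMr// mulrC.
by rewrite ltrBlDr lerBrDr.
Qed.

Lemma integral_mul_indic d (X : measurableType d) (mu : {measure set X -> \bar R})
    (D : set X) (f : X -> \bar R) : measurable D ->
  \int[mu]_(x in D) f x = \int[mu]_x ((\1_D x)%:E * f x).
Proof.
move=> mD; rewrite integral_mkcond; apply: eq_integral => x _.
by rewrite epatch_indic muleC.
Qed.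

Lemma measurable_integral_leb d (X : measurableType d) (F : X * R -> \bar R) :
  measurable_fun setT F -> (forall p, 0 <= F p) ->
  measurable_fun setT (fun x => \int[leb]_y F (x, y)).
Proof. by move=> mF F0; exact: (@measurable_fun_fubini_tonelli_F _ _ _ _ _ leb F mF F0). Qed.

Lemma swap_integral_leb (F : R * R -> \bar R) :
  measurable_fun setT F -> (forall p, 0 <= F p) ->
  \int[leb]_x \int[leb]_y F (x, y) = \int[leb]_y \int[leb]_x F (x, y).
Proof. by move=> mF F0; exact: (@fubini_tonelli _ _ _ _ _ leb leb F mF F0). Qed.

End affine.

Lemma eq_lee (R : realType) (x y : \bar R) : x = y -> (x <= y)%E.
Proof. by move->. Qed.

Section inverse.
Context {R : realType}.

(** Inversion is not continuous at [0]; on each half-line it is, up to signs, the power function of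
    exponent [-1], which is measurable and also takes the value [0] at [0]. *)
Lemma measurable_invr : measurable_fun setT (GRing.inv : R -> R).
Proof.
rewrite (_ : GRing.inv = fun x : R =>
    if 0 <= x then x `^ (- 1) else - ((- x) `^ (- 1))); last first.
  apply/funext => x; case: ifPn => [x0|]; first by rewrite powR_inv1.
  by rewrite -ltNge => /ltW x0; rewrite powR_inv1 ?oppr_ge0// invrN opprK.
apply: measurable_fun_ifT; first exact: measurable_fun_ler.
- exact: measurable_powR.
- apply: measurable_funN; apply: (measurableT_comp (measurable_powR (- 1))).
  exact: measurable_funN.
Qed.

Lemma measurable_funV d (T : measurableType d) (f : T -> R) :
  measurable_fun setT f -> measurable_fun setT (fun x => (f x)^-1).
Proof. exact: (measurableT_comp measurable_invr). Qed.

Lemma measurable_expRN d (T : measurableType d) (f : T -> R) :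
  measurable_fun setT f -> measurable_fun setT (fun x => expR (- f x)).
Proof.
by move=> mf; apply: (measurableT_comp (@measurable_expR R)); exact: measurable_funN.
Qed.

End inverse.

(** * Uniqueness of measures from moments *)

Section moments.
Context {R : realType}.
Implicit Types m : {measure set R -> \bar R}.

Let D : set R := `[0, 1]%classic.

Let mD : measurable D. Proof. exact: measurable_itv. Qed.

Let integrable_bounded m (f : R -> R) : (m setT < +oo)%E ->
    measurable_fun D f -> (forall x, D x -> `|f x| <= 1) ->
  m.-integrable D (EFin \o f).
Proof.
move=> moo mf f1; apply: measurable_bounded_integrable => //.
  by apply: le_lt_trans moo; apply: le_measure; rewrite ?inE.
exists 1; split => // x x1 y Dy; exact: le_trans (f1 _ Dy) (ltW x1).
Qed.

(* With [n] large and [N] about [c ^ n], [peak n N x] approximates the indicator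
   of [x < c^-1], by Bernoulli's inequality. *)
Let peak n N (x : R) := (1 - x ^+ n) ^+ N.

Let peak01 n N x : D x -> 0 <= peak n N x <= 1.
Proof.
rewrite /D /= in_itv/= => /andP[x0 x1].
have H : 0 <= 1 - x ^+ n <= 1 by rewrite subr_ge0 exprn_ile1//= lerBlDr lerDl exprn_ge0.
by case/andP: H => H0 H1; rewrite exprn_ge0//= exprn_ile1.
Qed.

Let mpeak n N : measurable_fun setT (peak n N).
Proof.
by apply: measurable_funX; apply: measurable_funB => //; exact: measurable_funX.
Qed.

Let peak_integrable m n N j : (m setT < +oo)%E ->
  m.-integrable D (fun x => (x ^+ j * peak n N x)%:E).
Proof.
move=> moo; apply: integrable_bounded => //.
  apply: measurable_funTS; apply: measurable_funM => //; exact: measurable_funX.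
move=> x Dx; have /andP[p0 p1] := peak01 n N Dx.
move: Dx; rewrite /D/= in_itv/= => /andP[x0 x1].
have xj0 : 0 <= x ^+ j by exact: exprn_ge0.
have xj1 : x ^+ j <= 1 by exact: exprn_ile1.
by rewrite ger0_norm; [exact: mulr_ile1|exact: mulr_ge0].
Qed.

(** Splitting off one factor [1 - x ^+ n] reduces the identity for [N.+1] to those for [N] with the
    exponents [j] and [j + n]; hence the induction on [N] for all [j] at once. *)
Let peak_integral m1 m2 n N j : (m1 setT < +oo)%E -> (m2 setT < +oo)%E ->
    (forall j, \int[m1]_(x in D) (x ^+ j)%:E = \int[m2]_(x in D) (x ^+ j)%:E)%E ->
  (\int[m1]_(x in D) (x ^+ j * peak n N x)%:E =
   \int[m2]_(x in D) (x ^+ j * peak n N x)%:E)%E.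
Proof.
move=> m1oo m2oo mom; elim: N j => [|N IH] j.
  by under eq_integral do rewrite /peak expr0 mulr1;
    under [RHS]eq_integral do rewrite /peak expr0 mulr1.
have E m : (m setT < +oo)%E -> (\int[m]_(x in D) (x ^+ j * peak n N.+1 x)%:E
   = \int[m]_(x in D) (x ^+ j * peak n N x)%:E
     - \int[m]_(x in D) (x ^+ (j + n) * peak n N x)%:E)%E.
  move=> moo; rewrite -integralB//; [|exact: peak_integrable..].
  apply: eq_integral => x _; rewrite -EFinB; congr EFin.
  by rewrite /peak exprS exprD; ring.
by rewrite !E// !IH.
Qed.

Lemma bernoulli_ge (h : R) n : -1 <= h -> 1 + n%:R * h <= (1 + h) ^+ n.
Proof.
move=> h0; elim: n => [|n IH]; first by rewrite mul0r addr0 expr0.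
have h1 : 0 <= 1 + h by rewrite -lerBlDl sub0r.
rewrite exprS; apply: le_trans (ler_wpM2l h1 IH).
rewrite -subr_ge0 [leRHS](_ : _ = n%:R * h ^+ 2); last by rewrite -natr1; ring.
by rewrite mulr_ge0 ?ler0n ?sqr_ge0.
Qed.

(** With [s = sqrt r], Bernoulli's inequality for [(s^-1) ^+ n] bounds [n s^n] by a constant, and a
    factor [s^n] remains. *)
Let cvg_natmul_expr (r : R) : 0 <= r -> r < 1 ->
  n%:R * r ^+ n @[n --> \oo] --> (0 : R).
Proof.
rewrite le_eqVlt => /predU1P[<- _|r0 r1].
  rewrite (_ : (fun n : nat => _) = cst 0); first exact: cvg_cst.
  by apply/funext => -[|n]; rewrite ?mul0r// expr0n mulr0.
pose s := Num.sqrt r.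
have s0 : 0 < s by rewrite sqrtr_gt0.
have s1 : s < 1 by rewrite -(@sqrtr1 R) ltr_sqrt.
have h0 : 0 < s^-1 - 1 by rewrite subr_gt0 invf_gt1.
apply: (@squeeze_cvgr _ _ _ _ (fun=> 0) (fun n => (s^-1 - 1)^-1 * s ^+ n)).
- near=> n; rewrite mulr_ge0// ?exprn_ge0 ?(ltW r0)//=.
  rewrite -(sqr_sqrtr (ltW r0)) -/s exprAC expr2 mulrA ler_wpM2r ?exprn_ge0 ?(ltW s0)//.
  rewrite -[leRHS]mul1r ler_pdivlMr//.
  have := @bernoulli_ge (s^-1 - 1) n (le_trans (lerN10 _) (ltW h0)).
  have -> : 1 + (s^-1 - 1) = s^-1 by rewrite addrC subrK.
  rewrite exprVn => B; rewrite -[leRHS](mulVf (lt0r_neq0 (exprn_gt0 n s0))).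
  rewrite [leLHS]mulrAC; apply: ler_wpM2r; first by rewrite exprn_ge0// ltW.
  by apply: le_trans B; rewrite lerDr.
- exact: cvg_cst.
- rewrite -[X in _ --> X](mulr0 (s^-1 - 1)^-1); apply: cvgM; first exact: cvg_cst.
  by apply: cvg_expr; rewrite ger0_norm// ltW.
Unshelve. all: by end_near. Qed.

(** The extra factor [n] settles the point [x = a]: there the product of [width a n] and [x ^+ n] is
    at least [n], so the peaks tend to [0]. For [x < a] that product is at most [2 n (x / a)^n] and
    still vanishes in the limit. *)
Let width (a : R) n := (n * (Num.truncn (a^-1 ^+ n)).+1)%N.

Let cvg_peak (a x : R) : 0 < a -> a <= 1 -> D x ->
  peak n (width a n) x @[n --> \oo] --> ((x < a)%R%:R : R).
Proof.
move=> a0 a1 Dx; have := Dx; rewrite /D/= in_itv/= => /andP[x0 x1].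
have c1 : 1 <= a^-1 by rewrite invf_ge1.
have c0 : 0 <= a^-1 by rewrite invr_ge0 ltW.
have cn n : 1 <= a^-1 ^+ n by exact: exprn_ege1.
have [xa|ax] := ltP x a.
- pose r := a^-1 * x.
  have r0 : 0 <= r by rewrite mulr_ge0.
  have r1 : r < 1 by rewrite /r mulrC ltr_pdivrMr// mul1r.
  apply: (@squeeze_cvgr _ _ _ _ (fun n => 1 - 2 * (n%:R * r ^+ n)) (fun=> 1)).
  + near=> n; have /andP[_ ->] := peak01 n (width a n) Dx; rewrite andbT.
    have := @bernoulli_ge (- x ^+ n) (width a n); rewrite lerN2 exprn_ile1// => /(_ isT).
    apply: le_trans; rewrite lerD2l mulrN lerN2 natrM.
    rewrite exprMn mulrCA -mulrA ler_wpM2l// mulrA ler_wpM2r ?exprn_ge0//.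
    rewrite mulr2n mulrDl mul1r -natr1 lerD// truncn_le//.
    exact: le_trans (cn n).
  + rewrite -[X in _ --> X]subr0; apply: cvgB; first exact: cvg_cst.
    rewrite -[X in _ --> X](mulr0 2); apply: cvgM; first exact: cvg_cst.
    exact: cvg_natmul_expr.
  + exact: cvg_cst.
- apply: (@squeeze_cvgr _ _ _ _ (fun=> 0) (fun n => n.+1%:R^-1)).
  + near=> n; have /andP[-> _] /= := peak01 n (width a n) Dx.
    set N := width a n; set y := x ^+ n.
    have y0 : 0 <= y by exact: exprn_ge0.
    have y1 : y <= 1 by exact: exprn_ile1.
    (* Since [(1 - y)^N (1 + y)^N <= 1], a lower bound on [(1 + y)^N] is an upper bound on the
       peak. *)
    have Ny : n.+1%:R <= (1 + y) ^+ N.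
      have := @bernoulli_ge y N (le_trans (lerN10 _) y0).
      apply: le_trans; rewrite -nat1r lerD2l /N natrM -mulrA ler_peMr//.
      apply: le_trans (_ : a^-1 ^+ n * x ^+ n <= _).
        by rewrite -exprMn exprn_ege1// mulrC ler_pdivlMr// mul1r.
      by rewrite ler_wpM2r// ltW// truncnS_gt.
    rewrite -[leRHS]mul1r ler_pdivlMr ?ltr0n//.
    have p0 : 0 <= peak n N x by case/andP: (peak01 n N Dx).
    apply: le_trans (ler_wpM2l p0 Ny) _.
    rewrite /peak -/y -exprMn -subr_sqr expr1n.
    by rewrite exprn_ile1// ?subr_ge0 ?exprn_ile1// lerBlDr lerDl sqr_ge0.
  + exact: cvg_cst.
  + exact: cvg_harmonic.
Unshelve. all: by end_near. Qed.

Let integral_lt m (a : R) : (m setT < +oo)%E -> 0 < a -> a <= 1 ->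
  (\int[m]_(x in D) (x ^+ 0 * peak n (width a n) x)%:E @[n --> \oo]
    --> m (D `&` [set x | (x < a)%R]))%E.
Proof.
move=> moo a0 a1.
have mA : measurable [set x : R | x < a].
  by rewrite (_ : [set x | _] = `]-oo, a[%classic)//; exact/seteqP.
have [] := @dominated_convergence _ _ _ m D mD
  (fun n x => (x ^+ 0 * peak n (width a n) x)%:E)
  (fun x => (\1_[set x | x < a] x)%:E) (cst 1%E).
- move=> n; apply/measurable_EFinP/measurable_funTS; apply: measurable_funM => //.
- exact/measurable_EFinP/measurable_indic.
- apply: aeW => x Dx; apply: cvg_EFin; first by near=> n.
  under eq_fun do rewrite /= expr0 mul1r.
  by rewrite indicE mem_setE; exact: cvg_peak.
- by apply: (@integrable_bounded m (cst 1)) => // x _; rewrite normr1.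
- apply: aeW => x n Dx; have /andP[p0 p1] := peak01 n (width a n) Dx.
  by rewrite expr0 mul1r lee_fin ger0_norm.
by move=> _ _; rewrite integral_indic// setIC.
Unshelve. all: by end_near. Qed.

(** Integrals of the polynomials [peak] are determined by the moments and converge, by dominated
    convergence, to the masses of the rays [x < a], which form a generating family stable under
    intersection. Finiteness of [m2] follows from the moment of order zero. *)
Lemma moment_unique m1 m2 : (m1 setT < +oo)%E ->
    m1 (~` D) = 0%E -> m2 (~` D) = 0%E ->
    (forall j, \int[m1]_(x in D) (x ^+ j)%:E = \int[m2]_(x in D) (x ^+ j)%:E)%E ->
  forall B, measurable B -> m1 B = m2 B.
Proof.
move=> m1oo m10 m20 mom.
have mE m B : m (~` D) = 0%E -> measurable B -> m B = m (D `&` B).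
  move=> m0 mB; rewrite (measureDI m mB mD) setIC.
  rewrite (@subset_measure0 _ _ _ m (B `\` D) (~` D)) ?add0e//.
  - exact: measurableD.
  - exact: measurableC.
have tot m : (\int[m]_(x in D) (x ^+ 0)%:E)%E = m D.
  under eq_integral do rewrite expr0.
  by rewrite integral_cst// mul1e.
have m2oo : (m2 setT < +oo)%E.
  rewrite mE// setIT -tot -mom tot; apply: le_lt_trans m1oo.
  by apply: le_measure; rewrite ?inE.
have mray (a : R) : measurable `]-oo, a[%classic by exact: measurable_itv.
apply: (@measure_unique _ _ _ (@RGenInftyO.G R) (fun n => `]-oo, n%:R[%classic)).
- exact: RGenInftyO.measurableE.
- move=> _ _ [a ->] [b ->]; exists (Num.min a b); apply/seteqP; split => x /=.
    by rewrite !in_itv/= lt_min => -[-> ->].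
  by rewrite !in_itv/= lt_min => /andP[-> ->].
- by move=> i; exists i%:R.
- apply/seteqP; split => // x _; exists (Num.truncn `|x|).+1 => //=.
  by rewrite in_itv/= (le_lt_trans (ler_norm x))// truncnS_gt.
- move=> _ [a ->]; rewrite (mE m1)// (mE m2)//.
  have [a0|a0] := leP a 0.
    rewrite (_ : _ `&` _ = set0) ?measure0//; apply/seteqP; split => // x [].
    rewrite /D/= !in_itv/= => /andP[x0 _] xa.
    by have := lt_le_trans xa (le_trans a0 x0); rewrite ltxx.
  have [a1|a1] := leP a 1.
    have -> : `]-oo, a[%classic = [set x | x < a] by apply/seteqP; split => x /=; rewrite in_itv.
    apply: (@cvg_unique _ (@ereal_hausdorff R) _ _ _ _ (integral_lt m1oo a0 a1)).
    rewrite /= (_ : (fun n => _) = (fun n =>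
      \int[m2]_(x in D) (x ^+ 0 * peak n (width a n) x)%:E)%E).
      exact: integral_lt.
    by apply/funext => n; exact: peak_integral.
  rewrite (_ : _ `&` _ = D); first by rewrite -!tot.
  apply/seteqP; split => x [] //; rewrite /D/= !in_itv/= => /andP[x0 x1].
  by rewrite x0 x1 (le_lt_trans x1).
- move=> k; apply: le_lt_trans m1oo.
  by apply: le_measure; rewrite ?inE.
Qed.

End moments.

(** * Joint laws of a point and of a variable with values in [[0, 1]] *)

Section joint_moments.
Context {R : realType} d d1 d2 (E : measurableType d)
  (X1 : measurableType d1) (X2 : measurableType d2).
Local Open Scope ereal_scope.

(** For a fixed measurable [C], the masses of the rectangles over [C] form a measure on [[0, 1]]
    whose moments are given, so the one-dimensional case applies. Rectangles then determine the two
    image measures on the product. *)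
Lemma joint_moment_unique (mu1 : {measure set X1 -> \bar R})
    (mu2 : {measure set X2 -> \bar R}) (w1 : X1 -> R) (w2 : X2 -> R)
    (e1 : X1 -> E) (e2 : X2 -> E) (f1 : X1 -> R) (f2 : X2 -> R) :
    (forall x, 0 <= w1 x)%R -> (forall x, 0 <= w2 x)%R ->
    measurable_fun setT w1 -> measurable_fun setT w2 ->
    measurable_fun setT e1 -> measurable_fun setT e2 ->
    measurable_fun setT f1 -> measurable_fun setT f2 ->
    (forall x, 0 <= f1 x <= 1)%R -> (forall x, 0 <= f2 x <= 1)%R ->
    \int[mu1]_x (w1 x)%:E < +oo ->
    (forall C j, measurable C ->
      \int[mu1]_x (w1 x * (\1_C (e1 x) * f1 x ^+ j))%:E =
      \int[mu2]_x (w2 x * (\1_C (e2 x) * f2 x ^+ j))%:E) ->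
  forall F : E * R -> \bar R, (forall p, 0 <= F p) -> measurable_fun setT F ->
    \int[mu1]_x ((w1 x)%:E * F (e1 x, f1 x)) =
    \int[mu2]_x ((w2 x)%:E * F (e2 x, f2 x)).
Proof.
move=> w10 w20 mw1 mw2 me1 me2 mf1 mf2 f101 f201 w1oo mom F F0 mF.
have [m1 m1E] := weighted_pushforward mu1 w10 mw1 (measurable_fun_pair me1 mf1).
have [m2 m2E] := weighted_pushforward mu2 w20 mw2 (measurable_fun_pair me2 mf2).
rewrite -m1E// -m2E//.
have setE d' (X : measurableType d') (mu : {measure set X -> \bar R}) (w : X -> R)
    (e : X -> E) (f : X -> R) (m : {measure set (E * R) -> \bar R}) :
    (forall F : E * R -> \bar R, (forall p, 0 <= F p) -> measurable_fun setT F ->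
       \int[m]_z F z = \int[mu]_x ((w x)%:E * F (e x, f x))) ->
    (forall x, 0 <= w x)%R -> measurable_fun setT w ->
    measurable_fun setT e -> measurable_fun setT f -> (forall x, 0 <= f x <= 1)%R ->
    forall C, measurable C -> exists n : {measure set R -> \bar R},
      [/\ forall B, measurable B -> m (C `*` B) = n B,
          n (~` `[0%R, 1%R]%classic) = 0 &
          forall j, \int[n]_(x in `[0%R, 1%R]) (x ^+ j)%:E =
            \int[mu]_x (w x * (\1_C (e x) * f x ^+ j))%:E].
  move=> mE w0 mw me mf f01 C mC.
  have mCe : measurable_fun setT (fun x => \1_C (e x) : R).
    by apply: (measurableT_comp _ me); exact: measurable_indic.
  have wC0 x : (0 <= w x * \1_C (e x))%R by rewrite mulr_ge0.
  have mwC : measurable_fun setT (fun x => w x * \1_C (e x))%R.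
    exact: measurable_funM.
  have [n nE] := weighted_pushforward mu wC0 mwC mf.
  exists n; split.
  - move=> B mB; rewrite -integral_indicT; last exact: measurableX.
    rewrite -integral_indicT// nE//; last exact/measurable_EFinP/measurable_indic.
    rewrite mE//; last by apply/measurable_EFinP/measurable_indic; exact: measurableX.
    apply: eq_integral => x _; rewrite -!EFinM; congr EFin.
    rewrite -mulrA; congr (_ * _)%R; rewrite !indicE in_setX/=.
    by case: (_ \in _); case: (_ \in _); rewrite ?mulr0 ?mulr1.
  - rewrite -integral_indicT//; last exact/measurableC.
    rewrite nE//; last by apply/measurable_EFinP/measurable_indic; exact/measurableC.
    rewrite integral0_eq// => x _; rewrite [X in _ * X%:E]indicE memNset ?mule0//.
    by rewrite /= in_itv/= f01.
  - move=> j; rewrite [LHS]integral_mul_indic// nE//; last first.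
    + apply: emeasurable_funM; apply/measurable_EFinP.
        exact: measurable_indic.
      exact: measurable_funX.
    + move=> z; rewrite indicE mem_setE in_itv/=.
      by case: andP => [[z0 z1]|_]; rewrite ?mul0e// mul1e lee_fin exprn_ge0.
    apply: eq_integral => x _; rewrite -!EFinM; congr EFin.
    by rewrite [X in (X * f x ^+ j)%R]indicE mem_setE in_itv/= f01 mul1r mulrA.
apply: eq_measure_integral => B mB _.
have fin : m1 setT < +oo.
  rewrite -integral_indicT// m1E//; last first.
    exact/measurable_EFinP/measurable_indic.
  by rewrite (eq_integral (fun x => (w1 x)%:E))// => x _; rewrite indicT mule1.
have rect C B' : measurable C -> measurable B' -> m1 (C `*` B') = m2 (C `*` B').
  move=> mC mB'.
  have [n1 [n1E n10 n1m]] := setE _ _ _ _ _ _ _ m1E w10 mw1 me1 mf1 f101 C mC.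
  have [n2 [n2E n20 n2m]] := setE _ _ _ _ _ _ _ m2E w20 mw2 me2 mf2 f201 C mC.
  rewrite n1E// n2E//; apply: moment_unique => //.
  - rewrite -n1E//; apply: le_lt_trans fin.
    by apply: le_measure; rewrite ?inE//; exact: measurableX.
  - by move=> j; rewrite n1m n2m mom.
pose G : set (set (E * R)) := [set A `*` B | A in measurable & B in measurable].
apply: (@measure_unique _ _ _ G (fun _ => setT)) => //.
- by rewrite measurable_prod_measurableType.
- move=> _ _ [A1 mA1 [B1 mB1 <-]] [A2 mA2 [B2 mB2 <-]].
  rewrite -setXI; exists (A1 `&` A2); first exact: measurableI.
  by exists (B1 `&` B2) => //; exact: measurableI.
- by move=> _; exists setT => //; exists setT => //; rewrite setXTT.
- by apply/seteqP; split => // x _; exists 0%N.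
- by move=> _ [A1 mA1 [B1 mB1 <-]]; exact: rect.
Qed.

End joint_moments.

(** * Completely monotone sequences *)

Section urn_dynamics.
Context {R : realType}.
Implicit Types (q : nat -> nat -> R) (s : nat * nat * R).
Local Notation leb := (@lebesgue_measure R).
Local Notation U01 := (`[0, 1[%classic : set R).

(* In state [(i, j)], with uniform variable [v], increment [j] with probability
   [q i j.+1 / q i j] and [i] otherwise, and rescale [v] so that it is uniform
   again given the outcome. *)
Definition urn_step q s : nat * nat * R :=
  let: (i, j, v) := s in let a := q i j.+1 / q i j in
  if v < a then (i, j.+1, v / a) else (i.+1, j, (v - a) / (1 - a)).

Definition urn_run q m s := iter m (urn_step q) s.

Lemma urn_runS q m s : urn_run q m.+1 s = urn_run q m (urn_step q s).
Proof. exact: iterSr. Qed.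

Lemma urn_runD q m n s : urn_run q (m + n) s = urn_run q n (urn_run q m s).
Proof. by rewrite addnC /urn_run iterD. Qed.

Lemma urn_run_le q m i j v : ((urn_run q m (i, j, v)).1.2 <= j + m)%N.
Proof.
elim: m i j v => [|m IH] i j v; first by rewrite addn0.
rewrite urn_runS /=; case: ifP => _; apply: leq_trans (IH _ _ _) _.
- by rewrite addSnnS.
- by rewrite leq_add2l.
Qed.

(** After one step the variable is, on each of two measurable sets, another measurable function of
    [x]. The induction therefore lets the starting variable be an arbitrary measurable [g]. *)
Lemma measurable_urn_run d d' (X : measurableType d) (T : measurableType d')
    (q : nat -> nat -> X -> R) m (F : nat -> nat -> R -> T) :
    (forall i j, measurable_fun setT (q i j)) ->
    (forall i j, measurable_fun setT (F i j)) ->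
  forall i j (g : X -> R), measurable_fun setT g ->
  measurable_fun setT (fun x =>
    let s := urn_run (fun i j => q i j x) m (i, j, g x) in F s.1.1 s.1.2 s.2).
Proof.
move=> mq mF; elim: m => [|m IH] i j g mg.
  exact: (measurableT_comp (mF i j) mg).
pose a x := q i j.+1 x / q i j x.
have ma : measurable_fun setT a.
  by apply: measurable_funM => //; exact: measurable_funV.
rewrite (_ : (fun x => _) = fun x => if g x < a x then
    let s := urn_run (fun i j => q i j x) m (i, j.+1, g x / a x) in F s.1.1 s.1.2 s.2
  else let s := urn_run (fun i j => q i j x) m (i.+1, j, (g x - a x) / (1 - a x)) in
    F s.1.1 s.1.2 s.2); last first.
  by apply/funext => x; rewrite urn_runS /=; case: ifP.
apply: measurable_fun_ifT.
- exact: measurable_fun_ltr.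
- by apply: IH; apply: measurable_funM => //; exact: measurable_funV.
- apply: IH; apply: measurable_funM; first exact: measurable_funB.
  by apply: measurable_funV; exact: measurable_funB.
Qed.

Local Open Scope ereal_scope.

(** The two outcomes occupy [[0, a[] and [[a, 1[], and the rescaling in [urn_step] is the affine map
    of each onto [[0, 1[]. Multiplying by [q i j] clears the ratios; when [q i j] vanishes, both
    successors vanish too. *)
Lemma integral_urn_step q i j (G : nat * nat * R -> \bar R) :
    (forall i j, 0 <= q i j)%R -> q i j = (q i.+1 j + q i j.+1)%R ->
    (forall s, 0 <= G s) -> (forall i j, measurable_fun setT (fun v => G (i, j, v))) ->
  (q i j)%:E * \int[leb]_(v in U01) G (urn_step q (i, j, v)) =
  (q i.+1 j)%:E * \int[leb]_(v in U01) G (i.+1, j, v) +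
  (q i j.+1)%:E * \int[leb]_(v in U01) G (i, j.+1, v).
Proof.
move=> q0 qS G0 mG.
have [qij|qij] := eqVneq (q i j) 0%R.
  have /andP[/eqP q1 /eqP q2] : (q i.+1 j == 0%R) && (q i j.+1 == 0%R).
    by rewrite -paddr_eq0// -qS qij.
  by rewrite qij q1 q2 !mul0e adde0.
have q_gt0 : (0 < q i j)%R by rewrite lt_neqAle eq_sym qij q0.
pose a := (q i j.+1 / q i j)%R.
have a0 : (0 <= a)%R by rewrite divr_ge0.
have aE : (1 - a = q i.+1 j / q i j)%R.
  by apply/eqP; rewrite /a subr_eq -mulrDl -qS divff.
have a1 : (a <= 1)%R by rewrite -subr_ge0 aE divr_ge0.
have scale k l (b c : R) : (0 <= b)%R ->
    b%:E * \int[leb]_(v in U01) G (k, l, v) =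
    \int[leb]_v ((\1_(`[c, c + b[%classic : set R) v)%:E * G (k, l, (v - c) / b)%R).
  rewrite le_eqVlt => /predU1P[<-|b0].
    rewrite addr0 mul0e integral0_eq// => v _.
    by rewrite set_itvco0// indic0 mul0e.
  rewrite (@lebesgue_integral_affine _ b c)//.
  - congr (_ * _); rewrite integral_mul_indic//; apply: eq_integral => v _.
    rewrite addrK mulrC mulfK ?gt_eqF// !indicE !mem_setE !in_itv/=.
    by rewrite lerDr (addrC c b) ltrD2r pmulr_lge0// gtr_pMl.
  - by move=> v; rewrite mule_ge0// lee_fin.
  - apply: emeasurable_funM; first exact/measurable_EFinP/measurable_indic.
    by apply: (measurableT_comp (mG k l)); apply: measurable_funM => //; apply: measurable_funB.
have stepE v : (\1_U01 v)%:E * G (urn_step q (i, j, v)) =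
    (\1_(`[0%R, 0 + a[%classic : set R) v)%:E * G (i, j.+1, (v - 0) / a)%R +
    (\1_(`[a, a + (1 - a)[%classic : set R) v)%:E * G (i.+1, j, (v - a) / (1 - a))%R.
  rewrite /urn_step -/a add0r subr0 (addrC a) subrK !indicE !mem_setE !in_itv/=.
  have [va|av] := ltP v a.
    by rewrite (lt_le_trans va a1)/= mul0e adde0.
  by rewrite andbF mul0e add0e (le_trans a0 av).
rewrite (integral_mul_indic leb (fun v => G (urn_step q (i, j, v))))//.
under eq_integral do rewrite stepE.
have mGs k l (b c : R) (D : set R) : measurable D ->
    measurable_fun setT (fun v => (\1_D v)%:E * G (k, l, (v - c) / b)%R).
  move=> mD; apply: emeasurable_funM; first exact/measurable_EFinP/measurable_indic.
  by apply: (measurableT_comp (mG k l)); apply: measurable_funM => //; apply: measurable_funB.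
have nn k l (b c : R) (D : set R) v : 0 <= (\1_D v)%:E * G (k, l, (v - c) / b)%R.
  by rewrite mule_ge0// lee_fin.
rewrite ge0_integralD//; [|exact: mGs..].
rewrite -!scale// ?subr_ge0// aE ge0_muleDr; last 2 first.
- by rewrite mule_ge0 ?lee_fin// integral_ge0.
- by rewrite mule_ge0 ?lee_fin ?divr_ge0// integral_ge0.
rewrite !muleA -!EFinM addeC /a mulrCA divff// mulr1.
by rewrite mulrCA divff// mulr1.
Qed.

(** The sum of [f] over the endpoints of all [m]-step paths from [(i, j)], each step raising one
    index by one; grouped by endpoint it would be a binomial sum. *)
Fixpoint path_sum (V : nmodType) m (f : nat -> nat -> V) i j : V :=
  if m is m'.+1 then (path_sum m' f i.+1 j + path_sum m' f i j.+1)%R else f i j.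

(** The transition probabilities along a path telescope: every path from [(i, j)] to [(k, l)] has
    probability [q k l / q i j], and given the path the variable is uniform again. *)
Lemma integral_urn_run q m i j (G : nat * nat * R -> \bar R) :
    (forall i j, 0 <= q i j)%R -> (forall i j, q i j = q i.+1 j + q i j.+1)%R ->
    (forall s, 0 <= G s) -> (forall i j, measurable_fun setT (fun v => G (i, j, v))) ->
  (q i j)%:E * \int[leb]_(v in U01) G (urn_run q m (i, j, v)) =
  path_sum m (fun i j => (q i j)%:E * \int[leb]_(v in U01) G (i, j, v)) i j.
Proof.
move=> q0 qS G0 mG; elim: m i j => [//|m IH] i j.
under eq_integral do rewrite urn_runS.
rewrite (integral_urn_step (G := fun s => G (urn_run q m s)))//=.
  by rewrite !IH.
move=> k l; rewrite (_ : (fun v => _) = fun v =>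
    let s := urn_run q m (k, l, v) in G (s.1.1, s.1.2, s.2)); last first.
  by apply/funext => v; case: urn_run => -[].
by apply: (@measurable_urn_run _ _ R _ (fun i j _ => q i j) m
  (fun i j v => G (i, j, v))).
Qed.

Lemma path_sum_EFin m (f : nat -> nat -> R) i j :
  path_sum m (fun i j => (f i j)%:E : \bar R) i j = (path_sum m f i j)%:E.
Proof. by elim: m i j => [|m IH] i j //=; rewrite !IH. Qed.

Local Close Scope ereal_scope.

Lemma path_sumD m (f g : nat -> nat -> R) i j :
  path_sum m (fun i j => f i j + g i j) i j = path_sum m f i j + path_sum m g i j.
Proof. by elim: m i j => [|m IH] i j //=; rewrite !IH addrACA. Qed.

Lemma path_sumZ m (c : R) (f : nat -> nat -> R) i j :
  path_sum m (fun i j => c * f i j) i j = c * path_sum m f i j.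
Proof. by elim: m i j => [|m IH] i j //=; rewrite !IH mulrDr. Qed.

Lemma eq_path_sum (V : nmodType) m (f g : nat -> nat -> V) i j :
  (forall i j, f i j = g i j) -> path_sum m f i j = path_sum m g i j.
Proof. by move=> fg; elim: m i j => [|m IH] i j //=; rewrite !IH. Qed.

(** The definition peels off the first step of a path; this peels off the last one. *)
Lemma path_sumSr m (f : nat -> nat -> R) i j :
  path_sum m.+1 f i j = path_sum m (fun i j => f i.+1 j + f i j.+1) i j.
Proof. by elim: m i j => [|m IH] i j //=; rewrite -!IH. Qed.

Section path_sum_moments.
Variable q : nat -> nat -> R.
Hypothesis qS : forall i j, q i j = q i.+1 j + q i j.+1.

(** Up to the factor [q 0 0], the case [t = 0] gives the factorial moments of the number of ones
    after [m] steps. Peeling off the last step calls for Pascal's rule, which trades one unit of [k]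
    for one unit of the shift [t]; hence the general [t]. *)
Lemma path_sum_bin m k t :
  path_sum m (fun i j => 'C(j, k)%:R * q i (j + t)%N) 0%N 0%N = 'C(m, k)%:R * q 0%N (k + t)%N.
Proof.
elim: m k t => [|m IH] k t.
  by case: k => [|k] //=; rewrite !bin0n !mul0r.
rewrite path_sumSr; case: k => [|k].
  rewrite bin0 -[1%N](bin0 m) -(IH 0%N t); apply: eq_path_sum => i j.
  by rewrite !bin0 !mul1r (qS i (j + t)%N) addSn.
rewrite (@eq_path_sum _ _ _ (fun i j => 'C(j, k.+1)%:R * q i (j + t)%N +
    'C(j, k)%:R * q i (j + t.+1)%N)); last first.
  by move=> i j; rewrite binS natrD addSnnS (qS i (j + t)%N) -addnS; ring.
by rewrite path_sumD !IH binS natrD addSnnS; ring.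
Qed.

Lemma path_sum0 m t i j : path_sum m (fun i j => q i (j + t)%N) i j = q i (j + t)%N.
Proof. by elim: m i j => [//|m IH] i j /=; rewrite !IH -qS. Qed.

(** First moment of the counter from an arbitrary state, and likewise the second moment below. The
    shift [t] is needed because these formulas are applied twice in a row, for two consecutive
    stretches of the run. *)
Lemma path_sum1 m t i j : path_sum m (fun i j => j%:R * q i (j + t)%N) i j =
  j%:R * q i (j + t)%N + m%:R * q i (j + t.+1)%N.
Proof.
elim: m i j => [|m IH] i j /=; first by rewrite mul0r addr0.
rewrite !IH !addSn -!addnS.
by rewrite (qS i (j + t)%N) -addnS (qS i (j + t.+1)%N) -addnS -!natr1; ring.
Qed.

Lemma path_sum2 m t i j : path_sum m (fun i j => j%:R ^+ 2 * q i (j + t)%N) i j =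
  j%:R ^+ 2 * q i (j + t)%N + (j%:R *+ 2 + 1) * m%:R * q i (j + t.+1)%N +
  m%:R * (m%:R - 1) * q i (j + t.+2)%N.
Proof.
elim: m i j => [|m IH] i j /=; first by rewrite mulr0 !mul0r !addr0.
rewrite !IH !addSn -!addnS.
by rewrite (qS i (j + t)%N) -addnS (qS i (j + t.+1)%N) -addnS (qS i (j + t.+2)%N) -addnS -!natr1; ring.
Qed.

End path_sum_moments.


Lemma integral_U01_cst (c : R) : (\int[leb]_(v in U01) c%:E = c%:E)%E.
Proof.
by rewrite integral_cst//= lebesgue_measure_itv/= lte_fin ltr01 oppr0 adde0 mule1.
Qed.

(** * Almost everywhere convergence of the urn frequency, and the moments of its limit *)

Section urn_frequency.
Variable q : nat -> nat -> R.
Hypothesis q_ge0 : forall i j, 0 <= q i j.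
Hypothesis qS : forall i j, q i j = q i.+1 j + q i j.+1.

Definition ones m (v : R) := (urn_run q m (0%N, 0%N, v)).1.2.

Lemma measurable_urn d (T : measurableType d) m (F : nat -> R -> T) i j :
  (forall k, measurable_fun setT (F k)) ->
  measurable_fun setT (fun v => F (urn_run q m (i, j, v)).1.2 (urn_run q m (i, j, v)).2).
Proof.
by move=> mF; exact: (@measurable_urn_run _ _ R _ (fun i j _ => q i j) m (fun=> F)).
Qed.

Lemma integral_ones m i j (h : nat -> R) : (forall k, 0 <= h k) ->
  ((q i j)%:E * \int[leb]_(v in U01) (h (urn_run q m (i, j, v)).1.2)%:E)%E =
  (path_sum m (fun i j => q i j * h j) i j)%:E.
Proof.
move=> h0; rewrite (integral_urn_run m i j (G := fun s => (h s.1.2)%:E))//; last 2 first.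
- by move=> s; rewrite lee_fin.
- by move=> k l; rewrite /=.
rewrite -path_sum_EFin.
by elim: m i j => [|m IH] i j /=; rewrite ?IH// integral_U01_cst -EFinM.
Qed.

Lemma integral_bin_ones m k :
  ((q 0 0)%:E * \int[leb]_(v in U01) ('C(ones m v, k)%:R)%:E)%E =
  ('C(m, k)%:R * q 0 k)%:E.
Proof.
rewrite (integral_ones m 0 0 (h := fun j => 'C(j, k)%:R))//; congr EFin.
rewrite -[k in q 0 k]addn0 -path_sum_bin//.
by apply: eq_path_sum => i j; rewrite addn0 mulrC.
Qed.

(** Heuristically, given the limit [Z] the steps are independent Bernoulli variables of parameter
    [Z], and [q 0 1 - q 0 2] is [q 0 0] times the mean of [Z (1 - Z)]. The proof is exact and makes
    no use of a limit: it computes second moments over the last [m] steps from an arbitrary state,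
    then over the first [n]. *)
Lemma integral_freq_sub n m : (0 < n)%N ->
  ((q 0 0)%:E * \int[leb]_(v in U01)
     (((ones n v)%:R / n%:R - (ones (n + m) v)%:R / (n + m)%:R) ^+ 2)%:E)%E =
  ((n%:R^-1 - (n + m)%:R^-1) * (q 0 1 - q 0 2))%:E.
Proof.
move=> n0.
pose c : R := n%:R^-1; pose e : R := (n + m)%:R^-1.
pose G (s : nat * nat * R) : \bar R :=
  ((s.1.2%:R * c - (urn_run q m s).1.2%:R * e) ^+ 2)%:E.
transitivity ((q 0 0)%:E * \int[leb]_(v in U01) G (urn_run q n (0%N, 0%N, v)))%E.
  by congr (_ * _)%E; apply: eq_integral => v _; rewrite /G /ones urn_runD.
rewrite integral_urn_run//; last 2 first.
- by move=> s; rewrite lee_fin sqr_ge0.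
- move=> i j; apply: (measurable_urn m
    (F := fun k _ => ((j%:R * c - k%:R * e) ^+ 2)%:E)) => // k.
have inner i j : ((q i j)%:E * \int[leb]_(v in U01) G (i, j, v))%E =
    ((c - e) ^+ 2 * (j%:R ^+ 2 * q i (j + 0)%N) +
     (2 * e ^+ 2 * m%:R - 2 * c * e * m%:R) * (j%:R * q i (j + 1)%N) +
     e ^+ 2 * m%:R * q i (j + 1)%N + e ^+ 2 * (m%:R * (m%:R - 1)) * q i (j + 2)%N)%:E.
  rewrite /G/= (integral_ones m i j (h := fun k => (j%:R * c - k%:R * e) ^+ 2)); last first.
    by move=> k; exact: sqr_ge0.
  congr EFin.
  rewrite (@eq_path_sum _ _ _ (fun k l => (j%:R * c) ^+ 2 * q k (l + 0)%N +
    (- (2 * (j%:R * c) * e)) * (l%:R * q k (l + 0)%N) + e ^+ 2 * (l%:R ^+ 2 * q k (l + 0)%N))); last first.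
    by move=> k l; rewrite addn0; ring.
  rewrite !path_sumD !path_sumZ path_sum0// path_sum1// path_sum2//.
  by rewrite addn0 addn1 addn2; ring.
rewrite (eq_path_sum n _ _ inner) path_sum_EFin; congr EFin.
rewrite !path_sumD !path_sumZ path_sum2// path_sum1//.
rewrite !path_sum0// !addn0 !add0n /c /e natrD.
have [nN mN] : n%:R != 0 :> R /\ n%:R + m%:R != 0 :> R.
  by rewrite -natrD !pnatr_eq0 addn_eq0 (gtn_eqF n0).
by field; rewrite nN mN.
Qed.

(* Along the times [4 ^ k] the mean square increments of the frequency are
   summable, so the frequency converges almost everywhere. *)
Definition freq k (v : R) : R := (ones (4 ^ k) v)%:R / (4 ^ k)%:R.

(** An upper limit is defined for every [v], lies in [[0, 1]] without exception, and is measurable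
    jointly in [v] and in any parameter of [q]. *)
Definition urn_limit (v : R) : R := fine (limn_esup (fun k => (freq k v)%:E)).

Lemma freq01 k v : 0 <= freq k v <= 1.
Proof.
rewrite divr_ge0//= ler_pdivrMr ?ltr0n ?expn_gt0// mul1r ler_nat.
exact: (urn_run_le q (4 ^ k) 0 0 v).
Qed.

Lemma limn_esup_freq01 v :
  (0 <= limn_esup (fun k => (freq k v)%:E : \bar R) <= 1)%E.
Proof.
rewrite limn_esup_lim; apply/andP; split.
- apply: lime_ge; first exact: is_cvg_esups.
  near=> n; apply: le_trans (ereal_sup_ubound _); last by exists n => //=.
  by rewrite lee_fin; case/andP: (freq01 n v).
- apply: lime_le; first exact: is_cvg_esups.
  near=> n; apply: ge_ereal_sup => _ [k _ <-].
  by rewrite lee_fin; case/andP: (freq01 k v).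
Unshelve. all: by end_near. Qed.

Lemma urn_limit01 v : 0 <= urn_limit v <= 1.
Proof.
have /andP[l0 l1] := limn_esup_freq01 v.
by rewrite -!lee_fin /urn_limit fineK ?l0// ge0_fin_numE// (le_lt_trans l1) ?ltry.
Qed.

Lemma measurable_freq k : measurable_fun setT (freq k).
Proof.
by apply: (measurable_urn (4 ^ k) 0 0
  (F := fun (j : nat) (_ : R) => j%:R / (4 ^ k)%:R : R)).
Qed.

Lemma integral_freq_dist k : 0 < q 0%N 0%N ->
  (\int[leb]_(v in U01) (`|freq k v - freq k.+1 v|)%:E <= (2 * 2^-1 ^+ k)%:E)%E.
Proof.
move=> q00.
have msub : measurable_fun setT (fun v => freq k v - freq k.+1 v).
  by apply: measurable_funB; exact: measurable_freq.
have E2 : (\int[leb]_(v in U01) ((freq k v - freq k.+1 v) ^+ 2)%:E <=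
    (4^-1 ^+ k)%:E)%E.
  rewrite -(@lee_pmul2l _ (q 0%N 0%N)%:E)//.
  have n0 : (0 < 4 ^ k)%N by rewrite expn_gt0.
  rewrite /freq (_ : 4 ^ k.+1 = 4 ^ k + 3 * 4 ^ k)%N; last first.
    by rewrite expnS -[X in (X + _)%N]mul1n -mulnDl.
  rewrite integral_freq_sub// -EFinM lee_fin.
  set N := (4 ^ k + _)%N.
  have N0 : 0 <= N%:R^-1 :> R by rewrite invr_ge0.
  have q1 : q 0%N 1%N <= q 0%N 0%N by rewrite (qS 0 0) lerDr.
  have nE : (4 ^ k)%:R^-1 = 4^-1 ^+ k :> R by rewrite natrX exprVn.
  rewrite mulrC; apply: ler_pM => //.
  - by rewrite subr_ge0 (qS 0 1) lerDr.
  - by rewrite subr_ge0 lef_pV2 ?posrE ?ltr0n ?addn_gt0 ?n0// ler_nat leq_addr.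
  - by rewrite lerBlDr (le_trans q1)// lerDl.
  - by rewrite nE lerBlDr lerDl.
(* From mean square to mean absolute value: the scale [2^-k] balances the two terms, since the mean
   square is at most [4^-k]. *)
have AG (x : R) : `|x| <= 2^-1 ^+ k + 2 ^+ k * x ^+ 2.
  have h0 : 0 < 2^-1 ^+ k :> R by rewrite exprn_gt0.
  have -> : 2 ^+ k = (2^-1 ^+ k)^-1 :> R by rewrite exprVn invrK.
  rewrite -real_normK ?num_real//; set y := `|x|; set h := _ ^+ k.
  rewrite -subr_ge0 -(pmulr_lge0 _ h0) -/h.
  have -> : (h + h^-1 * y ^+ 2 - y) * h = (h - y) ^+ 2 + h * y.
    by field; exact: lt0r_neq0.
  by rewrite addr_ge0 ?sqr_ge0// mulr_ge0 ?(ltW h0)// normr_ge0.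
apply: (@le_trans _ _ (\int[leb]_(v in U01) ((2^-1 ^+ k)%:E + (2 ^+ k)%:E *
    ((freq k v - freq k.+1 v) ^+ 2)%:E))%E).
  apply: ge0_le_integral => //.
  - by apply/measurable_EFinP/measurable_funTS; exact: measurableT_comp.
  - apply: emeasurable_funD => //; apply: emeasurable_funM => //.
    by apply/measurable_EFinP/measurable_funTS; exact: measurable_funX.
  - by move=> v _; rewrite -EFinM -EFinD lee_fin.
rewrite ge0_integralD//; last first.
- apply: emeasurable_funM => //.
  by apply/measurable_EFinP/measurable_funTS; exact: measurable_funX.
- by move=> v _; rewrite -EFinM lee_fin mulr_ge0 ?sqr_ge0.
rewrite integral_U01_cst ge0_integralZl//; last first.
- by move=> v _; rewrite lee_fin sqr_ge0.
- by apply/measurable_EFinP/measurable_funTS; exact: measurable_funX.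
rewrite mulr2n mulrDl mul1r EFinD leeD2l//.
apply: (le_trans (lee_wpmul2l _ E2)); first by rewrite lee_fin.
rewrite -EFinM lee_fin -exprMn le_eqVlt; apply/orP; left; apply/eqP.
by congr (_ ^+ k); field.
Qed.

Lemma cvg_freq_ae : 0 < q 0%N 0%N ->
  {ae leb, forall v, U01 v -> freq k v @[k --> \oo] --> urn_limit v}.
Proof.
move=> q00.
have mdist k : measurable_fun U01 (fun v => (`|freq k v - freq k.+1 v|)%:E : \bar R).
  apply/measurable_EFinP/measurable_funTS/measurableT_comp => //.
  by apply: measurable_funB; exact: measurable_freq.
pose S v : \bar R := (\sum_(0 <= k <oo) (`|freq k v - freq k.+1 v|)%:E)%E.
have S_ge0 v : (0 <= S v)%E by apply: nneseries_ge0 => k _ _; rewrite lee_fin.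
have Sint : leb.-integrable U01 S.
  apply/integrableP; split.
    rewrite /S; apply: (@ge0_emeasurable_sum _ _ _ U01
      (fun k v => (`|freq k v - freq k.+1 v|)%:E) xpredT) => //.
  under eq_integral do rewrite gee0_abs//.
  rewrite integral_nneseries//; apply: (@le_lt_trans _ _ 4%:E); last exact: ltry.
  apply: lime_le.
    by apply: is_cvg_nneseries => k _ _; apply: integral_ge0 => v _; rewrite lee_fin.
  near=> n; apply: (@le_trans _ _ (4 - 4 * 2^-1 ^+ n)%:E); last first.
    by rewrite lee_fin lerBlDr lerDl mulr_ge0.
  elim: (n) => [|m IH]; first by rewrite big_geq// expr0 mulr1 subrr.
  rewrite big_nat_recr//=; apply: le_trans (leeD IH (integral_freq_dist m q00)) _.
  rewrite -EFinD lee_fin exprS le_eqVlt; apply/orP; left; apply/eqP.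
  by field.
have mU : measurable (U01 : set (measurableTypeR R)) by exact: measurable_itv.
have := integrable_ae mU Sint.
apply: filterS => v /[apply] Sfin.
suff cv : cvgn (fun k => freq k v).
  have cvE : (freq k v)%:E @[k --> \oo] --> (limn (freq^~ v))%:E.
    by apply: cvg_EFin; [near=> n|exact: cv].
  by rewrite /urn_limit (is_cvg_limn_esupE (cvgP _ cvE)) (cvg_lim _ cvE).
have : cvgn (series (telescope (fun k => freq k v))).
  apply: normed_cvg; apply: nondecreasing_is_cvgn.
    by apply: nondecreasing_series => k _ _; exact: normr_ge0.
  exists (fine (S v)) => _ [n _ <-].
  rewrite -lee_fin fineK// /series/= -sumEFin.
  under eq_bigr do rewrite /telescope distrC.
  by apply: nneseries_lim_ge => k _; rewrite lee_fin.
rewrite telescopeK => cv.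
rewrite (_ : (fun k => freq k v) = (fun k => (freq k v - freq 0 v) + freq 0 v)).
  by apply: is_cvgD => //; exact: is_cvg_cst.
by apply/funext => k; rewrite subrK.
Unshelve. all: by end_near. Qed.

(** The quotient is the probability of drawing [k] ones without replacement from the first [4^n]
    outcomes; in the limit replacement makes no difference. *)
Lemma cvg_bin_ratio k v : freq n v @[n --> \oo] --> urn_limit v ->
  'C(ones (4 ^ n) v, k)%:R / 'C(4 ^ n, k)%:R @[n --> \oo] --> urn_limit v ^+ k.
Proof.
move=> cv; elim: k => [|k IH].
  under eq_fun do rewrite !bin0 divr1.
  by rewrite expr0; exact: cvg_cst.
have inv0 : (4 ^ n)%:R^-1 @[n --> \oo] --> (0 : R).
  under eq_fun do rewrite natrX -exprVn.
  by apply: cvg_expr; rewrite ger0_norm// invf_lt1// ltr1n.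
rewrite exprS.
(* Passing from [k] to [k + 1] multiplies the quotient by [(J - k) / (N - k)], written here with
   numerator and denominator divided by [N = 4^n]. *)
apply: (@cvg_trans _ (((freq n v - k%:R * (4 ^ n)%:R^-1) / (1 - k%:R * (4 ^ n)%:R^-1) *
    ('C(ones (4 ^ n) v, k)%:R / 'C(4 ^ n, k)%:R)) @[n --> \oo])); last first.
  apply: cvgM => //.
  rewrite -[X in _ --> X](_ : (urn_limit v - k%:R * 0) / (1 - k%:R * 0) = _); last first.
    by rewrite mulr0 !subr0 divr1.
  apply: cvgM; first by apply: cvgB => //; apply: cvgM => //; exact: cvg_cst.
  apply: cvgV; first by rewrite mulr0 subr0 oner_eq0.
  by apply: cvgB; [exact: cvg_cst|apply: cvgM => //; exact: cvg_cst].
apply: near_eq_cvg; near=> n.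
have kn : (k < 4 ^ n)%N.
  apply: (@leq_trans (4 ^ k)); first exact: ltn_expl.
  by rewrite leq_pexp2l//; near: n; exact: nbhs_infty_ge.
set J := ones (4 ^ n) v; set N := (4 ^ n)%N in kn *.
have binS' m : k.+1%:R * 'C(m, k.+1)%:R = (m%:R - k%:R) * 'C(m, k)%:R :> R.
  rewrite -natrM mul_bin_left natrM; have [mk|km] := ltnP m k.
    by rewrite bin_small// !mulr0.
  by rewrite natrB.
have NR : N%:R != 0 :> R by rewrite pnatr_eq0 -lt0n (leq_trans _ kn).
have NkR : N%:R - k%:R != 0 :> R by rewrite subr_eq0 eqr_nat gtn_eqF.
have CN : 'C(N, k)%:R != 0 :> R by rewrite pnatr_eq0 -lt0n bin_gt0 ltnW.
have k1 : k.+1%:R != 0 :> R by rewrite pnatr_eq0.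
have binE m : 'C(m, k.+1)%:R = (m%:R - k%:R) * 'C(m, k)%:R / k.+1%:R :> R.
  by rewrite -binS' mulrAC divff// mul1r.
rewrite !binE /freq -/J -/N.
move: (k.+1%:R) k1 {binE binS'} => c c0.
by field; rewrite CN NR NkR c0.
Unshelve. all: by end_near. Qed.

(** Hausdorff's moment theorem. By [integral_bin_ones] the binomial quotients have exactly the
    integral [q 0 k / q 0 0] as soon as [k <= 4 ^ n]; they are bounded by [1] and converge to the
    [k]-th power of the limit. *)
Lemma integral_urn_limit k :
  ((q 0 0)%:E * \int[leb]_(v in U01) (urn_limit v ^+ k)%:E = (q 0 k)%:E)%E.
Proof.
have [q00|q00] := eqVneq (q 0%N 0%N) 0.
  have q_le : q 0%N k <= q 0%N 0%N.
    by elim: k => // k; apply: le_trans; rewrite (qS 0 k) lerDr.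
  suff -> : q 0%N k = 0 by rewrite q00 mul0e.
  by apply/eqP; rewrite eq_le q_ge0 andbT -q00.
have q_gt0 : 0 < q 0%N 0%N by rewrite lt_neqAle eq_sym q00 q_ge0.
have mU : measurable (U01 : set (measurableTypeR R)) by exact: measurable_itv.
pose f n v : \bar R := ('C(ones (4 ^ n) v, k)%:R / 'C(4 ^ n, k)%:R)%:E.
have mf n : measurable_fun setT (f n).
  apply/measurable_EFinP.
  by apply: (measurable_urn (4 ^ n) 0 0
    (F := fun (j : nat) (_ : R) => 'C(j, k)%:R / 'C(4 ^ n, k)%:R : R)).
have fint n : (k <= 4 ^ n)%N -> ((q 0 0)%:E * \int[leb]_(v in U01) f n v = (q 0 k)%:E)%E.
  move=> kn; have C0 : 'C(4 ^ n, k)%:R != 0 :> R.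
    by rewrite pnatr_eq0 -lt0n bin_gt0.
  rewrite /f; under eq_integral do rewrite mulrC EFinM.
  rewrite ge0_integralZl//; last first.
    apply/measurable_EFinP/measurable_funTS.
    by apply: (measurable_urn (4 ^ n) 0 0 (F := fun (j : nat) (_ : R) => 'C(j, k)%:R : R)).
  by rewrite muleCA integral_bin_ones -EFinM mulrA mulVf// mul1r.
have [] := @dominated_convergence _ _ _ leb U01 mU f
  (fun v => (urn_limit v ^+ k)%:E) (cst 1%E).
- by move=> n; exact: (@measurable_funTS _ _ (measurableTypeR R) _ _ _ (mf n)).
- apply/measurable_EFinP/measurable_funX/measurable_funTS.
  apply: (@measurableT_comp _ _ _ _ _ _ fine) => //.
  by apply: measurable_fun_limn_esup => n; apply/measurable_EFinP; exact: measurable_freq.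
- have := cvg_freq_ae q_gt0.
  apply: (@filterS _ _ (ae_filter_ringOfSetsType (@lebesgue_measure R))) => v /[apply] cv.
  by apply: cvg_EFin; [near=> n|exact: cvg_bin_ratio].
- apply/integrableP; split => //.
  under eq_integral do rewrite /= normr1.
  by rewrite integral_U01_cst ltry.
- apply: aeW => v n _; rewrite /f/= lee_fin ger0_norm ?divr_ge0//.
  have [->|C0] := eqVneq ('C(4 ^ n, k)) 0%N; first by rewrite invr0 mulr0.
  rewrite ler_pdivrMr ?ltr0n ?lt0n// mul1r ler_nat leq_bin2l//.
  exact: (urn_run_le q (4 ^ n) 0 0 v).
move=> lint _ /= cvint.
have /(cvg_unique (@ereal_hausdorff R)) : ((q 0 0)%:E * \int[leb]_(v in U01) f n v
    @[n --> \oo] --> (q 0 0)%:E * \int[leb]_(v in U01) (urn_limit v ^+ k)%:E)%E.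
  apply: cvgeZl => //.
apply; apply: cvg_near_cst; near=> n; apply: fint.
apply: (@leq_trans (4 ^ k)); first exact/ltnW/ltn_expl.
by rewrite leq_pexp2l//; near: n; exact: nbhs_infty_ge.
Unshelve. all: by end_near. Qed.

End urn_frequency.

Lemma measurable_urn_limit d (X : measurableType d) (q : nat -> nat -> X -> R) :
  (forall i j, measurable_fun setT (q i j)) ->
  measurable_fun setT (fun p : X * R => urn_limit (fun i j => q i j p.1) p.2).
Proof.
move=> mq; apply: (@measurableT_comp _ _ _ _ _ _ fine) => //.
apply: measurable_fun_limn_esup => n; apply/measurable_EFinP.
apply: (@measurable_urn_run _ _ _ R (fun i j p => q i j p.1) (4 ^ n)
  (fun _ j _ => j%:R / (4 ^ n)%:R)) => //.
by move=> i j; exact: (measurableT_comp (mq i j) measurable_fst).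
Qed.

End urn_dynamics.

(** * Completely monotone functions *)

Section completely_monotone.
Context {R : realType}.
Implicit Types f : R -> R.

Lemma near_pos (r : R) : 0 < r -> \forall x \near r, 0 < x.
Proof. by move=> r0; exact: lt_nbhsr. Qed.

(** The derivatives are prescribed on the positive half-line only; since differentiation is local,
    this identifies the iterated derivative there, whatever [F 0] is elsewhere. *)
Lemma completely_monotone_intro (F : nat -> R -> R) :
    (forall n (r : R), 0 < r -> is_derive r 1 (F n) (F n.+1 r)) ->
    (forall n (r : R), 0 < r -> 0 <= (-1) ^+ n * F n r) ->
  completely_monotone (F 0%N).
Proof.
move=> dF F0.
have E n r : 0 < r -> derive1n n (F 0%N) r = F n r.
  elim: n r => [//|n IH] r r0.
  rewrite derive1nS derive1E.
  rewrite (@near_eq_derive _ _ _ _ (F n)).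
    by have [] := dF n r r0.
  by near=> x; apply: IH; near: x; exact: near_pos.
split=> n r r0; last by rewrite E// F0.
apply: (@near_eq_derivable _ _ _ (F n)).
  by near=> x; rewrite E//; near: x; exact: near_pos.
by have [] := dF n r r0.
Unshelve. all: by end_near. Qed.

Lemma is_derive_derive1n f n (r : R) : completely_monotone f -> 0 < r ->
  is_derive r 1 (derive1n n f) (derive1n n.+1 f r).
Proof.
move=> [df _] r0; apply: DeriveDef; first exact: df.
by rewrite derive1nS derive1E.
Qed.

Lemma completely_monotone_ge0 f (r : R) : completely_monotone f -> 0 < r -> 0 <= f r.
Proof. by move=> [_ /(_ 0%N r)]; rewrite expr0 mul1r. Qed.

Lemma completely_monotone_continuous f (r : R) : completely_monotone f -> 0 < r ->
  {for r, continuous f}.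
Proof.
move=> [df _] r0; have := df 0%N r r0; rewrite derive1n0 => /derivable1_diffP.
exact: differentiable_continuous.
Qed.

Lemma alternating_nincr f n (r s : R) : completely_monotone f -> 0 < r -> r <= s ->
  (-1) ^+ n * derive1n n f s <= (-1) ^+ n * derive1n n f r.
Proof.
move=> cmf r0 rs.
pose g (x : R) : R := (-1) ^+ n * derive1n n f x.
have dg (x : R) : 0 < x -> is_derive x 1 g ((-1) ^+ n * derive1n n.+1 f x).
  by move=> x0; apply: is_deriveZ; exact: is_derive_derive1n.
have pos (x : R) : x \in `[r, s] -> 0 < x.
  by rewrite in_itv/= => /andP[rx _]; exact: lt_le_trans rx.
apply: (@ler0_derive1_nincr _ g r s) => //.
- by move=> x /subset_itv_oo_cc/pos/dg[].
- move=> x /subset_itv_oo_cc/pos x0; rewrite derive1E.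
  have [_ ->] := dg x x0.
  have := cmf.2 n.+1 x x0; rewrite exprS mulN1r mulNr oppr_ge0.
  by [].
- apply: continuous_in_subspaceT => x /[!inE]/= /pos/dg[d _].
  by apply: differentiable_continuous; exact/derivable1_diffP.
Qed.

Lemma completely_monotone_nincr f (r s : R) : completely_monotone f -> 0 < r -> r <= s ->
  f s <= f r.
Proof. by move=> cmf r0 rs; have := alternating_nincr 0 cmf r0 rs; rewrite !mul1r. Qed.

Lemma completely_monotone_diff f (h : R) : completely_monotone f -> 0 < h ->
  completely_monotone (fun u => f u - f (u + h)).
Proof.
move=> cmf h0.
apply: (completely_monotone_intro
  (F := fun n u => derive1n n f u - derive1n n f (u + h))).
- move=> n r r0; apply: is_deriveB; first exact: is_derive_derive1n.
  have rh : 0 < r + h by exact: addr_gt0.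
  have dsh : is_derive r 1 (fun u => u + h) 1.
    rewrite -[X in is_derive _ _ _ X]addr0.
    exact: is_deriveD.
  have := @is_derive1_comp R (derive1n n f) (fun u => u + h) r _ 1
    (is_derive_derive1n n cmf rh) dsh.
  by rewrite mulr1.
- move=> n r r0; rewrite mulrBr subr_ge0; apply: alternating_nincr => //.
  by rewrite lerDl ltW.
Qed.

(** Sampling starts at [h] and not at [0], because a completely monotone function may blow up at the
    origin. *)
Definition difference_array (h : R) f i j : R :=
  iter i (fun (f : R -> R) u => f u - f (u + h)) f (h *+ j.+1).

Lemma difference_arrayS (h : R) f i j :
  difference_array h f i j = difference_array h f i.+1 j + difference_array h f i j.+1.
Proof. by rewrite /difference_array iterS -mulrSr subrK. Qed.

Lemma difference_array_ge0 (h : R) f i j : completely_monotone f -> 0 < h ->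
  0 <= difference_array h f i j.
Proof.
move=> cmf h0; rewrite /difference_array.
have : completely_monotone (iter i (fun (f : R -> R) u => f u - f (u + h)) f).
  by elim: i => [//|i IH]; rewrite iterS; exact: completely_monotone_diff.
by move/completely_monotone_ge0; apply; rewrite pmulrn_rgt0.
Qed.

Local Notation leb := (@lebesgue_measure R).
Local Notation U01 := (`[0, 1[%classic : set R).

(** If [f u = int e^(-u s) m(ds)] and [f h > 0], this variable is distributed as [e^(-h s)] under
    the probability proportional to [e^(-h s) m(ds)]; the tilting reflects that the samples start at
    [h]. *)
Definition bernstein (h : R) f : R -> R := urn_limit (difference_array h f).

Lemma bernstein01 (h : R) f v : 0 <= bernstein h f v <= 1.
Proof. exact: urn_limit01. Qed.

Lemma measurable_bernstein (h : R) f : measurable_fun setT (bernstein h f).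
Proof.
have mq i j : measurable_fun setT (fun _ : R => difference_array h f i j).
  exact: measurable_cst.
have mdiag : measurable_fun setT (fun v : R => (v, v)).
  exact: measurable_fun_pair.
exact: (measurableT_comp (measurable_urn_limit mq) mdiag).
Qed.

Lemma integral_bernstein (h : R) f k : completely_monotone f -> 0 < h ->
  ((f h)%:E * \int[leb]_(v in U01) (bernstein h f v ^+ k)%:E = (f (h *+ k.+1))%:E)%E.
Proof.
move=> cmf h0; have := @integral_urn_limit R (difference_array h f) _ _ k.
rewrite /difference_array/=; apply.
- by move=> i j; exact: difference_array_ge0.
- exact: difference_arrayS.
Qed.

(* At [z = 0] the value is [0], since [0^-1 = 0]. *)
Definition pow_pred (u z : R) : R := z `^ u / `|z|.

Lemma pow_pred_ge0 u z : 0 <= pow_pred u z.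
Proof. by rewrite divr_ge0// powR_ge0. Qed.

Lemma measurable_pow_pred u : measurable_fun setT (pow_pred u).
Proof.
apply: measurable_funM; first exact: measurable_powR.
by apply: (measurable_funV (f := fun x : R => `|x|)); exact: normr_measurable.
Qed.

(* [bernstein 1 f] and the [K]-th power of [bernstein K^-1 f] have the same
   moments against the respective weights, hence the same law. *)
Lemma bernstein_rat f (K j : nat) : completely_monotone f -> (0 < K)%N ->
  ((f 1)%:E * \int[leb]_(v in U01) (pow_pred (j.+2%:R / K%:R) (bernstein 1 f v))%:E =
   (f (j.+2%:R / K%:R))%:E)%E.
Proof.
move=> cmf K0.
have KR : 0 < K%:R^-1 :> R by rewrite invr_gt0 ltr0n.
pose Z := bernstein 1 f; pose ZK := bernstein K%:R^-1 f.
have Z01 v : 0 <= Z v <= 1 by exact: bernstein01.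
have ZK01 v : 0 <= ZK v <= 1 by exact: bernstein01.
have ZK0 v : 0 <= ZK v by case/andP: (ZK01 v).
have mZ := measurable_bernstein 1 f; have mZK := measurable_bernstein K%:R^-1 f.
pose w1 (v : R) : R := f 1 * \1_U01 v.
(* The samples with step [1/K] start at [1/K]; the power [K - 1] moves the start to [1], so that the
   moments of [ZK ^+ K] become the values of [f] at the positive integers, as for [Z]. *)
pose w2 (v : R) : R := f K%:R^-1 * \1_U01 v * ZK v ^+ K.-1.
have f0 (r : R) : 0 < r -> 0 <= f r by exact: completely_monotone_ge0.
have mU : measurable_fun setT (\1_U01 : R -> R) by exact: measurable_indic.
have intE (g : R -> R) (c : R) : measurable_fun setT g -> (forall v, 0 <= g v) ->
    0 <= c ->
    (\int[leb]_v (c * \1_U01 v * g v)%:E = c%:E * \int[leb]_(v in U01) (g v)%:E)%E.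
  move=> mg g0 c0.
  rewrite -ge0_integralZl//; last 2 first.
  - by apply/measurable_EFinP; exact: measurable_funTS.
  - by move=> v _; rewrite lee_fin.
  rewrite [RHS]integral_mul_indic//.
  by apply: eq_integral => v _; rewrite -!EFinM mulrCA mulrA.
have w1_ge0 v : 0 <= w1 v by rewrite mulr_ge0 ?f0.
have w2_ge0 v : 0 <= w2 v by rewrite !mulr_ge0 ?f0// exprn_ge0.
have f201 v : 0 <= ZK v ^+ K <= 1.
  by case/andP: (ZK01 v) => z0 z1; rewrite exprn_ge0//= exprn_ile1.
have mw1 : measurable_fun setT w1 by apply: measurable_funM.
have mw2 : measurable_fun setT w2.
  by apply: measurable_funM; [exact: measurable_funM|exact: measurable_funX].
have w1oo : (\int[leb]_v (w1 v)%:E < +oo)%E.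
  have -> : (\int[leb]_v (w1 v)%:E = \int[leb]_v (f 1 * \1_U01 v * Z v ^+ 0)%:E)%E.
    by apply: eq_integral => v _; rewrite expr0 mulr1.
  by rewrite intE ?f0// integral_bernstein ?ltry.
have mF : measurable_fun setT
    (fun p : unit * R => (pow_pred (j.+2%:R / K%:R) p.2)%:E : \bar R).
  by apply/measurable_EFinP; apply: (measurableT_comp (measurable_pow_pred _)).
have F0 (p : unit * R) : (0 <= (pow_pred (j.+2%:R / K%:R) p.2)%:E :> \bar R)%E.
  by rewrite lee_fin pow_pred_ge0.
have := @joint_moment_unique R _ _ _ unit _ _ leb leb w1 w2 (fun=> tt) (fun=> tt)
  Z (fun v => ZK v ^+ K) w1_ge0 w2_ge0 mw1 mw2 (measurable_cst _) (measurable_cst _)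
  mZ (measurable_funX _ mZK) Z01 f201 w1oo _ _ F0 mF.
have KK : K%:R^-1 *+ K = 1 :> R.
  by rewrite -[LHS]mulr_natr mulVf// pnatr_eq0 -lt0n.
have -> : (\int[leb]_v ((w1 v)%:E * (pow_pred (j.+2%:R / K%:R) (tt, Z v).2)%:E))%E =
    ((f 1)%:E * \int[leb]_(v in U01) (pow_pred (j.+2%:R / K%:R) (Z v))%:E)%E.
  rewrite -intE ?f0//.
  - exact: (measurableT_comp (measurable_pow_pred _) mZ).
  - by move=> v; exact: pow_pred_ge0.
have -> : (\int[leb]_v ((w2 v)%:E * (pow_pred (j.+2%:R / K%:R) (tt, ZK v ^+ K).2)%:E))%E =
    (f (j.+2%:R / K%:R))%:E.
  (* The numerator [j + 2] leaves an exponent at least [1], so both integrands vanish where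
     [ZK v = 0]. *)
  transitivity (\int[leb]_v (f K%:R^-1 * \1_U01 v * ZK v ^+ j.+1)%:E)%E.
    apply: eq_integral => v _; rewrite -EFinM /w2; congr EFin; rewrite -[LHS]mulrA /=; congr (_ * _).
    rewrite /pow_pred; have [->|z0] := eqVneq (ZK v) 0.
      by rewrite [0 ^+ K]expr0n (gtn_eqF K0) normr0 invr0 !mulr0 expr0n.
    have zpos : 0 < ZK v by rewrite lt_neqAle eq_sym z0 ZK0.
    have -> : (ZK v ^+ K) `^ (j.+2%:R / K%:R) = ZK v ^+ j.+2.
      rewrite -[ZK v ^+ K]powR_mulrn// -powRrM mulrCA divff ?mulr1 ?powR_mulrn//.
      by rewrite pnatr_eq0 -lt0n.
    have -> : ZK v ^+ K = ZK v * ZK v ^+ K.-1 by rewrite -exprS prednK.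
    rewrite ger0_norm ?mulr_ge0 ?exprn_ge0// [ZK v ^+ j.+2]exprS.
    by field; rewrite z0 expf_neq0.
  rewrite intE ?f0//; last first.
  - by move=> v; rewrite exprn_ge0.
  - exact: measurable_funX.
  - by rewrite integral_bernstein// mulr_natl.
apply=> C k _.
have intCE (g : R -> R) (c : R) : measurable_fun setT g -> (forall v, 0 <= g v) ->
    0 <= c ->
    (\int[leb]_v (c * \1_U01 v * (\1_C tt * g v))%:E =
     (\1_C tt)%:E * (c%:E * \int[leb]_(v in U01) (g v)%:E))%E.
  move=> mg g0 c0; rewrite intE//; last 2 first.
  - by apply: measurable_funM.
  - by move=> v; rewrite mulr_ge0.
  rewrite muleCA; congr (_ * _)%E; under eq_integral do rewrite EFinM.
  rewrite ge0_integralZl//.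
  - by apply/measurable_EFinP; exact: measurable_funTS.
  - by move=> v _; rewrite lee_fin.
rewrite intCE ?f0//; last 2 first.
- exact: (measurable_funX _ mZ).
- by move=> v; rewrite exprn_ge0//; case/andP: (Z01 v).
rewrite integral_bernstein//.
transitivity (\int[leb]_v (f K%:R^-1 * \1_U01 v *
    (\1_C tt * ZK v ^+ (K.-1 + K * k)))%:E)%E; last first.
  by apply: eq_integral => v _; rewrite /w2 exprD exprM; congr EFin; ring.
rewrite intCE ?f0//; last 2 first.
- exact: (measurable_funX _ mZK).
- by move=> v; rewrite exprn_ge0.
rewrite integral_bernstein// -addSn prednK// -mulnS mulrnA KK.
by [].
Qed.

(** The integral is nonincreasing in [u] because [0 <= Z <= 1], and [f] is continuous; so the
    identity extends from rational exponents by enclosing [u] between two of them. *)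
Lemma bernstein_repr f (u : R) : completely_monotone f -> 0 < u ->
  ((f 1)%:E * \int[leb]_(v in U01) (pow_pred u (bernstein 1 f v))%:E = (f u)%:E)%E.
Proof.
move=> cmf u0.
pose g (t : R) := ((f 1)%:E * \int[leb]_(v in U01) (pow_pred t (bernstein 1 f v))%:E)%E.
have g_nincr s t : s <= t -> (g t <= g s)%E.
  move=> st; apply: lee_wpmul2l; first by rewrite lee_fin completely_monotone_ge0.
  have mp r : measurable_fun U01 (fun v => (pow_pred r (bernstein 1 f v))%:E : \bar R).
    apply/measurable_EFinP/measurable_funTS.
    exact: (measurableT_comp (measurable_pow_pred _) (measurable_bernstein _ _)).
  apply: ge0_le_integral => //.
  - by move=> v _; rewrite lee_fin pow_pred_ge0.
  - exact: mp.
  - exact: mp.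
  - move=> v _; rewrite lee_fin /pow_pred.
    have /andP[z0 z1] := bernstein01 1 f v.
    have [->|zn0] := eqVneq (bernstein 1 f v) 0; first by rewrite normr0 invr0 !mulr0.
    rewrite ler_wpM2r ?invr_ge0//; apply: ger_powR => //.
    by rewrite lt_neqAle eq_sym zn0 z0.
have rat (j K : nat) : (0 < K)%N -> g (j.+2%:R / K%:R) = (f (j.+2%:R / K%:R))%:E.
  exact: bernstein_rat.
have approx (e : R) : 0 < e -> ((f u - e)%:E <= g u <= (f u + e)%:E)%E.
  move=> e0; have := completely_monotone_continuous cmf u0.
  move=> /cvgrPdist_lt/(_ e e0) /nbhs_ballP[d /= d0 fd].
  (* [K > 2 / u] makes the integer part of [u K] at least [2], the least numerator covered by the
     rational case; [K > 1 / d] makes the mesh finer than [d]. *)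
  pose K := (Num.truncn (Num.max (2 / u) d^-1)).+1.
  have KM : Num.max (2 / u) d^-1 < K%:R by exact: truncnS_gt.
  have K0 : 0 < K%:R :> R by rewrite ltr0n.
  have Kd : K%:R^-1 < d.
    by rewrite invf_plt ?posrE// (le_lt_trans _ KM)// le_max lexx orbT.
  have uK : 2 <= u * K%:R.
    rewrite mulrC -ler_pdivrMr//; apply/ltW/(le_lt_trans _ KM).
    by rewrite le_max lexx.
  have [j jE] : exists j, Num.truncn (u * K%:R) = j.+2.
    have : (2 <= Num.truncn (u * K%:R))%N by rewrite truncn_ge_nat// (le_trans _ uK).
    by case: (Num.truncn _) => [|[|j]]// _; exists j.
  have /andP[j_le j_gt] : j.+2%:R <= u * K%:R < j.+3%:R.
    rewrite -jE truncnS_gt andbT truncn_le//.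
    by rewrite mulr_ge0// ltW.
  have u1 : j.+2%:R / K%:R <= u by rewrite ler_pdivrMr.
  have u2 : u <= j.+3%:R / K%:R by rewrite ler_pdivlMr// ltW.
  have u12 : j.+3%:R / K%:R = j.+2%:R / K%:R + K%:R^-1 :> R.
    by rewrite -natr1 mulrDl mul1r.
  have d1 : `|f u - f (j.+2%:R / K%:R)| < e.
    by apply: fd; rewrite /ball/= ger0_norm ?subr_ge0//; lra.
  have d2 : `|f u - f (j.+3%:R / K%:R)| < e.
    by apply: fd; rewrite /ball/= ler0_norm ?subr_le0//; lra.
  apply/andP; split.
  - apply: le_trans (g_nincr _ _ u2); rewrite rat// lee_fin.
    by move: d2; rewrite ltr_norml => /andP[]; lra.
  - apply: (le_trans (g_nincr _ _ u1)); rewrite rat// lee_fin.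
    by move: d1; rewrite ltr_norml => /andP[]; lra.
rewrite -/(g u); apply/eqP; rewrite eq_le; apply/andP; split.
- by apply/lee_addgt0Pr => e e0; case/andP: (approx e e0).
- apply/lee_subgt0Pr => e e0; case/andP: (approx e e0).
  by rewrite EFinB.
Qed.

Lemma measurable_bernstein_param d (X : measurableType d) (g : X -> R -> R) :
  (forall u, 0 < u -> measurable_fun setT (g^~ u)) ->
  measurable_fun setT (fun p : X * R => bernstein 1 (g p.1) p.2).
Proof.
move=> mg; apply: (@measurable_urn_limit R _ X (fun i j x => difference_array 1 (g x) i j)).
elim=> [|i IH] j; first by apply: mg; rewrite pmulrn_rgt0.
rewrite (_ : (fun x => _) = fun x =>
    difference_array 1 (g x) i j - difference_array 1 (g x) i j.+1).
  exact: measurable_funB.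
by apply/funext => x; rewrite (difference_arrayS _ _ i) addrK.
Qed.

End completely_monotone.

(** * Measurability in R^d and polar coordinates *)

Lemma measurable_sqrt (R : realType) : measurable_fun setT (Num.sqrt : R -> R).
Proof. by apply: continuous_measurable_fun; exact: sqrt_continuous. Qed.

Section rv_measurable.
Context {R : realType} (d : nat).
Implicit Types x y : 'rV[R]_d.

Lemma measurable_coord (i : 'I_d) :
  measurable_fun [set: Rd R d] (fun x : Rd R d => (x : 'rV[R]_d) ord0 i).
Proof.
apply: (measurability _ (RGenOpens.measurableE R)) => _ [_ [a [b ->] <-]].
rewrite setTI; apply: sub_sigma_algebra.
by have /continuousP := @coord_continuous R 1 d ord0 i; apply; exact: interval_open.
Qed.

(** Rational boxes form a countable base of the topology. Every open set is a countable union of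
    them, so measurability into [Rd R d] can be tested on coordinates. *)
Let box (p : 'rV[rat]_d * nat) : set 'rV[R]_d :=
  [set y | forall i, `|y ord0 i - ratr (p.1 ord0 i)| < p.2.+1%:R^-1].

Let open_bigcup_box (U : set 'rV[R]_d) : open U ->
  U = \bigcup_p (if pselect (box p `<=` U) then box p else set0).
Proof.
move=> oU; apply/seteqP; split => [x Ux|x [p _]]; last by case: pselect => // s /s.
have /nbhs_ballP[e /= e0 xeU] : nbhs x U by exact: open_nbhs_nbhs.
pose n := Num.truncn (2 / e).
have n0 : 0 < n.+1%:R^-1 :> R by rewrite invr_gt0 ltr0n.
have ne : n.+1%:R^-1 < e / 2.
  by rewrite invf_plt ?posrE ?divr_gt0// invf_div truncnS_gt.
have [c [cE c0 ce]] : exists c : R, [/\ c = n.+1%:R^-1, 0 < c & c < e / 2].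
  by exists n.+1%:R^-1.
have /choice[q qx] : forall i, exists q : rat, `|x ord0 i - ratr q| < c.
  move=> i; have xi : x ord0 i - c < x ord0 i + c by lra.
  have [q] := rat_in_itvoo xi.
  by rewrite in_itv/= => /andP[q1 q2]; exists q; rewrite ltr_norml; lra.
exists (\row_i q i, n) => //; case: pselect => [_ i|[]]; first by rewrite /= mxE -cE.
move=> y /= yq; apply: xeU; split => // i j; rewrite (ord1 i) /ball/=.
have := yq j; rewrite /= mxE -cE; have := qx j.
rewrite !ltr_norml => /andP[? ?] /andP[? ?]; lra.
Qed.

Lemma measurable_rv d' (T : measurableType d') (f : T -> Rd R d) :
  (forall i, measurable_fun setT (fun t => (f t : 'rV[R]_d) ord0 i)) ->
  measurable_fun setT f.
Proof.
move=> mf; apply: (@measurability _ _ T (Rd R d) setT f (@open 'rV[R]_d) erefl) => _ [U oU <-].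
rewrite setTI (open_bigcup_box oU) preimage_bigcup.
apply: countable_bigcupT_measurable => [|p]; first exact: countableP.
case: pselect => pU /=; last by rewrite preimage_set0.
rewrite (_ : _ @^-1` _ = \bigcap_(i in [set: 'I_d])
    [set t | `|(f t : 'rV[R]_d) ord0 i - ratr (p.1 ord0 i)| < p.2.+1%:R^-1]).
  apply: fin_bigcap_measurable => // i _.
  rewrite (_ : [set t | _] = [set t | (f t : 'rV[R]_d) ord0 i \in
      `](ratr (p.1 ord0 i) - p.2.+1%:R^-1), (ratr (p.1 ord0 i) + p.2.+1%:R^-1)[]).
    rewrite -[X in measurable X]setTI.
    exact: (mf i measurableT _ (measurable_itv `](ratr (p.1 ord0 i) - p.2.+1%:R^-1),
      (ratr (p.1 ord0 i) + p.2.+1%:R^-1)[)).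
  apply/funext => t /=; rewrite in_itv/= ltr_norml; congr is_true.
  by rewrite ltrBrDr ltrBlDr [- _ + _]addrC [p.2.+1%:R^-1 + _]addrC.
by apply/seteqP; split => t /= h i *; exact: h.
Qed.

Lemma enorm_ge0 x : 0 <= enorm x. Proof. exact: sqrtr_ge0. Qed.

Lemma sumsq_ge0 x : 0 <= \sum_(i < d) x ord0 i ^+ 2.
Proof. by apply: sumr_ge0 => i _; exact: sqr_ge0. Qed.

Lemma enormZ a x : enorm (a *: x) = `|a| * enorm x.
Proof.
rewrite /enorm; under eq_bigr do rewrite mxE exprMn.
by rewrite -mulr_sumr sqrtrM ?sqr_ge0// sqrtr_sqr.
Qed.

Lemma enorm_eq0 x : (enorm x == 0) = (x == 0).
Proof.
rewrite /enorm sqrtr_eq0 le_eqVlt ltNge sumsq_ge0 orbF psumr_eq0; last first.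
  by move=> i _; exact: sqr_ge0.
apply/allP/eqP => [h|-> i _]; last by rewrite mxE expr0n eqxx.
apply/rowP => i; rewrite mxE; apply/eqP; rewrite -sqrf_eq0.
by apply: h; rewrite mem_index_enum.
Qed.

Lemma enorm_gt0 x : (0 < enorm x) = (x != 0).
Proof. by rewrite lt_neqAle eq_sym enorm_eq0 enorm_ge0 andbT. Qed.

Lemma measurable_enorm : measurable_fun [set: Rd R d] (fun x : Rd R d => enorm x).
Proof.
have msum : measurable_fun [set: Rd R d]
    (fun x : Rd R d => \sum_(i < d) (x : 'rV[R]_d) ord0 i ^+ 2).
  by apply: measurable_sum => i; apply: measurable_funX; exact: measurable_coord.
exact: (measurableT_comp (@measurable_sqrt R) msum).
Qed.

Lemma measurable_scale d' (T : measurableType d') (a : T -> R) (f : T -> Rd R d) :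
  measurable_fun setT a -> measurable_fun setT f ->
  measurable_fun setT (fun t => a t *: (f t : 'rV[R]_d) : Rd R d).
Proof.
move=> ma mf; apply: measurable_rv => i.
rewrite (_ : (fun t => _) = fun t => a t * (f t : 'rV[R]_d) ord0 i); last first.
  by apply/funext => t; rewrite mxE.
by apply: measurable_funM => //; exact: (measurableT_comp (measurable_coord i) mf).
Qed.

(** At the origin the value is [0], which is not on the sphere. *)
Definition direction (x : Rd R d) : Rd R d := (enorm x)^-1 *: (x : 'rV[R]_d).

Lemma measurable_direction : measurable_fun setT direction.
Proof.
exact: (@measurable_scale _ _ (fun x : Rd R d => (enorm x)^-1) (fun x => x)
  (measurable_funV measurable_enorm) (@measurable_id _ _ _)).
Qed.

Lemma direction_sphere (x : Rd R d) : x != 0 -> sphere R d (direction x).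
Proof.
move=> x0; rewrite /sphere/= /direction enormZ ger0_norm ?invr_ge0 ?enorm_ge0//.
by rewrite mulVf// enorm_eq0.
Qed.

Lemma measurable_sphere : measurable (sphere R d).
Proof.
rewrite -[X in measurable X]setTI.
exact: (measurable_enorm _ (measurable_set1 1)).
Qed.

End rv_measurable.

(** * Laplace transforms *)

(** Each power of [x] is absorbed by half of the remaining exponent, as
    [x e^(-u x / 2) <= 2 / u]. *)
Lemma expr_expR {R : realType} n (u : R) : 0 < u -> exists C v : R, [/\ 0 <= C, 0 < v &
  forall x : R, 0 <= x -> x ^+ n * expR (- (u * x)) <= C * expR (- (v * x))].
Proof.
elim: n u => [|n IH] u u0; first by exists 1, u; split => // x _; rewrite expr0 mul1r.
have u2 : 0 < u / 2 by rewrite divr_gt0.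
have [C [v [C0 v0 Cv]]] := IH _ u2.
exists ((u / 2)^-1 * C), v; split => // [|x x0]; first by rewrite mulr_ge0// invr_ge0 ltW.
have -> : x ^+ n.+1 * expR (- (u * x)) =
    (x * expR (- (u / 2 * x))) * (x ^+ n * expR (- (u / 2 * x))).
  rewrite exprS [in LHS](_ : - (u * x) = - (u / 2 * x) + - (u / 2 * x)); last by field.
  by rewrite expRD; ring.
rewrite -[leRHS]mulrA; apply: ler_pM; last exact: Cv.
- by rewrite mulr_ge0 ?expR_ge0.
- by rewrite mulr_ge0 ?exprn_ge0 ?expR_ge0.
rewrite expRN ler_pdivrMr ?expR_gt0// ler_pdivlMl//.
apply: le_trans (expR_ge1Dx _).
by rewrite lerDr.
Qed.

Section laplace.
Context {R : realType} d (T : measurableType d) (mu : {measure set T -> \bar R})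
  (D : set T) (w s : T -> R).
Hypotheses (mD : measurable D) (w0 : forall y, 0 <= w y) (s0 : forall y, 0 <= s y)
  (mw : measurable_fun setT w) (ms : measurable_fun setT s)
  (fin : forall u : R, 0 < u -> (\int[mu]_(y in D) (w y * expR (- (u * s y)))%:E < +oo)%E).

Definition laplace_deriv n (u : R) : R :=
  \int[mu]_(y in D) (w y * (- s y) ^+ n * expR (- (u * s y))).

Let me (u : R) : measurable_fun setT (fun y => expR (- (u * s y))).
Proof.
by apply: measurable_expRN; apply: measurable_funM.
Qed.

Let ker_integrable n (u : R) : 0 < u ->
  mu.-integrable D (fun y => (w y * (s y) ^+ n * expR (- (u * s y)))%:E).
Proof.
move=> u0; have [C [v [C0 v0 Cv]]] := expr_expR n u0.
have ik : mu.-integrable D (fun y => C%:E * (w y * expR (- (v * s y)))%:E)%E.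
  apply: integrableZl => //; apply/integrableP; split.
    by apply/measurable_EFinP/measurable_funTS; apply: measurable_funM.
  apply: le_lt_trans (fin v0); apply: eq_lee.
  by apply: eq_integral => y _; rewrite gee0_abs// lee_fin mulr_ge0// expR_ge0.
apply: le_integrable ik => //.
  apply/measurable_EFinP/measurable_funTS; apply: measurable_funM => //.
  by apply: measurable_funM => //; apply: measurable_funX.
move=> y _; rewrite -EFinM !abse_EFin lee_fin !ger0_norm ?mulr_ge0 ?exprn_ge0 ?expR_ge0//.
by rewrite -mulrA [leRHS]mulrCA ler_wpM2l// Cv.
Qed.

Let signed_kernel n (u : R) y :
  w y * (- s y) ^+ n * expR (- (u * s y)) =
  (-1) ^+ n * (w y * s y ^+ n * expR (- (u * s y))).
Proof. by rewrite [(- s y) ^+ n]exprNn !mulrA [w y * _]mulrC. Qed.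

Let signed_integrable n (u : R) : 0 < u ->
  mu.-integrable D (fun y => (w y * (- s y) ^+ n * expR (- (u * s y)))%:E).
Proof.
move=> u0.
rewrite (_ : (fun y => _) = (fun y => ((-1) ^+ n)%:E *
   (w y * s y ^+ n * expR (- (u * s y)))%:E)%E); last first.
  by apply/funext => y; rewrite signed_kernel EFinM.
exact: integrableZl (ker_integrable n u0).
Qed.

Lemma completely_monotone_laplace : completely_monotone (laplace_deriv 0).
Proof.
apply: completely_monotone_intro => n u u0; last first.
  rewrite /laplace_deriv.
  rewrite (_ : Rintegral _ _ _ = (-1) ^+ n *
      \int[mu]_(y in D) (w y * s y ^+ n * expR (- (u * s y)))); last first.
    rewrite -RintegralZl//; last exact: ker_integrable.
    by apply: eq_Rintegral => y _; exact: signed_kernel.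
  rewrite mulrA -exprMn mulrN1 opprK expr1n mul1r.
  by apply: Rintegral_ge0 => y _; rewrite !mulr_ge0 ?exprn_ge0 ?expR_ge0.
have [uv1 uv2] : u / 2 < u /\ u < u + 1 by split; lra.
pose f (u : R) (y : T) := w y * (- s y) ^+ n * expR (- (u * s y)).
have df (x : R) y : is_derive x 1 (f^~ y) (w y * (- s y) ^+ n.+1 * expR (- (x * s y))).
  rewrite /f.
  have h1 : is_derive x (1:R) (fun u : R => - (u * s y)) (- s y).
    by apply: is_derive_eq; rewrite scaler0 add0r; rewrite /GRing.scale/= mulr1.
  have h2 : is_derive x (1:R) (fun u : R => expR (- (u * s y))) (- s y * expR (- (x * s y))).
    have := @is_derive1_comp _ expR (fun u : R => - (u * s y)) x _ _ (is_derive_expR _) h1.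
    by move=> h; apply: is_derive_eq; rewrite mulrC.
  rewrite exprS.
  have h3 := is_deriveZ (w y * (- s y) ^+ n) h2.
  by apply: is_derive_eq; rewrite /GRing.scale/=; ring.
have pf (x : R) y : partial1of2 f x y = w y * (- s y) ^+ n.+1 * expR (- (x * s y)).
  by rewrite /partial1of2 derive1E; exact: derive_val.
have Ia : `]u/2, u + 1[%classic u by rewrite /= in_itv/= uv1 uv2.
have i1 (x : R) : `]u/2, u + 1[%classic x -> mu.-integrable D (EFin \o f x).
  rewrite /= in_itv/= => /andP[x1 _]; apply: signed_integrable.
  by apply: lt_trans x1; rewrite divr_gt0.
have i2 (x : R) (y : T) : `]u/2, u + 1[%classic x -> D y -> derivable (f^~ y) x 1.
  by move=> _ _; have [] := df x y.
(* Domination of the derivative on the whole neighbourhood []u / 2, u + 1[] of [u]: the exponential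
   is largest at the left end, and the power is integrable against it by [expr_expR]. *)
pose G y := w y * s y ^+ n.+1 * expR (- (u / 2 * s y)).
have G0 y : 0 <= G y by rewrite /G !mulr_ge0 ?exprn_ge0 ?expR_ge0.
have iG : mu.-integrable D (EFin \o G) by apply: ker_integrable; rewrite divr_gt0.
have fG (x : R) (y : T) : `]u/2, u + 1[%classic x -> D y -> `|partial1of2 f x y| <= G y.
  rewrite /= in_itv/= => /andP[x1 _] _; rewrite pf signed_kernel normrM normrX normrN1.
  rewrite expr1n mul1r ger0_norm ?mulr_ge0 ?exprn_ge0 ?expR_ge0// ler_wpM2l ?mulr_ge0 ?exprn_ge0//.
  by rewrite ler_expR lerN2 ler_wpM2r// ltW.
have := differentiation_under_integral mD Ia i1 i2 G0 iG fG.
have dd := derivable_under_integral mD Ia i1 i2 G0 iG fG.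
rewrite derive1E => dv; split; first exact: dd.
rewrite [LHS]dv; apply: eq_Rintegral => y _; exact: pf.
Qed.
End laplace.

(** * From polar decompositions to mixtures of exponentials *)

Section polar_to_mixture.
Context {R : realType} {d : nat}.
Local Notation leb := (@lebesgue_measure R).
Local Notation U01 := (`[0, 1[%classic : set R).

(** The common form of the two transforms: with [theta] the identity and [w x = 1 / |x|] it is
    [Ups0], with [theta] the square and [w] proportional to [|x|^(-1/2)] it is [A1] after [Ups0].
    Weight [1] is the form met in Bernstein's theorem. *)
Definition radial_mix (w : Rd R d -> R) (theta : R -> R)
    (rho : {measure set (Rd R d) -> \bar R}) (F : Rd R d * R -> R) : \bar R :=
  (\int[rho]_x \int[leb]_(r in Rpos R)
     (w x * F (direction x, r) * expR (- (theta r / enorm x)))%:E)%E.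

(** The factor [f 1 / Z] undoes the tilting in [bernstein 1 f], so that [Z^u] integrates to [f u]
    against this weight plus the atom. The value [Z = 1], exponent [0], is split off; at [Z = 0] the
    weight is [0] since [0^-1 = 0]. *)
Definition bernstein_weight (f : R -> R) (v : R) : R :=
  if bernstein 1 f v == 1 then 0 else \1_U01 v * (f 1 * (bernstein 1 f v)^-1).

(* The mass that the mixing measure of [f] gives to the exponent [0], that is,
   the limit of [f] at infinity. *)
Definition bernstein_atom (f : R -> R) : \bar R :=
  (\int[leb]_v (if bernstein 1 f v == 1 then \1_U01 v * f 1 else 0)%:E)%E.

Lemma bernstein_weight_ge0 f v : 0 <= f 1 -> 0 <= bernstein_weight f v.
Proof.
move=> f1; have /andP[b0 _] := bernstein01 1 f v.
by rewrite /bernstein_weight; case: ifPn => // _; rewrite !mulr_ge0// invr_ge0.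
Qed.

Lemma measurable_bernstein_weight d' (X : measurableType d') (g : X -> R -> R) :
  (forall u : R, 0 < u -> measurable_fun setT (g^~ u)) ->
  measurable_fun setT (fun p : X * R => bernstein_weight (g p.1) p.2).
Proof.
move=> mg; have mb := measurable_bernstein_param mg.
apply: measurable_fun_ifT => //.
  by apply: measurable_fun_eqr.
apply: measurable_funM.
  have mU : measurable_fun setT (\1_U01 : R -> R) by exact: measurable_indic.
  exact: (measurableT_comp mU measurable_snd).
apply: measurable_funM; last exact: measurable_funV.
exact: (measurableT_comp (mg 1 ltr01) measurable_fst).
Qed.

Lemma measurable_bernstein_weight1 f : measurable_fun setT (bernstein_weight f).
Proof.
have mg (t : R) : 0 < t -> measurable_fun setT ((fun _ : R => f) ^~ t) by move=> _.
exact: (measurableT_comp (measurable_bernstein_weight mg)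
  (measurable_fun_pair (measurable_cst (0:R)) (@measurable_id _ R setT))).
Qed.

Lemma measurable_bernstein_kernel (f : R -> R) (u : R) :
  measurable_fun setT (fun v => bernstein_weight f v * expR (u * ln (bernstein 1 f v))).
Proof.
apply: measurable_funM; first exact: measurable_bernstein_weight1.
have mln : measurable_fun setT (fun v => u * ln (bernstein 1 f v)).
  apply: measurable_funM => //.
  exact: (measurableT_comp (@measurable_ln R) (measurable_bernstein 1 f)).
exact: (measurableT_comp (@measurable_expR R) mln).
Qed.

Lemma bernstein_split f (u : R) : completely_monotone f -> 0 < u ->
  ((f u)%:E = \int[leb]_v (bernstein_weight f v * expR (u * ln (bernstein 1 f v)))%:E
    + bernstein_atom f)%E.
Proof.
move=> cm u0; have f1 := completely_monotone_ge0 cm ltr01.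
have mb := measurable_bernstein 1 f.
rewrite -ge0_integralD//; first last.
- apply/measurable_EFinP; apply: measurable_fun_ifT => //.
    by apply: measurable_fun_eqr.
  by apply: measurable_funM => //; exact: measurable_indic.
- by move=> v _; rewrite lee_fin; case: ifPn => // _; rewrite mulr_ge0.
- by apply/measurable_EFinP; exact: measurable_bernstein_kernel.
- by move=> v _; rewrite lee_fin mulr_ge0 ?expR_ge0 ?bernstein_weight_ge0.
rewrite -bernstein_repr// -ge0_integralZl//; first last.
- by move=> v _; rewrite lee_fin pow_pred_ge0.
- apply/measurable_EFinP/measurable_funTS.
  exact: (measurableT_comp (measurable_pow_pred _) mb).
rewrite [LHS]integral_mul_indic ?measurable_itv//.
apply: eq_integral => v _; rewrite -!EFinM -EFinD; congr EFin.
rewrite /bernstein_weight /pow_pred.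
have /andP[b0 _] := bernstein01 1 f v.
case: ifPn => [/eqP->|b1].
  by rewrite powR1 normr1 divr1 mulr1 mul0r add0r mulrC.
rewrite addr0 ger0_norm// /powR; case: ifPn => [/eqP->|bn0].
  by rewrite invr0 !mulr0 mul0r.
by ring.
Qed.

Lemma measurable_set_zero : measurable ([set 0] : set (Rd R d)).
Proof.
rewrite (_ : [set 0] = [set x : Rd R d | enorm x = 0]); last first.
  apply/seteqP; split => x /= /eqP h; last by apply/eqP; rewrite -enorm_eq0.
  by apply/eqP; rewrite enorm_eq0.
rewrite -[X in measurable X]setTI.
exact: (@measurable_enorm R d _ _ (measurable_set1 0)).
Qed.

Lemma measurable_Rpos : measurable (Rpos R : set (measurableTypeR R)).
Proof. exact: measurable_itv. Qed.

Lemma integral_RposE (f : R -> \bar R) :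
  (\int[leb]_(r in Rpos R) f r = \int[leb]_r ((\1_(Rpos R) r)%:E * f r))%E.
Proof. by rewrite integral_mul_indic//; exact: measurable_Rpos. Qed.

Lemma in_Rpos (r : R) : Rpos R r = (0 < r) :> Prop.
Proof. by rewrite /Rpos/= in_itv/= andbT. Qed.

(** By [bernstein_split] the atom is a lower bound of [f] on the positive half-line, and a positive
    constant has infinite integral over []1, +oo[]. *)
Lemma bernstein_atom_eq0 f (theta : R -> R) : completely_monotone f ->
    (forall r : R, 0 < r -> 0 < theta r) ->
    measurable_fun (Rpos R) (fun r => f (theta r)) ->
    (\int[leb]_(r in Rpos R) (\1_(`]1, +oo[%classic : set R) r * f (theta r))%:E < +oo)%E ->
  bernstein_atom f = 0%E.
Proof.
move=> cm theta0 mf; apply: contraPP => an0.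
have a0 : (0 <= bernstein_atom f)%E.
  apply: integral_ge0 => v _; rewrite lee_fin; case: ifPn => // _.
  by rewrite mulr_ge0// (completely_monotone_ge0 cm).
apply/negP; rewrite -leNgt.
have le (r : R) : 0 < r -> (bernstein_atom f <= (f (theta r))%:E)%E.
  move=> r0; rewrite (bernstein_split cm (theta0 _ r0)) leeDr//.
  apply: integral_ge0 => v _; rewrite lee_fin mulr_ge0 ?expR_ge0//.
  by rewrite bernstein_weight_ge0// (completely_monotone_ge0 cm).
have afin : bernstein_atom f \is a fin_num.
  by rewrite ge0_fin_numE//; apply: le_lt_trans (le 1 ltr01) _; rewrite ltry.
have apos : (0 < bernstein_atom f)%E by rewrite lt0e a0 andbT; apply/eqP.
have mI1 : measurable_fun (Rpos R) (\1_(`]1, +oo[%classic : set R) : R -> R).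
  by apply/measurable_funTS; exact: measurable_indic.
have mI : measurable_fun (Rpos R) (fun r => (\1_(`]1, +oo[%classic : set R) r)%:E : \bar R).
  exact/measurable_EFinP.
apply: (@le_trans _ _ (\int[leb]_(r in Rpos R)
    ((fine (bernstein_atom f))%:E * (\1_(`]1, +oo[%classic : set R) r)%:E))%E).
  rewrite ge0_integralZl//; last 2 first.
  - exact: measurable_Rpos.
  - by rewrite lee_fin fine_ge0.
  rewrite integral_indic//=; last exact: measurable_Rpos.
  rewrite fineK// (_ : _ `&` _ = `]1, +oo[%classic); last first.
    rewrite setIidl// => r /=; rewrite /Rpos/= !in_itv/= !andbT.
    exact: lt_trans.
  by rewrite lebesgue_measure_itv/= ltry gt0_muley.
apply: ge0_le_integral.
- exact: measurable_Rpos.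
- by move=> r _; rewrite mule_ge0// lee_fin// fine_ge0.
- exact: emeasurable_funM.
- by apply/measurable_EFinP; apply: measurable_funM.
- move=> r; rewrite in_Rpos => r0; rewrite EFinM muleC.
  by apply: lee_wpmul2l; [rewrite lee_fin | rewrite fineK// le].
Qed.

(** Nothing is known of [H] for [r <= 0], so it is extended by zero before Tonelli's measurability
    statement is applied. *)
Lemma measurable_radial_integral (H : Rd R d * R -> R) :
  (forall x (r : R), 0 < r -> 0 <= H (x, r)) ->
  measurable_fun ([set: Rd R d] `*` Rpos R) H ->
  measurable_fun setT (fun x : Rd R d => \int[leb]_(r in Rpos R) (H (x, r))%:E)%E.
Proof.
move=> H0 mH.
have msT : measurable ([set: Rd R d] `*` Rpos R : set (Rd R d * measurableTypeR R)).
  by apply: measurableX => //; exact: measurable_Rpos.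
pose G (p : Rd R d * R) : \bar R := ((EFin \o H) \_ ([set: Rd R d] `*` Rpos R)) p.
have mG : measurable_fun setT G.
  by apply/(measurable_restrictT _ msT)/measurable_EFinP.
have G0 p : (0 <= G p)%E.
  rewrite /G patchE; case: ifPn => //; rewrite inE; case: p => x r [_ /=].
  by rewrite in_Rpos => r0; rewrite lee_fin H0.
have := measurable_integral_leb mG G0.
apply: eq_measurable_fun => x _; rewrite /fubini_F [RHS]integral_mkcond.
by apply: eq_integral => r _; rewrite /G !patchE in_setX in_setT.
Qed.

Lemma measurable_radial_kernel (w : Rd R d -> R) (theta : R -> R) (F : Rd R d * R -> R) :
  measurable_fun setT w -> measurable_fun setT theta -> measurable_fun setT F ->
  measurable_fun setT (fun p : Rd R d * R =>
    w p.1 * F (direction p.1, p.2) * expR (- (theta p.2 / enorm p.1))).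
Proof.
move=> mw mtheta mF; apply: measurable_funM.
  apply: measurable_funM; first exact: (measurableT_comp mw measurable_fst).
  have md : measurable_fun setT (fun p : Rd R d * R => (direction p.1, p.2)).
    apply/measurable_fun_pair => //.
    exact: (measurableT_comp (@measurable_direction R d) measurable_fst).
  exact: (measurableT_comp mF md).
apply: measurable_expRN; apply: measurable_funM.
  exact: (measurableT_comp mtheta measurable_snd).
apply: measurable_funV.
exact: (measurableT_comp (@measurable_enorm R d) measurable_fst).
Qed.

Lemma measurable_section dX dY dZ (X : measurableType dX) (Y : measurableType dY)
    (T : measurableType dZ) (f : X * Y -> T) (x : X) :
  measurable_fun setT f -> measurable_fun setT (fun y => f (x, y)).
Proof. by move=> mf; apply: (measurableT_comp mf); apply/measurable_fun_pair. Qed.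

Section core.
Variables (lam : {measure set (Rd R d) -> \bar R}) (g : Rd R d -> R -> R)
  (theta : R -> R).
Hypotheses (cmg : forall xi, completely_monotone (g xi))
  (mg : measurable_fun ([set: Rd R d] `*` Rpos R) (fun p : Rd R d * R => g p.1 p.2))
  (mtheta : measurable_fun [set: R] theta)
  (theta0 : forall r : R, 0 < r -> 0 < theta r).

Let msT : measurable ([set: Rd R d] `*` Rpos R : set (Rd R d * measurableTypeR R)).
Proof. by apply: measurableX => //; exact: measurable_Rpos. Qed.

Let mgtheta : measurable_fun ([set: Rd R d] `*` Rpos R)
  (fun p : Rd R d * R => g p.1 (theta p.2)).
Proof.
pose h (p : Rd R d * R) : Rd R d * R := (p.1, theta p.2).
have mh : measurable_fun ([set: Rd R d] `*` Rpos R) h.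
  apply/measurable_funTS/measurable_fun_pair => //.
  exact: (measurableT_comp mtheta measurable_snd).
have hs : h @` ([set: Rd R d] `*` Rpos R) `<=` [set: Rd R d] `*` Rpos R.
  move=> _ [[x r] [_ /= r0] <-]; split => //=; move: r0.
  by rewrite /Rpos/= !in_itv/= !andbT; exact: theta0.
exact: (measurable_comp msT hs mg mh).
Qed.

Let mg1 (u : R) : 0 < u -> measurable_fun setT (g^~ u).
Proof.
move=> u0.
pose h (x : Rd R d) : Rd R d * R := (x, u).
have mh : measurable_fun setT h by apply/measurable_fun_pair.
have hs : h @` setT `<=` [set: Rd R d] `*` Rpos R.
  by move=> _ [x _ <-]; split => //=; rewrite /Rpos/= in_itv/= u0.
exact: (measurable_comp msT hs mg mh).
Qed.

Let mgs (xi : Rd R d) : measurable_fun (Rpos R) (fun r => g xi (theta r)).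
Proof.
pose h (r : R) : Rd R d * R := (xi, r).
have mh : measurable_fun (Rpos R) h by apply/measurable_funTS/measurable_fun_pair.
have hs : h @` (Rpos R) `<=` [set: Rd R d] `*` Rpos R.
  by move=> _ [x x0 <-].
exact: (measurable_comp msT hs mgtheta mh).
Qed.

Let mradial (F : Rd R d * R -> R) : (forall p, 0 <= F p) -> measurable_fun setT F ->
  measurable_fun setT (fun xi => \int[leb]_(r in Rpos R) (F (xi, r) * g xi (theta r))%:E)%E.
Proof.
move=> F0 mF.
apply: (measurable_radial_integral (H := fun p => F p * g p.1 (theta p.2))).
  move=> x r r0; rewrite mulr_ge0// (completely_monotone_ge0 (cmg _))//.
  exact: theta0.
by apply: measurable_funM => //; exact: measurable_funTS.
Qed.

Let Z (p : Rd R d * R) := bernstein 1 (g p.1) p.2.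
Let w (p : Rd R d * R) := \1_(sphere R d) p.1 * bernstein_weight (g p.1) p.2.
(* The value [z] of [bernstein] stands for the exponential [expR (- r / |x|)] with
   [z = expR (- |x|^-1)]. *)
Let phi (p : Rd R d * R) : Rd R d := (- ln (Z p))^-1 *: (p.1 : 'rV[R]_d).

Let w_ge0 p : 0 <= w p.
Proof.
by rewrite /w mulr_ge0// bernstein_weight_ge0// (completely_monotone_ge0 (cmg _)).
Qed.

Let mw : measurable_fun setT w.
Proof.
apply: measurable_funM; last exact: measurable_bernstein_weight.
have mS : measurable_fun setT (\1_(sphere R d) : Rd R d -> R).
  by apply: measurable_indic; exact: measurable_sphere.
exact: (measurableT_comp mS measurable_fst).
Qed.

Let mphi : measurable_fun setT phi.
Proof.
have mZ : measurable_fun setT Z by exact: measurable_bernstein_param.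
have ml : measurable_fun setT (fun p => (- ln (Z p))^-1).
  apply: measurable_funV; apply: measurable_funN.
  exact: (measurableT_comp (@measurable_ln R) mZ).
exact: (@measurable_scale _ _ _ _ _ fst ml measurable_fst).
Qed.

Let w_neq0 p : w p != 0 -> sphere R d p.1 /\ ln (Z p) < 0.
Proof.
rewrite /w mulf_eq0 negb_or => /andP[]; rewrite indicE pnatr_eq0 eqb0 negbK inE => pS.
rewrite /bernstein_weight; have /andP[b0 b1] := bernstein01 1 (g p.1) p.2.
case: ifPn => [|Z1 h]; first by rewrite eqxx.
split=> //; apply: ln_lt0; rewrite /Z !lt_neqAle Z1 b0 b1 !andbT eq_sym.
by apply: contraNN h => /eqP ->; rewrite invr0 !mulr0.
Qed.

Let phiE p : w p != 0 -> enorm (phi p) = (- ln (Z p))^-1 /\ direction (phi p) = p.1.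
Proof.
move=> /w_neq0[pS l0].
have i0 : 0 < (- ln (Z p))^-1 by rewrite invr_gt0 oppr_gt0.
have e : enorm (phi p) = (- ln (Z p))^-1.
  by rewrite /phi enormZ gtr0_norm// (_ : enorm _ = 1) ?mulr1.
by split=> //; rewrite /direction e /phi scalerA mulVf ?scale1r// gt_eqF.
Qed.

(** [rho] is the image under [phi] of [lam(dxi) w(xi, v) dv], and [phi] is chosen so that
    [Z ^ (theta r)] becomes [e^(-theta r / |x|)]. For almost every [xi] the radial integral over
    []1, +oo[] is finite, which removes the atom; the only interchange is that of [r] and [v] with
    [xi] fixed. *)
Lemma polar_to_mixture :
  (\int[lam]_(xi in sphere R d) \int[leb]_(r in Rpos R)
     (\1_(`]1, +oo[%classic : set R) r * g xi (theta r))%:E < +oo)%E ->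
  exists rho : {measure set (Rd R d) -> \bar R}, rho [set 0] = 0%E /\
    forall F : Rd R d * R -> R, (forall p, 0 <= F p) -> measurable_fun setT F ->
    (\int[lam]_(xi in sphere R d) \int[leb]_(r in Rpos R)
      (F (xi, r) * g xi (theta r))%:E)%E = radial_mix (fun=> 1) theta rho F.
Proof.
move=> fin.
have [rho rhoE] := mixture_measure lam leb w_ge0 mw mphi.
exists rho; split=> [|F F0 mF].
  have m0 := measurable_set_zero.
  rewrite -integral_indicT// rhoE//; last exact/measurable_EFinP/measurable_indic.
  apply: integral0_eq => xi _; apply: integral0_eq => v _.
  have [->|wn0] := eqVneq (w (xi, v)) 0; first by rewrite mul0e.
  rewrite indicE memNset ?mule0//= => phi0.
  have [e _] := phiE wn0; have [_ l0] := w_neq0 wn0.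
  move: e; rewrite phi0 => /esym/eqP.
  by rewrite (eqP (_ : enorm 0 == 0)) ?enorm_eq0// gt_eqF// invr_gt0 oppr_gt0.
pose K (x : Rd R d) := (\int[leb]_(r in Rpos R)
     (1 * F (direction x, r) * expR (- (theta r / enorm x)))%:E)%E.
have K0 x : (0 <= K x)%E.
  by apply: integral_ge0 => r _; rewrite lee_fin !mulr_ge0 ?expR_ge0.
have mK : measurable_fun setT K.
  apply: (measurable_radial_integral
    (H := fun p => 1 * F (direction p.1, p.2) * expR (- (theta p.2 / enorm p.1)))).
    by move=> x r r0; rewrite !mulr_ge0 ?expR_ge0.
  exact: (measurable_funTS (measurable_radial_kernel (measurable_cst (1:R)) mtheta mF)).
rewrite /radial_mix (rhoE K K0 mK) [LHS]integral_mul_indic; last exact: measurable_sphere.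
have mI1 : measurable_fun setT (\1_(`]1, +oo[%classic : set R) : R -> R).
  exact: measurable_indic.
have mJ := mradial (F := fun p => \1_(`]1, +oo[%classic : set R) p.2)
  (fun p => ler0n _ _) (measurableT_comp mI1 measurable_snd).
have iJ : lam.-integrable (sphere R d) (fun xi => (\int[leb]_(r in Rpos R)
     (\1_(`]1, +oo[%classic : set R) r * g xi (theta r))%:E)%E).
  apply/integrableP; split; first exact: measurable_funTS.
  apply: le_lt_trans fin; apply: eq_lee; apply: eq_integral => xi _; rewrite gee0_abs//; apply: integral_ge0 => r.
  rewrite in_Rpos => r0.
  by rewrite lee_fin mulr_ge0// (completely_monotone_ge0 (cmg _))// theta0.
have aeJ := integrable_ae (@measurable_sphere R d) iJ.
have J0 (xi : Rd R d) :
    (0 <= \int[leb]_(r in Rpos R) (F (xi, r) * g xi (theta r))%:E)%E.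
  apply: integral_ge0 => r; rewrite in_Rpos => r0.
  by rewrite lee_fin mulr_ge0// (completely_monotone_ge0 (cmg _))// theta0.
have mwK : measurable_fun setT (fun p : Rd R d * R => (w p)%:E * K (phi p))%E.
  apply: emeasurable_funM; first exact/measurable_EFinP.
  exact: (measurableT_comp mK mphi).
have wK0 (p : Rd R d * R) : (0 <= (w p)%:E * K (phi p))%E by rewrite mule_ge0// lee_fin.
apply: ge0_ae_eq_integral.
- exact: measurableT.
- apply: emeasurable_funM; last exact: mradial.
  by apply/measurable_EFinP; apply: measurable_indic; exact: measurable_sphere.
- exact: (measurable_integral_leb mwK wK0).
- by move=> xi _; apply: mule_ge0; [rewrite lee_fin | exact: J0].
- by move=> xi _; apply: integral_ge0.
apply: (@filterS _ _ (ae_filter_ringOfSetsType lam)) aeJ => xi fJ _.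
have [xiS|xiS] := pselect (sphere R d xi); last first.
  rewrite indicE memNset// mul0e; apply/esym/integral0_eq => v _.
  by rewrite /w/= indicE memNset// mul0r mul0e.
have a0 : bernstein_atom (g xi) = 0%E.
  apply: (bernstein_atom_eq0 (cmg xi) theta0 (mgs xi)).
  rewrite -ge0_fin_numE; first exact: fJ.
  apply: integral_ge0 => r; rewrite in_Rpos => r0.
  by rewrite lee_fin mulr_ge0// (completely_monotone_ge0 (cmg _))// theta0.
rewrite indicE mem_set// mul1e.
pose T (p : R * R) := \1_(Rpos R) p.1 * F (xi, p.1) *
  (bernstein_weight (g xi) p.2 * expR (theta p.1 * ln (bernstein 1 (g xi) p.2))).
have bw0 v : 0 <= bernstein_weight (g xi) v.
  by rewrite bernstein_weight_ge0// (completely_monotone_ge0 (cmg _)).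
have T0 p : (0 <= (T p)%:E)%E by rewrite lee_fin /T !mulr_ge0 ?expR_ge0.
have mT : measurable_fun setT (fun p => (T p)%:E).
  have mR : measurable_fun setT (\1_(Rpos R) : R -> R).
    by apply: measurable_indic; exact: measurable_Rpos.
  have mF2 : measurable_fun setT (fun r : R => F (xi, r)).
    exact: measurable_section.
  apply/measurable_EFinP; apply: measurable_funM.
    apply: measurable_funM; first exact: (measurableT_comp mR measurable_fst).
    exact: (measurableT_comp mF2 measurable_fst).
  apply: measurable_funM.
    exact: (measurableT_comp (measurable_bernstein_weight1 (g xi)) measurable_snd).
  have me : measurable_fun setT (fun p : R * R =>
      theta p.1 * ln (bernstein 1 (g xi) p.2)).
    apply: measurable_funM; first exact: (measurableT_comp mtheta measurable_fst).
    have ml := measurableT_comp (@measurable_ln R) (measurable_bernstein 1 (g xi)).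
    exact: (measurableT_comp ml measurable_snd).
  exact: (measurableT_comp (@measurable_expR R) me).
transitivity (\int[leb]_r \int[leb]_v (T (r, v))%:E)%E.
  rewrite integral_RposE.
  apply: eq_integral => r _; rewrite indicE; case: (boolP (r \in Rpos R)) => rR; last first.
    rewrite mul0e; apply/esym/integral0_eq => v _.
    by rewrite /T/= indicE (negbTE rR) !mul0r.
  have r0 : 0 < r by move: rR; rewrite inE in_Rpos.
  rewrite mul1e EFinM (bernstein_split (cmg xi) (theta0 r0)) a0 adde0.
  rewrite -ge0_integralZl//; first last.
  - by rewrite lee_fin.
  - by move=> v _; rewrite lee_fin mulr_ge0// expR_ge0.
  - by apply/measurable_EFinP; exact: measurable_bernstein_kernel.
  by apply: eq_integral => v _; rewrite /T/= indicE rR mul1r.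
rewrite (@fubini_tonelli _ _ _ _ _ leb leb (fun p => (T p)%:E) mT T0).
apply: eq_integral => v _.
have [w0|wn0] := eqVneq (w (xi, v)) 0.
  rewrite w0 mul0e; apply: integral0_eq => r _; rewrite /T/=.
  by move: w0; rewrite /w/= indicE mem_set// mul1r => ->; rewrite mul0r mulr0.
have [e dE] := phiE wn0.
rewrite /K -ge0_integralZl; first last.
- by rewrite lee_fin.
- by move=> r _; rewrite lee_fin !mulr_ge0 ?expR_ge0.
- apply/measurable_EFinP/measurable_funTS.
  have mk := @measurable_radial_kernel (fun=> 1) theta F (measurable_cst (1:R)) mtheta mF.
  exact: (measurable_section (phi (xi, v)) mk).
- exact: measurable_Rpos.
rewrite [RHS]integral_RposE.
apply: eq_integral => r _; rewrite dE e invrK -!EFinM /T/=; congr EFin.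
rewrite /w/= [\1_(sphere R d) xi]indicE mem_set// !mul1r mulrN opprK /Z/=.
by rewrite -!mulrA; congr (_ * _); rewrite mulrCA.
Qed.

End core.
End polar_to_mixture.

(** * Disintegration *)

Section disintegration.
Local Open Scope ereal_scope.

Lemma finite_density d (T : measurableType d) (R : realType)
    (mu nu : {measure set T -> \bar R}) :
    mu setT < +oo -> (forall A, measurable A -> nu A <= mu A) ->
  exists f : T -> R, [/\ measurable_fun setT f, forall x, (0 <= f x)%R,
    mu.-integrable setT (EFin \o f) &
    forall A, measurable A -> nu A = \int[mu]_(x in A) (f x)%:E].
Proof.
move=> muoo numu.
have nuoo : nu setT < +oo by apply: le_lt_trans muoo; exact: numu.
pose mu' : {finite_measure set T -> \bar R} := mfrestr measurableT muoo.
pose nu' : {finite_measure set T -> \bar R} := mfrestr measurableT nuoo.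
have muE A : mu' A = mu A by rewrite /mu'/= /mfrestr/= /mrestr setIT.
have nuE A : nu' A = nu A by rewrite /nu'/= /mfrestr/= /mrestr setIT.
have muI A f : \int[mu']_(x in A) f x = \int[mu]_(x in A) f x.
  by apply: eq_measure_integral => B mB _; exact: muE.
have dom A : measurable A -> mu' A = 0 -> nu' A = 0.
  move=> mA; rewrite muE nuE => A0.
  by apply/eqP; rewrite eq_le measure_ge0 andbT -A0 numu.
have [|f [f0 ffin fi fE]] := @radon_nikodym_sigma_finite _ _ _ mu' nu'.
  exact/null_content_dominatesP.
have fK : f = EFin \o (fine \o f) by apply/funext => x /=; rewrite fineK.
exists (fine \o f); split.
- by apply: measurableT_comp => //; exact: measurable_int fi.
- by move=> x; exact: fine_ge0.
- rewrite -fK; move/integrableP : fi => [mf fi]; apply/integrableP; split => //.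
  by rewrite -muI.
- by move=> A mA; rewrite -nuE fE// muI; apply: eq_integral => x _; rewrite /= fineK.
Qed.

(** With [w rho] as reference measure, the density [D (i, j)] is the conditional mean of
    [(1 - f)^i f^j] given [e]. So [Z (xi, .)] has the conditional law of [f] given [e = xi], and the
    identity for all [F] follows from that of joint moments. *)
Lemma disintegration d1 d2 (X : measurableType d1) (E : measurableType d2)
    (R : realType) (rho : {measure set X -> \bar R}) (w f : X -> R) (e : X -> E) :
    (forall x, 0 <= w x)%R -> measurable_fun setT w ->
    (forall x, 0 <= f x <= 1)%R -> measurable_fun setT f -> measurable_fun setT e ->
    \int[rho]_x (w x)%:E < +oo ->
  exists (lam : {measure set E -> \bar R}) (Z : E * R -> R),
    [/\ measurable_fun setT Z, forall p, (0 <= Z p <= 1)%R &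
    forall F : E * R -> \bar R, (forall p, 0 <= F p) -> measurable_fun setT F ->
      \int[rho]_x ((w x)%:E * F (e x, f x)) =
      \int[lam]_xi \int[@lebesgue_measure R]_v
         ((\1_(`[0%R, 1%R[%classic : set R) v)%:E * F (xi, Z (xi, v)))].
Proof.
move=> w0 mw f01 mf me woo.
pose wij i j x := (w x * ((1 - f x) ^+ i * f x ^+ j))%R.
have f0 x : (0 <= f x)%R by have /andP[] := f01 x.
have f1 x : (0 <= 1 - f x)%R by have /andP[_] := f01 x; rewrite subr_ge0.
have wij0 i j x : (0 <= wij i j x)%R by rewrite /wij !mulr_ge0 ?exprn_ge0.
have mwij i j : measurable_fun setT (wij i j).
  apply: measurable_funM => //; apply: measurable_funM; apply: measurable_funX => //.
  exact: measurable_funB.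
have /choice[nu nuE] : forall ij : nat * nat, exists m : {measure set E -> \bar R},
    forall h : E -> \bar R, (forall z, 0 <= h z) -> measurable_fun setT h ->
    \int[m]_z h z = \int[rho]_x ((wij ij.1 ij.2 x)%:E * h (e x)).
  by move=> ij; exact: weighted_pushforward.
pose lam := nu (0, 0)%N.
have nuA i j A : measurable A -> nu (i, j) A = \int[rho]_x (wij i j x * \1_A (e x))%:E.
  move=> mA; rewrite -integral_indicT// nuE//; exact/measurable_EFinP/measurable_indic.
have mwA i j A : measurable A ->
    measurable_fun setT (fun x => (wij i j x * \1_A (e x))%:E : \bar R).
  move=> mA; apply/measurable_EFinP; apply: measurable_funM => //.
  have mI : measurable_fun setT (\1_A : E -> R) by exact: measurable_indic.
  exact: (measurableT_comp mI me).
have w00 x : wij 0%N 0%N x = w x by rewrite /wij !expr0 !mulr1.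
have lamoo : lam setT < +oo.
  rewrite nuA//; apply: le_lt_trans woo; apply: eq_lee.
  by apply: eq_integral => x _; rewrite w00 indicT/= mulr1.
have wle i j x : (wij i j x <= w x)%R.
  rewrite /wij ler_piMr// mulr_ile1 ?exprn_ge0// exprn_ile1// ?lerBlDr ?lerDl//.
  by have /andP[] := f01 x.
have nule ij A : measurable A -> nu ij A <= lam A.
  move=> mA; case: ij => i j; rewrite !nuA//; apply: ge0_le_integral => //.
  - by move=> x _; rewrite lee_fin mulr_ge0.
  - exact: mwA.
  - exact: mwA.
  - by move=> x _; rewrite lee_fin ler_wpM2r// w00.
have /choice[D DE] := fun ij => finite_density lamoo (nule ij).
have nuS i j A : measurable A -> nu (i, j) A = nu (i.+1, j) A + nu (i, j.+1) A.
  move=> mA; rewrite !nuA// -ge0_integralD//; first last.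
  - exact: mwA.
  - by move=> x _; rewrite lee_fin mulr_ge0.
  - exact: mwA.
  - by move=> x _; rewrite lee_fin mulr_ge0.
  by apply: eq_integral => x _; rewrite -EFinD; congr EFin; rewrite /wij !exprS; ring.
have mD ij : measurable_fun setT (D ij) by have [] := DE ij.
have D0 ij x : (0 <= D ij x)%R by have [] := DE ij.
(* The urn identities hold almost everywhere for each [(i, j)]; being countably many, they hold
   together off one null set. *)
pose G := [set xi | D (0, 0)%N xi = 1%R /\
  forall i j, (D (i, j) xi = D (i.+1, j) xi + D (i, j.+1) xi)%R].
have iD ij : lam.-integrable setT (EFin \o D ij) by have [] := DE ij.
have nuD ij A : measurable A -> nu ij A = \int[lam]_(x in A) (D ij x)%:E.
  by have [_ _ _] := DE ij; exact.
have aeG : {ae lam, forall xi, G xi}.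
  have ae1 : ae_eq lam setT (EFin \o D (0, 0)%N) (cst 1).
    apply: integral_ae_eq => //.
    by move=> A _ mA; rewrite -nuD// integral_cst// mul1e.
  have aeS ij : ae_eq lam setT (EFin \o D ij)
      (fun x => (D (ij.1.+1, ij.2) x + D (ij.1, ij.2.+1) x)%:E).
    apply: integral_ae_eq => //.
      by apply/measurable_EFinP; apply: measurable_funD.
    move=> A _ mA; rewrite -nuD//; case: ij => i j /=; rewrite nuS// !nuD//.
    rewrite -ge0_integralD//.
    - by move=> x _; rewrite lee_fin.
    - by apply/measurable_funTS/measurable_EFinP.
    - by move=> x _; rewrite lee_fin.
    - by apply/measurable_funTS/measurable_EFinP.
  have {aeS} aeS' : {ae lam, forall xi, forall i j,
      D (i, j) xi = (D (i.+1, j) xi + D (i, j.+1) xi)%R}.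
    apply/ae_foralln => i; apply/ae_foralln => j.
    by apply: (@filterS _ _ (ae_filter_ringOfSetsType lam)) (aeS (i, j)) => xi /(_ I) [].
  by apply: (@filterS2 _ _ (ae_filter_ringOfSetsType lam)) ae1 aeS' => xi /(_ I) [h1] hS.
have meq (a b : E -> R) : measurable_fun setT a -> measurable_fun setT b ->
    measurable [set xi | a xi = b xi].
  move=> ma mb; have := measurable_fun_eqr ma mb => /(_ measurableT [set true]).
  rewrite setTI (_ : _ @^-1` _ = [set xi | a xi = b xi]); first exact.
  by apply/seteqP; split => x /eqP.
have mG : measurable G.
  rewrite (_ : G = [set xi | D (0, 0)%N xi = 1%R] `&` \bigcap_i \bigcap_j
    [set xi | D (i, j) xi = (D (i.+1, j) xi + D (i, j.+1) xi)%R]).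
    apply: measurableI; first by apply: meq.
    apply: bigcapT_measurable => i; apply: bigcapT_measurable => j.
    by apply: meq => //; exact: measurable_funD.
  apply/seteqP; split => xi /= [h1 h2]; split => // i; first by move=> _ j _; exact: h2.
  by move=> j; exact: h2.
(* Off [G] the array of the constant variable [1/2] is substituted; it satisfies the same
   identities, so the urn applies at every [xi]. *)
pose q i j xi : R := if xi \in G then D (i, j) xi else (2^-1 ^+ (i + j))%R.
have mq i j : measurable_fun setT (q i j).
  apply: measurable_fun_ifT => //.
  apply: (@measurable_fun_bool _ _ _ _ true); rewrite setTI.
  rewrite (_ : _ @^-1` _ = G)//.
  by apply/seteqP; split => x; [move/set_mem | move/mem_set].
have q0 i j xi : (0 <= q i j xi)%R.
  by rewrite /q; case: ifPn => // _; rewrite exprn_ge0// invr_ge0.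
have qS xi i j : (q i j xi = q i.+1 j xi + q i j.+1 xi)%R.
  rewrite /q; case: ifPn => [|_]; first by rewrite inE => -[_]; exact.
  by rewrite addnS addSn exprS; field.
have q00 xi : (q 0%N 0%N xi = 1)%R.
  by rewrite /q; case: ifPn => [|_]; [rewrite inE => -[]|rewrite expr0].
pose Z (p : E * R) := urn_limit (fun i j => q i j p.1) p.2.
have mZ : measurable_fun setT Z by exact: measurable_urn_limit.
have Z01 p : (0 <= Z p <= 1)%R by exact: urn_limit01.
exists lam, Z; split => // F F0 mF.
have one0 p : (0 <= (\1_(`[0%R, 1%R[%classic : set R) (p : E * R).2 : R))%R by [].
have mone : measurable_fun setT (fun p : E * R => (\1_(`[0%R, 1%R[%classic : set R) p.2 : R)).
  have mU : measurable_fun setT (\1_(`[0%R, 1%R[%classic : set R) : R -> R).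
    exact: measurable_indic.
  exact: (measurableT_comp mU measurable_snd).
have [m mE] := mixture_measure lam (@lebesgue_measure R) one0 mone (@measurable_id _ _ setT).
have mFZ : measurable_fun setT (fun p => F (p.1, Z p)).
  by apply: (measurableT_comp mF); apply/measurable_fun_pair.
transitivity (\int[m]_p F (p.1, Z p)); last by rewrite mE.
under [RHS]eq_integral do rewrite -[F _]mul1e.
apply: (joint_moment_unique (mu1 := rho) (mu2 := m) (w1 := w) (w2 := cst 1%R)
  (e1 := e) (e2 := fst) (f1 := f) (f2 := Z)) => // C j mC.
transitivity (nu (0, j)%N C).
  rewrite nuA//; apply: eq_integral => x _; congr EFin.
  by rewrite /wij expr0; ring.
have mC1 : measurable_fun setT (\1_C : E -> R) by exact: measurable_indic.
have mom0 p : (0 <= (cst 1 p * (\1_C p.1 * Z p ^+ j))%:E :> \bar R).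
  by rewrite lee_fin !mulr_ge0// exprn_ge0//; have /andP[] := Z01 p.
have mmom : measurable_fun setT (fun p : E * R => (cst 1 p * (\1_C p.1 * Z p ^+ j))%:E : \bar R).
  apply/measurable_EFinP; apply: measurable_funM => //; apply: measurable_funM.
    exact: (measurableT_comp mC1 measurable_fst).
  exact: measurable_funX.
rewrite nuD// [LHS]integral_mul_indic// (mE _ mom0 mmom).
transitivity (\int[lam]_xi ((\1_C xi)%:E * (q 0%N j xi)%:E)).
  apply: ge0_ae_eq_integral => //.
  - by apply: emeasurable_funM; apply/measurable_EFinP.
  - by apply: emeasurable_funM; apply/measurable_EFinP.
  - by move=> x _; rewrite mule_ge0 ?lee_fin.
  - by move=> x _; rewrite mule_ge0 ?lee_fin.
  apply: (@filterS _ _ (ae_filter_ringOfSetsType lam)) aeG => xi xiG _.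
  by rewrite /q mem_set.
apply: eq_integral => xi _.
rewrite -(integral_urn_limit (fun i j => q0 i j xi) (qS xi)) q00 mul1e.
rewrite integral_mul_indic// -ge0_integralZl//; first last.
- move=> v _; rewrite -EFinM lee_fin mulr_ge0// exprn_ge0//.
  by have /andP[] := urn_limit01 (fun i j => q i j xi) v.
- have mU : measurable_fun setT (\1_(`[0%R, 1%R[%classic : set R) : R -> R).
    exact: measurable_indic.
  apply: emeasurable_funM; apply/measurable_EFinP => //.
  by apply: measurable_funX; exact: (measurable_section xi mZ).
by apply: eq_integral => v _; rewrite -!EFinM/= mul1r mulrCA.
Qed.

End disintegration.

(** * From mixtures of exponentials to polar decompositions *)

Section mixture_to_polar.
Context {R : realType} {d : nat}.
Local Notation leb := (@lebesgue_measure R).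
Local Notation U01 := (`[0, 1[%classic : set R).

Lemma completely_monotone_expR : completely_monotone (fun u : R => expR (1 - u)).
Proof.
have h := @completely_monotone_intro R (fun n u => (-1) ^+ n * expR (1 - u)).
have -> : (fun u : R => expR (1 - u)) = (fun u => (-1) ^+ 0 * expR (1 - u)).
  by apply/funext => u; rewrite mul1r.
apply: h => n u u0; last by rewrite mulrA -exprMn mulrN1 opprK expr1n mul1r expR_ge0.
have h1 : is_derive u (1:R) (fun u : R => 1 - u) (-1).
  rewrite -[-1]sub0r; exact: (is_deriveB (is_derive_cst (1:R) u 1) (is_derive_id u 1)).
have h2 := @is_derive1_comp _ expR (fun u : R => 1 - u) u _ _ (is_derive_expR _) h1.
have h3 := is_deriveZ ((-1) ^+ n) h2.
by apply: is_derive_eq; rewrite /GRing.scale/= exprS; ring.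
Qed.

(** This is [z^(u - 1)] for [0 < z], written as a weighted Laplace kernel with exponent [- ln z]; at
    [z = 0] it is [0] since [0^-1 = 0]. *)
Definition pow_ker (z u : R) : R := `|z|^-1 * expR (- (u * - ln z)).

Lemma pow_ker_ge0 z u : 0 <= pow_ker z u.
Proof. by rewrite mulr_ge0 ?expR_ge0 ?invr_ge0. Qed.

Lemma measurable_pow_ker d' (X : measurableType d') (a b : X -> R) :
  measurable_fun setT a -> measurable_fun setT b ->
  measurable_fun setT (fun x => pow_ker (a x) (b x)).
Proof.
move=> ma mb; apply: measurable_funM.
  by apply: measurable_funV; exact: (measurableT_comp (@normr_measurable R setT) ma).
have ml := measurableT_comp (@measurable_ln R) ma.
by apply: measurable_expRN; apply: measurable_funM => //; exact: measurable_funN.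
Qed.

Let X (x : Rd R d) : R := expR (- (enorm x)^-1).

Let X01 x : 0 <= X x <= 1.
Proof. by rewrite expR_ge0 -expR0 ler_expR oppr_le0 invr_ge0 enorm_ge0. Qed.

Let mX : measurable_fun setT X.
Proof.
by apply: measurable_expRN; apply: measurable_funV; exact: measurable_enorm.
Qed.

Let X_pow_ker x u : X x * pow_ker (X x) u = expR (- (u / enorm x)).
Proof.
by rewrite /pow_ker mulrA ger0_norm ?expR_ge0// divff ?gt_eqF ?expR_gt0// mul1r expRK opprK.
Qed.

Variables (rho : {measure set (Rd R d) -> \bar R}) (theta : R -> R).
Hypotheses (rho0 : rho [set 0] = 0%E)
  (fin : forall u : R, 0 < u -> (\int[rho]_x (expR (- (u / enorm x)))%:E < +oo)%E)
  (mtheta : measurable_fun [set: R] theta)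
  (theta0 : forall r : R, 0 < r -> 0 < theta r).

Let Xoo : (\int[rho]_x (X x)%:E < +oo)%E.
Proof.
apply: le_lt_trans (fin ltr01); apply: eq_lee.
by apply: eq_integral => x _; rewrite /X div1r.
Qed.

(** [rho] weighted by [X = e^(-1/|x|)] is finite and is disintegrated over the directions. The
    densities are [g xi u = int_0^1 Z(xi, v)^(u - 1) dv], a Laplace transform in [u]; the shift by
    one undoes the weight [X]. *)
Lemma mixture_to_polar :
  exists (lam : {measure set (Rd R d) -> \bar R}) (g : Rd R d -> R -> R),
  [/\ lam (~` sphere R d) = 0%E, forall xi, completely_monotone (g xi),
    forall xi, g xi 1 = 1,
    measurable_fun setT (fun p : Rd R d * R => g p.1 p.2) &
    forall F : Rd R d * R -> R, (forall p, 0 <= F p) -> measurable_fun setT F ->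
    (\int[lam]_(xi in sphere R d) \int[leb]_(r in Rpos R)
      (F (xi, r) * g xi (theta r))%:E)%E = radial_mix (fun=> 1) theta rho F].
Proof.
have [lam [Z [mZ Z01 lamE]]] := disintegration (fun x => expR_ge0 _) mX X01 mX
  (@measurable_direction R d) Xoo.
have mU : measurable_fun setT (\1_U01 : R -> R) by exact: measurable_indic.
pose gE (xi : Rd R d) (u : R) := (\int[leb]_v ((\1_U01 v)%:E * (pow_ker (Z (xi, v)) u)%:E))%E.
have gE_ge0 xi u : (0 <= gE xi u)%E.
  by apply: integral_ge0 => v _; rewrite mule_ge0// lee_fin pow_ker_ge0.
have mgE : measurable_fun setT (fun p : Rd R d * R => gE p.1 p.2).
  pose G (q : Rd R d * R * R) := ((\1_U01 q.2)%:E * (pow_ker (Z (q.1.1, q.2)) q.1.2)%:E)%E.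
  have G0 q : (0 <= G q)%E by rewrite /G mule_ge0// lee_fin pow_ker_ge0.
  have mG : measurable_fun setT G.
    apply: emeasurable_funM; apply/measurable_EFinP.
      exact: (measurableT_comp mU measurable_snd).
    apply: measurable_pow_ker; last exact: (measurableT_comp measurable_snd measurable_fst).
    apply: (measurableT_comp mZ); apply/measurable_fun_pair => //.
    exact: (measurableT_comp measurable_fst measurable_fst).
  exact: (measurable_integral_leb mG G0).
have intU (c : \bar R) : (\int[leb]_v ((\1_U01 v)%:E * c) = c)%E.
  have mU' : measurable (U01 : set (measurableTypeR R)) by exact: measurable_itv.
  by rewrite -integral_mul_indic// integral_cst//= lebesgue_measure_itv/= lte_fin ltr01
    oppr0 adde0 mule1.
have lamC (C : set (Rd R d)) : measurable C ->
    lam C = (\int[rho]_x ((X x)%:E * (\1_C (direction x))%:E))%E.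
  move=> mC; have mC1 : measurable_fun setT (\1_C : Rd R d -> R) by exact: measurable_indic.
  rewrite (lamE (fun p => (\1_C p.1)%:E)) => [|p|].
  - rewrite -integral_indicT//; apply: eq_integral => xi _ /=.
    by rewrite intU.
  - by rewrite lee_fin.
  - by apply/measurable_EFinP; exact: (measurableT_comp mC1 measurable_fst).
have mker xi u : measurable_fun setT
    (fun v => (\1_U01 v)%:E * (pow_ker (Z (xi, v)) u)%:E : \bar R)%E.
  apply: emeasurable_funM; apply/measurable_EFinP => //.
  by apply: measurable_pow_ker => //; exact: measurable_section.
have gEC (C : set (Rd R d)) u : measurable C ->
    (\int[lam]_(xi in C) gE xi u =
     \int[rho]_x ((\1_C (direction x))%:E * (expR (- (u / enorm x)))%:E))%E.
  move=> mC; have mC1 : measurable_fun setT (\1_C : Rd R d -> R) by exact: measurable_indic.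
  transitivity (\int[rho]_x ((X x)%:E * (\1_C (direction x) * pow_ker (X x) u)%:E))%E; last first.
    by apply: eq_integral => x _; rewrite -!EFinM mulrCA X_pow_ker.
  rewrite (lamE (fun p => (\1_C p.1 * pow_ker p.2 u)%:E)) => [|p|].
  - rewrite integral_mul_indic//; apply: eq_integral => xi _ /=.
    rewrite /gE -ge0_integralZl//; first last.
    + by move=> v _; rewrite mule_ge0// lee_fin pow_ker_ge0.
    + exact: mker.
    by apply: eq_integral => v _; rewrite EFinM muleCA.
  - by rewrite lee_fin mulr_ge0// pow_ker_ge0.
  - apply/measurable_EFinP; apply: measurable_funM.
      exact: (measurableT_comp mC1 measurable_fst).
    by apply: measurable_pow_ker.
have lamS : lam (~` sphere R d) = 0%E.
  have mSC : measurable (~` sphere R d) by apply: measurableC; exact: measurable_sphere.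
  have m0 := @measurable_set_zero R d.
  have mc : measurable_fun setT (\1_(~` sphere R d) : Rd R d -> R) by exact: measurable_indic.
  apply/eqP; rewrite eq_le measure_ge0 andbT -rho0 lamC// -[leRHS]integral_indicT//.
  apply: ge0_le_integral => //.
  - by move=> x _; rewrite mule_ge0// lee_fin expR_ge0.
  - apply: emeasurable_funM; apply/measurable_EFinP => //.
    exact: (measurableT_comp mc (@measurable_direction R d)).
  - by apply/measurable_EFinP; exact: measurable_indic.
  - move=> x _; rewrite -EFinM lee_fin.
    have [->|x0] := eqVneq x 0.
      by rewrite [leRHS]indicE mem_set// mulr_ile1 ?expR_ge0//; have /andP[] := X01 0.
    by rewrite [\1_(~` _) _]indicE memNset ?mulr0//; apply; exact: direction_sphere.
have mgu u : measurable_fun setT (gE^~ u).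
  have mp : measurable_fun setT (fun xi : Rd R d => (xi, u)) by apply/measurable_fun_pair.
  exact: (measurableT_comp mgE mp).
(* [pow_ker z 1] is [1] for [z > 0] and [0] for [z = 0]: the claim is that [Z (xi, .)] is almost
   everywhere positive, which it inherits from [X > 0]. *)
have ae1 : {ae lam, forall xi, gE xi 1 = 1%E}.
  have h : ae_eq lam setT (cst 1%E) (gE^~ 1).
    apply: integral_ae_eq => //.
      apply/integrableP; split => //.
      have -> : (\int[lam]_x `|cst 1%E x| = lam setT)%E.
        transitivity (\int[lam]_x cst 1%E x)%E; last by rewrite integral_cst// mul1e.
        by apply: eq_integral => x _; rewrite gee0_abs.
      rewrite lamC//.
      apply: le_lt_trans Xoo; apply: eq_lee.
      by apply: eq_integral => x _; rewrite indicT mule1.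
    move=> C _ mC; rewrite gEC// integral_cst// mul1e lamC//.
    by apply: eq_integral => x _; rewrite muleC /X div1r.
  by apply: (@filterS _ _ (ae_filter_ringOfSetsType lam)) h => xi /(_ I).
(* As [Z <= 1], [gE xi] is nonincreasing, so finiteness at the points [1 / (k + 1)] gives finiteness
   on the whole positive half-line off a single null set. *)
have aefin : {ae lam, forall xi, forall k, (gE xi (k.+1%:R^-1)%R < +oo)%E}.
  apply/ae_foralln => k.
  have h : lam.-integrable setT (gE^~ k.+1%:R^-1).
    apply/integrableP; split => //.
    have k0 : 0 < k.+1%:R^-1 :> R by rewrite invr_gt0 ltr0n.
    apply: le_lt_trans (fin k0); apply: eq_lee.
    transitivity (\int[lam]_(xi in setT) gE xi (k.+1%:R^-1)%R)%E.
      by apply: eq_integral => xi _; rewrite gee0_abs.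
    by rewrite gEC//; apply: eq_integral => x _; rewrite indicT mul1e.
  apply: (@filterS _ _ (ae_filter_ringOfSetsType lam)) (integrable_ae measurableT h).
  by move=> xi /(_ I); rewrite ge0_fin_numE.
(* Off the full set [A] any completely monotone function with value [1] at [1]
   will do. *)
pose A : set (Rd R d) := [set xi | gE xi 1 = 1%E] `&` \bigcap_k [set xi | (gE xi (k.+1%:R^-1)%R < +oo)%E].
have mA : measurable A.
  apply: measurableI.
    rewrite -[X in measurable X]setTI.
    exact: (mgu 1 measurableT [set 1%E] (emeasurable_set1 _)).
  apply: bigcapT_measurable => k; rewrite -[X in measurable X]setTI.
  exact: emeasurable_fun_infty_o.
pose lap (xi : Rd R d) := laplace_deriv leb U01 (fun v => `|Z (xi, v)|^-1) (fun v => - ln (Z (xi, v))) 0.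
have lapE xi u : lap xi u = fine (gE xi u).
  rewrite /lap /laplace_deriv /Rintegral; congr fine.
  rewrite integral_mul_indic; last exact: measurable_itv.
  by apply: eq_integral => v _; rewrite expr0 mulr1.
have gE_fin xi u : A xi -> 0 < u -> (gE xi u < +oo)%E.
  move=> [_ Axi] u0; have [k ku] : exists k, k.+1%:R^-1 < u.
    exists (Num.truncn u^-1); rewrite invf_plt ?posrE ?ltr0n//.
    exact: truncnS_gt.
  apply: le_lt_trans (Axi k I); apply: ge0_le_integral => //.
  - by move=> v _; rewrite mule_ge0// lee_fin pow_ker_ge0.
  - exact: mker.
  - exact: mker.
  - move=> v _; apply: lee_wpmul2l => //; rewrite lee_fin /pow_ker ler_wpM2l ?invr_ge0//.
    rewrite ler_expR lerN2 ler_wpM2r// ?(ltW ku)// oppr_ge0 ln_le0//.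
    by have /andP[] := Z01 (xi, v).
have gEK xi u : A xi -> 0 < u -> ((lap xi u)%:E = gE xi u)%E.
  by move=> Axi u0; rewrite lapE fineK// ge0_fin_numE// gE_fin.
pose g (xi : Rd R d) (u : R) := if xi \in A then lap xi u else expR (1 - u).
have cmg xi : completely_monotone (g xi).
  have [xiA|xiA] := boolP (xi \in A); last first.
    rewrite (_ : g xi = fun u => expR (1 - u)); first exact: completely_monotone_expR.
    by apply/funext => u; rewrite /g (negbTE xiA).
  have Axi : A xi by rewrite inE in xiA.
  rewrite (_ : g xi = lap xi); last by apply/funext => u; rewrite /g xiA.
  apply: completely_monotone_laplace.
  - exact: measurable_itv.
  - by move=> v; rewrite invr_ge0.
  - by move=> v; rewrite oppr_ge0 ln_le0//; have /andP[] := Z01 (xi, v).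
  - apply: measurable_funV; apply: (measurableT_comp (@normr_measurable R setT)).
    exact: measurable_section.
  - apply: measurable_funN; apply: (measurableT_comp (@measurable_ln R)).
    exact: measurable_section.
  - move=> u u0; rewrite integral_mul_indic; last exact: measurable_itv.
    exact: gE_fin.
have g1 xi : g xi 1 = 1.
  rewrite /g; case: ifPn => [|_]; last by rewrite subrr expR0.
  by rewrite inE => Axi; rewrite lapE (proj1 Axi).
have mg : measurable_fun setT (fun p : Rd R d * R => g p.1 p.2).
  apply: measurable_fun_ifT.
  - apply: (@measurable_fun_bool _ _ _ _ true); rewrite setTI.
    rewrite (_ : _ @^-1` _ = A `*` setT); first exact: measurableX.
    by apply/seteqP; split => -[x y] /=; [move/set_mem | move=> []/mem_set].
  - rewrite (_ : (fun p => _) = fun p => fine (gE p.1 p.2)); last first.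
      by apply/funext => p; rewrite lapE.
    exact: measurableT_comp.
  - have me : measurable_fun setT (fun p : Rd R d * R => 1 - p.2).
      by apply: measurable_funB.
    exact: (measurableT_comp (@measurable_expR R) me).
exists lam, g; split => // F F0 mF.
have mI : measurable_fun setT (\1_(Rpos R) : R -> R).
  by apply: measurable_indic; exact: measurable_Rpos.
pose H (q : Rd R d * R * R) : \bar R :=
  ((\1_(Rpos R) q.2)%:E * (F (q.1.1, q.2) * pow_ker q.1.2 (theta q.2))%:E)%E.
have H0 q : (0 <= H q)%E by rewrite /H mule_ge0// lee_fin mulr_ge0// pow_ker_ge0.
have mH : measurable_fun setT H.
  apply: emeasurable_funM; apply/measurable_EFinP.
    exact: (measurableT_comp mI measurable_snd).
  apply: measurable_funM.
    apply: (measurableT_comp mF); apply/measurable_fun_pair => //.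
    exact: (measurableT_comp measurable_fst measurable_fst).
  apply: measurable_pow_ker; first exact: (measurableT_comp measurable_snd measurable_fst).
  exact: (measurableT_comp mtheta measurable_snd).
pose Phi (p : Rd R d * R) := (\int[leb]_r H (p, r))%E.
have Phi0 p : (0 <= Phi p)%E by exact: integral_ge0.
have mPhi : measurable_fun setT Phi.
  exact: (measurable_integral_leb mH H0).
have -> : radial_mix (fun=> 1) theta rho F =
    (\int[rho]_x ((X x)%:E * Phi (direction x, X x)))%E.
  apply: eq_integral => x _.
  rewrite /Phi -ge0_integralZl; first last.
  - by rewrite lee_fin expR_ge0.
  - by move=> r _; exact: H0.
  - exact: (measurable_section (direction x, X x) mH).
  - exact: measurableT.
  rewrite [LHS]integral_RposE.
  apply: eq_integral => r _; rewrite /H -!EFinM /=; congr EFin.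
  by rewrite -X_pow_ker mul1r; ring.
rewrite (lamE _ Phi0 mPhi).
pose J (xi : Rd R d) := (\int[leb]_(r in Rpos R) (F (xi, r) * g xi (theta r))%:E)%E.
rewrite -/(J _).
have mJ : measurable_fun setT J.
  apply: (measurable_radial_integral (H := fun p => F p * g p.1 (theta p.2))).
    by move=> x r r0; rewrite mulr_ge0// (completely_monotone_ge0 (cmg _))// theta0.
  apply: measurable_funTS; apply: measurable_funM => //.
  have mp : measurable_fun setT (fun p : Rd R d * R => (p.1, theta p.2)).
    by apply/measurable_fun_pair => //; exact: (measurableT_comp mtheta measurable_snd).
  exact: (measurableT_comp mg mp).
have J0 xi : (0 <= J xi)%E.
  apply: integral_ge0 => r; rewrite in_Rpos => r0.
  by rewrite lee_fin mulr_ge0// (completely_monotone_ge0 (cmg _))// theta0.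
pose K (xi : Rd R d) := (\int[leb]_v ((\1_U01 v)%:E * Phi (xi, Z (xi, v))))%E.
have K0 xi : (0 <= K xi)%E by apply: integral_ge0 => v _; rewrite mule_ge0// lee_fin.
have mPhiZ : measurable_fun setT (fun p => Phi (p.1, Z p)).
  by apply: (measurableT_comp mPhi); apply/measurable_fun_pair.
have mK : measurable_fun setT K.
  pose G (p : Rd R d * R) := ((\1_U01 p.2)%:E * Phi (p.1, Z p))%E.
  have G0 p : (0 <= G p)%E by rewrite /G mule_ge0// lee_fin.
  have mG : measurable_fun setT G.
    apply: emeasurable_funM => //; apply/measurable_EFinP.
    exact: (measurableT_comp mU measurable_snd).
  exact: (measurable_integral_leb mG G0).
transitivity (\int[lam]_xi J xi)%E.
  rewrite [LHS]integral_mul_indic; last exact: measurable_sphere.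
  apply: ge0_ae_eq_integral => //.
  - apply: emeasurable_funM => //; apply/measurable_EFinP; apply: measurable_indic.
    exact: measurable_sphere.
  - by move=> xi _; rewrite -/(J xi) mule_ge0// lee_fin.
  - exists (~` sphere R d); split => //; first by apply: measurableC; exact: measurable_sphere.
    move=> xi; apply: contra_not => xiS _.
    by rewrite indicE mem_set ?mul1e//; apply: contrapT.
rewrite -[RHS]/(\int[lam]_xi K xi)%E; apply: ge0_ae_eq_integral => //.
apply: (@filterS2 _ _ (ae_filter_ringOfSetsType lam)) ae1 aefin => xi a1 afin _.
have Axi : A xi by split => // k _; exact: afin.
have xiA : xi \in A by rewrite inE.
pose T (p : R * R) := ((\1_U01 p.2)%:E * H ((xi, Z (xi, p.2)), p.1))%E.
have T0 p : (0 <= T p)%E by rewrite /T mule_ge0// lee_fin.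
have mT : measurable_fun setT T.
  apply: emeasurable_funM.
    by apply/measurable_EFinP; exact: (measurableT_comp mU measurable_snd).
  apply: (measurableT_comp mH); apply/measurable_fun_pair => //.
  apply/measurable_fun_pair => //.
  exact: (measurableT_comp (measurable_section xi mZ) measurable_snd).
transitivity (\int[leb]_r \int[leb]_v T (r, v))%E.
  rewrite /J integral_RposE.
  apply: eq_integral => r _; rewrite /T /H/=.
  rewrite indicE; case: (boolP (r \in Rpos R)) => rR; last first.
    rewrite mul0e; apply/esym/integral0_eq => v _.
    by rewrite mul0e mule0.
  have r0 : 0 < theta r by apply: theta0; move: rR; rewrite inE in_Rpos.
  rewrite mul1e EFinM /g xiA gEK// /gE -ge0_integralZl; first last.
  - by rewrite lee_fin.
  - by move=> v _; rewrite mule_ge0// lee_fin pow_ker_ge0.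
  - exact: mker.
  - exact: measurableT.
  by apply: eq_integral => v _; rewrite mul1e EFinM muleCA.
rewrite (swap_integral_leb mT T0).
apply: eq_integral => v _; rewrite /T/= /Phi -ge0_integralZl//.
exact: (measurable_section (xi, Z (xi, v)) mH).
Qed.
End mixture_to_polar.

(** * Integrals over the half-line *)

Section halfline.
Context {R : realType}.
Local Notation leb := (@lebesgue_measure R).

Lemma indic_Rpos (r : R) : \1_(Rpos R) r = (0 < r)%R%:R :> R.
Proof.
by rewrite indicE; congr (nat_of_bool _)%:R; apply/idP/idP; rewrite inE in_Rpos.
Qed.

Lemma measurable_indic_Rpos : measurable_fun setT (\1_(Rpos R) : R -> R).
Proof. by apply: measurable_indic; exact: measurable_Rpos. Qed.

Lemma eq_integral_Rpos (f g : R -> \bar R) : (forall r : R, 0 < r -> f r = g r) ->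
  (\int[leb]_(r in Rpos R) f r = \int[leb]_(r in Rpos R) g r)%E.
Proof. by move=> fg; apply: eq_integral => r; rewrite inE in_Rpos; exact: fg. Qed.

Lemma integral_Rpos_scale (a : R) (f : R -> \bar R) : 0 < a ->
    (forall r, (0 <= f r)%E) -> measurable_fun setT f ->
  (\int[leb]_(r in Rpos R) f r = a%:E * \int[leb]_(t in Rpos R) f (a * t)%R)%E.
Proof.
move=> a0 f0 mf; rewrite integral_RposE.
rewrite (lebesgue_integral_affine 0 (f := fun r => ((\1_(Rpos R) r)%:E * f r)%E) a0).
- rewrite [in RHS]integral_RposE.
  congr (_ * _)%E; apply: eq_integral => t _.
  by rewrite addr0 !indic_Rpos pmulr_rgt0.
- by move=> r; rewrite mule_ge0// lee_fin.
- by apply: emeasurable_funM => //; apply/measurable_EFinP; exact: measurable_indic_Rpos.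
Qed.

Lemma le_integral_Rpos (a b c : R) (f : R -> R) : 0 <= a -> a < b -> 0 <= c ->
    (forall r : R, 0 < r -> 0 <= f r) ->
    measurable_fun (Rpos R) f -> (forall r, a < r < b -> c <= f r) ->
  (((b - a) * c)%:E <= \int[leb]_(r in Rpos R) (f r)%:E)%E.
Proof.
move=> a0 ab c0 f0 mf fc.
have mI : measurable (`]a, b[%classic : set (measurableTypeR R)) by exact: measurable_itv.
have -> : ((b - a) * c)%:E = (\int[leb]_(r in `]a, b[) c%:E)%E.
  rewrite integral_cst//= lebesgue_measure_itv/= lte_fin ab -EFinB -EFinM mulrC //.
have sub : `]a, b[%classic `<=` Rpos R.
  by move=> r; rewrite in_Rpos /= in_itv/= => /andP[ar _]; apply: le_lt_trans ar.
apply: (@le_trans _ _ (\int[leb]_(r in `]a, b[) (f r)%:E)%E).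
  apply: ge0_le_integral => //.
    by apply/measurable_EFinP; apply: measurable_funS mf => //; exact: measurable_Rpos.
apply: ge0_subset_integral => //.
- exact: measurable_Rpos.
- exact/measurable_EFinP.
- by move=> r; rewrite in_Rpos => r0; rewrite lee_fin f0.
Qed.

Lemma integral_Rpos_expR_le (a : R) : 0 < a ->
  (\int[leb]_(t in Rpos R) (expR (- (a * t)))%:E <= a^-1%:E)%E.
Proof.
move=> a0; have pdf0 r := exponential_pdf_ge0 (ltW a0) r.
have mp : measurable_fun setT (fun t : R => a^-1 * exponential_pdf a t).
  by apply: measurable_funM => //; exact: measurable_exponential_pdf.
have -> : (a^-1%:E = \int[leb]_t (a^-1 * exponential_pdf a t)%:E)%E.
  rewrite -[LHS]mule1 -(integral_exponential_pdf a0) -ge0_integralZl//.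
  - by apply/measurable_EFinP; exact: measurable_exponential_pdf.
  - by move=> t _; rewrite lee_fin.
  - by rewrite lee_fin invr_ge0 ltW.
rewrite integral_RposE.
apply: ge0_le_integral => //.
- apply: emeasurable_funM; apply/measurable_EFinP; first exact: measurable_indic_Rpos.
  by apply: measurable_expRN; exact: measurable_funM.
- exact/measurable_EFinP.
- move=> t _; rewrite -EFinM lee_fin indic_Rpos; case: ltP => t0; last first.
    by rewrite mul0r mulr_ge0// invr_ge0 ltW.
  rewrite mul1r /exponential_pdf patchE ifT; last by rewrite inE/= in_itv/= ltW.
  by rewrite mulrA mulVf ?gt_eqF// mul1r mulNr.
Qed.

(** The value of the Gamma function at [1/2]. It enters as a scale factor, through its positivity
    and finiteness. *)
Definition half_gamma : \bar R := (\int[leb]_(t in Rpos R) (expR (- t) / Num.sqrt t)%:E)%E.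

Let mexp (a b : R -> R) : measurable_fun setT a -> measurable_fun setT b ->
  measurable_fun setT (fun t => expR (- (a t)) / Num.sqrt (b t)).
Proof.
move=> ma mb; apply: measurable_funM.
  by apply: measurable_expRN.
by apply: measurable_funV; exact: (measurableT_comp (@measurable_sqrt R) mb).
Qed.

Lemma half_gamma_gt0 : (0 < half_gamma)%E.
Proof.
apply: (@lt_le_trans _ _ (((2 - 1) * (expR (- 2) / Num.sqrt 2))%:E)%E).
  by rewrite lte_fin mulr_gt0 ?divr_gt0 ?expR_gt0 ?sqrtr_gt0// subr_gt0 ltrDl.
apply: le_integral_Rpos => //.
- by rewrite ltrDl.
- by apply: measurable_funTS; apply: mexp.
- move=> r /andP[r1 r2]; have r0 : 0 < r by apply: lt_trans r1.
  apply: ler_pM; rewrite ?expR_ge0 ?invr_ge0 ?sqrtr_ge0//.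
    by rewrite ler_expR lerN2 ltW.
  by rewrite lef_pV2 ?posrE ?sqrtr_gt0// ler_sqrt// ltW.
Qed.

(* [1 / sqrt t] is dominated by [expR 1] times the integral of
   [expR (- t v ^ 2)] in [v], and swapping the integrals leaves [1 / (1 + v ^ 2)]. *)
Lemma half_gamma_lty : (half_gamma < +oo)%E.
Proof.
have e1 : 0 < expR (- 1) :> R by exact: expR_gt0.
have mR := measurable_Rpos (R := R).
pose T (p : R * R) : \bar R :=
  ((\1_(Rpos R) p.1)%:E * ((\1_(Rpos R) p.2)%:E * (expR (- (oneDsqr p.2 * p.1)))%:E))%E.
have T0 p : (0 <= T p)%E by rewrite /T !mule_ge0// lee_fin expR_ge0.
have mI := measurable_indic_Rpos.
have mT : measurable_fun setT T.
  apply: emeasurable_funM.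
    by apply/measurable_EFinP; exact: (measurableT_comp mI measurable_fst).
  apply: emeasurable_funM; apply/measurable_EFinP.
    exact: (measurableT_comp mI measurable_snd).
  apply: measurable_expRN; apply: measurable_funM => //.
  by apply: measurable_funD => //; exact: measurable_funX.
have TE t : (\int[leb]_v T (t, v) =
    (\1_(Rpos R) t)%:E * \int[leb]_(v in Rpos R) (expR (- (oneDsqr v * t)))%:E)%E.
  have mS : measurable_fun setT (fun v : R =>
      (\1_(Rpos R) v)%:E * (expR (- (oneDsqr v * t)))%:E : \bar R)%E.
    apply: emeasurable_funM; apply/measurable_EFinP => //.
    apply: measurable_expRN; apply: measurable_funM => //.
    by apply: measurable_funD => //; exact: measurable_funX.
  by rewrite [in RHS]integral_mul_indic// -ge0_integralZl// => v _; rewrite mule_ge0// lee_fin expR_ge0.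
have le1 : ((expR (- 1))%:E * half_gamma <= \int[leb]_t \int[leb]_v T (t, v))%E.
  rewrite /half_gamma integral_mul_indic// -ge0_integralZl//; last first.
    by apply: emeasurable_funM; apply/measurable_EFinP => //; exact: mexp.
  apply: ge0_le_integral => //.
  - apply: emeasurable_funM => //.
    by apply: emeasurable_funM; apply/measurable_EFinP => //; exact: mexp.
  - exact: (measurable_integral_leb mT T0).
  - move=> t _; rewrite TE muleCA indic_Rpos; case: ltP => [t0|_]; last by rewrite !mul0e.
    rewrite !mul1e -EFinM mulrC.
    have -> : expR (- t) / Num.sqrt t * expR (- 1) =
        ((Num.sqrt t)^-1 - 0) * (expR (- (t + 1))).
      by rewrite opprD expRD subr0; ring.
    apply: le_integral_Rpos => //.
    + by rewrite invr_gt0 sqrtr_gt0.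
    + have m1 : measurable_fun setT (fun v : R => - (oneDsqr v * t)).
        apply: measurable_funN; apply: measurable_funM => //.
        by apply: measurable_funD => //; exact: measurable_funX.
      exact: measurable_funTS (measurableT_comp (@measurable_expR R) m1).
    + move=> v /andP[v0 vt]; rewrite ler_expR lerN2 /oneDsqr mulrDl mul1r lerD2l.
      have s0 : 0 < Num.sqrt t by rewrite sqrtr_gt0.
      rewrite -(sqr_sqrtr (ltW t0)) -exprMn expr_le1 ?mulr_ge0 ?(ltW v0) ?(ltW s0)//.
      by rewrite -ler_pdivlMr// div1r ltW.
have le2 : (\int[leb]_t \int[leb]_v T (t, v) <= (pi / 2)%:E)%E.
  rewrite (swap_integral_leb mT T0) -integral0y_oneDsqr.
  have mU : measurable (`[0, +oo[%classic : set (measurableTypeR R)) by exact: measurable_itv.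
  rewrite [leRHS]integral_mul_indic//; apply: ge0_le_integral => //.
  - by move=> v _; exact: integral_ge0.
  - exact: (@measurable_fun_fubini_tonelli_G _ _ _ _ _ leb T mT T0).
  - apply: emeasurable_funM; apply/measurable_EFinP; first exact: measurable_indic.
    by apply: measurable_funV; apply: measurable_funD => //; exact: measurable_funX.
  - move=> v _.
    have -> : (\int[leb]_t T (t, v) =
        (\1_(Rpos R) v)%:E * \int[leb]_(t in Rpos R) (expR (- (oneDsqr v * t)))%:E)%E.
      rewrite [in RHS]integral_mul_indic// -ge0_integralZl//.
        by apply: eq_integral => t _; rewrite /T muleCA.
      apply: emeasurable_funM; apply/measurable_EFinP => //.
      by apply: measurable_expRN; apply: measurable_funM.
    rewrite indic_Rpos; case: ltP => [v0|_]; last by rewrite mul0e mule_ge0// lee_fin invr_ge0.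
    rewrite mul1e indicE mem_set ?mul1e; last by rewrite /= in_itv/= ltW.
    by apply: integral_Rpos_expR_le; apply: lt_le_trans (oneDsqr_ge1 v).
have : ((expR (- 1))%:E * half_gamma < +oo)%E.
  by apply: le_lt_trans (ltry (pi / 2)); exact: le_trans le1 le2.
have := half_gamma_gt0; case: half_gamma => [r _ _|_|//]; first by rewrite ltry.
by rewrite gt0_muley ?lte_fin.
Qed.

End halfline.

(** * Radial mixtures *)

Section radial_measures.
Context {R : realType} {d : nat}.
Local Notation leb := (@lebesgue_measure R).
Implicit Types (rho nu : {measure set (Rd R d) -> \bar R}) (w : Rd R d -> R) (theta : R -> R).

Definition ray (p : Rd R d * R) : Rd R d := p.2 *: (p.1 : 'rV[R]_d).

Lemma measurable_ray : measurable_fun setT ray.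
Proof. exact: (@measurable_scale _ _ _ _ snd fst measurable_snd measurable_fst). Qed.

Lemma enorm_direction (x : Rd R d) : x != 0 -> enorm (direction x) = 1.
Proof. exact: direction_sphere. Qed.

Lemma enorm_ray (x : Rd R d) (r : R) : x != 0 -> 0 < r -> enorm (ray (direction x, r)) = r.
Proof. by move=> x0 r0; rewrite enormZ enorm_direction// mulr1 gtr0_norm. Qed.

Lemma direction_ray (x : Rd R d) (r : R) : x != 0 -> 0 < r ->
  direction (ray (direction x, r)) = direction x.
Proof.
move=> x0 r0; rewrite {1}/direction enorm_ray// /ray scalerA mulVf ?scale1r//.
by rewrite gt_eqF.
Qed.

Lemma measurable_indic_ray (B : set (Rd R d)) : measurable B ->
  measurable_fun setT (fun p : Rd R d * R => \1_B (ray p) : R).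
Proof. by move=> mB; apply: (measurableT_comp _ measurable_ray); exact: measurable_indic. Qed.

Definition is_radial w theta rho nu := forall B, measurable B ->
  nu B = radial_mix w theta rho (fun p => \1_B (ray p)).

Lemma ae_off0 rho (P : Rd R d -> Prop) : rho [set 0] = 0%E ->
  (forall x, x != 0 -> P x) -> {ae rho, forall x, P x}.
Proof.
move=> rho0 hP; exists [set 0]; split => //; first exact: measurable_set_zero.
by move=> x; apply: contra_notP => /eqP; exact: hP.
Qed.

Lemma integral_off0 rho (f g : Rd R d -> \bar R) : rho [set 0] = 0%E ->
    measurable_fun setT f -> measurable_fun setT g -> (forall x, x != 0 -> f x = g x) ->
  (\int[rho]_x f x = \int[rho]_x g x)%E.
Proof.
move=> rho0 mf mg fg; apply: ae_eq_integral => //.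
by apply: ae_off0 => // x x0 _; exact: fg.
Qed.

Lemma weighted_measure rho w : (forall x, 0 <= w x) -> measurable_fun setT w ->
  exists rho' : {measure set (Rd R d) -> \bar R}, (rho [set 0] = 0%E -> rho' [set 0] = 0%E) /\
    forall f : Rd R d -> \bar R, (forall x, 0 <= f x)%E -> measurable_fun setT f ->
    (\int[rho']_x f x = \int[rho]_x ((w x)%:E * f x))%E.
Proof.
move=> w0 mw.
have [rho' rhoE] := weighted_pushforward rho w0 mw (@measurable_id _ _ setT).
exists rho'; split => // rho0; have m0 := @measurable_set_zero R d.
have mI : measurable_fun setT (fun x : Rd R d => (\1_[set 0] x)%:E : \bar R).
  by apply/measurable_EFinP; exact: measurable_indic.
rewrite -integral_indicT// rhoE//.
transitivity (\int[rho]_x (cst 0 x))%E; last by rewrite integral0.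
apply: integral_off0 => //; first by apply: emeasurable_funM => //; exact/measurable_EFinP.
by move=> x /eqP x0; rewrite indicE memNset ?mule0.
Qed.

Lemma measurable_radial_inner w theta (f : Rd R d * R -> \bar R) :
    (forall x, 0 <= w x) -> measurable_fun setT w -> measurable_fun setT theta ->
    (forall p, 0 <= f p)%E -> measurable_fun setT f ->
  measurable_fun setT (fun x => \int[leb]_(r in Rpos R)
    ((w x * expR (- (theta r / enorm x)))%:E * f (direction x, r)))%E.
Proof.
move=> w0 mw mt f0 mf.
pose H (p : Rd R d * R) : \bar R := ((\1_(Rpos R) p.2)%:E *
  ((w p.1 * 1 * expR (- (theta p.2 / enorm p.1)))%:E * f (direction p.1, p.2)))%E.
have H0 p : (0 <= H p)%E by rewrite /H !mule_ge0// lee_fin !mulr_ge0// expR_ge0.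
have mH : measurable_fun setT H.
  apply: emeasurable_funM.
    by apply/measurable_EFinP; exact: (measurableT_comp (@measurable_indic_Rpos R) measurable_snd).
  apply: emeasurable_funM.
    apply/measurable_EFinP.
    exact: (measurable_radial_kernel mw mt (measurable_cst (1:R))).
  apply: (measurableT_comp mf); apply/measurable_fun_pair => //.
  exact: (measurableT_comp (@measurable_direction R d) measurable_fst).
have := measurable_integral_leb mH H0.
apply: eq_measurable_fun => x _; rewrite /fubini_F [RHS]integral_RposE.
by apply: eq_integral => r _; rewrite /H/= mulr1.
Qed.

Lemma measurable_radial_mix w theta (F : Rd R d * R -> R) :
    (forall x, 0 <= w x) -> measurable_fun setT w -> measurable_fun setT theta ->
    (forall p, 0 <= F p) -> measurable_fun setT F ->
  measurable_fun setT (fun x => \int[leb]_(r in Rpos R)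
    (w x * F (direction x, r) * expR (- (theta r / enorm x)))%:E)%E.
Proof.
move=> w0 mw mt F0 mF.
apply: (measurable_radial_integral (H := fun p => w p.1 *
    F (direction p.1, p.2) * expR (- (theta p.2 / enorm p.1)))).
  move=> x r r0; apply: mulr_ge0; last exact: expR_ge0.
  by apply: mulr_ge0; [exact: w0 | exact: F0].
exact: measurable_funTS (measurable_radial_kernel mw mt mF).
Qed.

Lemma measurable_radial_integrand (c a : R) theta (f : Rd R d * R -> \bar R) (x : Rd R d) :
    measurable_fun setT theta -> measurable_fun setT f ->
  measurable_fun setT (fun r : R => (c * expR (- (theta r / a)))%:E * f (x, r))%E.
Proof.
move=> mt mf; apply: emeasurable_funM; last exact: measurable_section.
apply/measurable_EFinP; apply: measurable_funM => //.
by apply: measurable_expRN; exact: measurable_funM.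
Qed.

Lemma radial_measure rho w theta :
    (forall x, 0 <= w x) -> measurable_fun setT w -> measurable_fun setT theta ->
  exists m : {measure set (Rd R d) -> \bar R},
    forall f : Rd R d -> \bar R, (forall x, 0 <= f x)%E -> measurable_fun setT f ->
    (\int[m]_y f y = \int[rho]_x \int[leb]_(r in Rpos R)
      ((w x * expR (- (theta r / enorm x)))%:E * f (ray (direction x, r))))%E.
Proof.
move=> w0 mw mt.
pose k (p : Rd R d * R) := \1_(Rpos R) p.2 * (w p.1 * 1 * expR (- (theta p.2 / enorm p.1))).
have k0 p : 0 <= k p by rewrite /k !mulr_ge0// expR_ge0.
have mk : measurable_fun setT k.
  apply: measurable_funM; first exact: (measurableT_comp (@measurable_indic_Rpos R) measurable_snd).
  exact: (measurable_radial_kernel mw mt (measurable_cst (1:R))).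
have mphi : measurable_fun setT (fun p : Rd R d * R => ray (direction p.1, p.2)).
  apply: (measurableT_comp measurable_ray); apply/measurable_fun_pair => //.
  exact: (measurableT_comp (@measurable_direction R d) measurable_fst).
have [m mE] := mixture_measure rho leb k0 mk mphi.
exists m => f f0 mf; rewrite (mE f f0 mf); apply: eq_integral => x _.
rewrite [RHS]integral_RposE.
by apply: eq_integral => r _; rewrite /k/= mulr1 EFinM muleA.
Qed.

Lemma integral_radial nu rho w theta (f : Rd R d -> \bar R) :
    (forall x, 0 <= w x) -> measurable_fun setT w -> measurable_fun setT theta ->
    is_radial w theta rho nu ->
    (forall x, 0 <= f x)%E -> measurable_fun setT f ->
  (\int[nu]_y f y = \int[rho]_x \int[leb]_(r in Rpos R)
      ((w x * expR (- (theta r / enorm x)))%:E * f (ray (direction x, r))))%E.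
Proof.
move=> w0 mw mt nuE f0 mf; have [m mE] := radial_measure rho w0 mw mt.
rewrite -(mE f f0 mf); apply: eq_measure_integral => B mB _; rewrite nuE//.
have mI : measurable_fun setT (fun x : Rd R d => (\1_B x)%:E : \bar R).
  by apply/measurable_EFinP; exact: measurable_indic.
have I0 (x : Rd R d) : (0 <= (\1_B x)%:E :> \bar R)%E by rewrite lee_fin.
rewrite -[RHS]integral_indicT// (mE _ I0 mI).
apply: eq_integral => x _; apply: eq_integral => r _; rewrite -EFinM; congr EFin.
by ring.
Qed.

Lemma integral_radialR nu rho w theta (f : Rd R d -> R) :
    (forall x, 0 <= w x) -> measurable_fun setT w -> measurable_fun setT theta ->
    is_radial w theta rho nu ->
    (forall x, 0 <= f x) -> measurable_fun setT f ->
  (\int[nu]_y (f y)%:E)%E = radial_mix w theta rho (fun p => f (ray p)).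
Proof.
move=> w0 mw mt nuE f0 mf; 
have mf' : measurable_fun setT (fun x => (f x)%:E : \bar R) by exact/measurable_EFinP.
have f0' x : (0 <= (f x)%:E :> \bar R)%E by rewrite lee_fin.
rewrite (integral_radial w0 mw mt nuE f0' mf').
apply: eq_integral => x _; apply: eq_integral => r _; rewrite -EFinM; congr EFin.
by ring.
Qed.

(** Moves a weight between the kernel and the mixing measure, to pass between the weight [1] of
    Bernstein's theorem and the weights of the transforms. Agreement off the origin suffices, as
    [rho] does not charge it. *)
Lemma radial_mix_reweight rho rho' w w1 w2 theta (F : Rd R d * R -> R) :
    (forall x, 0 <= w x) -> measurable_fun setT w ->
    (forall x, 0 <= w1 x) -> measurable_fun setT w1 ->
    (forall x, 0 <= w2 x) -> measurable_fun setT w2 -> measurable_fun setT theta ->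
    (forall p, 0 <= F p) -> measurable_fun setT F -> rho [set 0] = 0%E ->
    (forall f : Rd R d -> \bar R, (forall x, 0 <= f x)%E -> measurable_fun setT f ->
      (\int[rho']_x f x = \int[rho]_x ((w x)%:E * f x))%E) ->
    (forall x, x != 0 -> w x * w1 x = w2 x) ->
  radial_mix w1 theta rho' F = radial_mix w2 theta rho F.
Proof.
move=> w0 mw w10 mw1 w20 mw2 mt F0 mF rho0 rhoE ww.
have radialE (u : Rd R d -> R) x : (\int[leb]_(r in Rpos R)
      (u x * F (direction x, r) * expR (- (theta r / enorm x)))%:E =
    \int[leb]_(r in Rpos R)
      ((u x * expR (- (theta r / enorm x)))%:E * (F (direction x, r))%:E))%E.
  by apply: eq_integral => r _; rewrite -EFinM; congr EFin; ring.
have mF' : measurable_fun setT (fun p => (F p)%:E : \bar R) by exact/measurable_EFinP.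
have F0' p : (0 <= (F p)%:E :> \bar R)%E by rewrite lee_fin.
have inner0 (u : Rd R d -> R) x : (forall x, 0 <= u x) -> (0 <= \int[leb]_(r in Rpos R)
      ((u x * expR (- (theta r / enorm x)))%:E * (F (direction x, r))%:E))%E.
  by move=> u0; apply: integral_ge0 => r _; rewrite mule_ge0// lee_fin mulr_ge0// expR_ge0.
rewrite /radial_mix (eq_integral _ _ (fun x _ => radialE w1 x)).
rewrite (eq_integral _ _ (fun x _ => radialE w2 x)).
have m1 := measurable_radial_inner w10 mw1 mt F0' mF'.
have m2 := measurable_radial_inner w20 mw2 mt F0' mF'.
rewrite (rhoE _ (fun x => inner0 _ x w10) m1).
apply: integral_off0 => //; first by apply: emeasurable_funM => //; exact/measurable_EFinP.
move=> x x0; rewrite -ge0_integralZl; first last.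
- by rewrite lee_fin.
- by move=> r _; rewrite mule_ge0// lee_fin mulr_ge0// expR_ge0.
- apply: measurable_funTS.
  exact: (measurable_radial_integrand (w1 x) (enorm x) (direction x) mt mF').
- exact: measurable_Rpos.
by apply: eq_integral => r _; rewrite muleA -EFinM mulrA ww.
Qed.

End radial_measures.

(** * The transforms A1 and Upsilon0 *)

Section transforms.
Context {R : realType} {d : nat}.
Local Notation leb := (@lebesgue_measure R).
Implicit Types (rho ups : {measure set (Rd R d) -> \bar R}).

Definition arcsine_const : R := 2 / pi * fine (@half_gamma R).

Lemma half_gammaK : ((fine (@half_gamma R))%:E = half_gamma)%E.
Proof. by rewrite fineK// ge0_fin_numE ?half_gamma_lty// ltW ?half_gamma_gt0. Qed.

Lemma arcsine_const_gt0 : 0 < arcsine_const.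
Proof.
by rewrite mulr_gt0 ?divr_gt0 ?pi_gt0// fine_gt0// half_gamma_gt0 half_gamma_lty.
Qed.

Lemma a1_ge0 (r s : R) : 0 <= a1 r s.
Proof. by rewrite /a1; case: ifP => // _; rewrite mulr_ge0 ?divr_ge0 ?pi_ge0 ?invr_ge0 ?sqrtr_ge0. Qed.

Lemma measurable_a1 d' (X : measurableType d') (f g : X -> R) :
  measurable_fun setT f -> measurable_fun setT g ->
  measurable_fun setT (fun x => a1 (f x) (g x)).
Proof.
move=> mf mg.
have ms : measurable_fun setT (fun x => Num.sqrt (g x)).
  exact: (measurableT_comp (@measurable_sqrt R) mg).
apply: measurable_fun_ifT => //.
  by apply: measurable_and; apply: measurable_fun_ltr.
apply: measurable_funM => //; apply: measurable_funV.
have mD : measurable_fun setT (fun x => g x - f x ^+ 2).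
  by apply: measurable_funB => //; exact: measurable_funX.
exact: (measurableT_comp (@measurable_sqrt R) mD).
Qed.

(** Substituting [s = a t + r^2] turns [a1 r s] into a multiple of [(a t)^(-1/2)] and splits the
    exponential into [e^-t] and [e^(-r^2/a)]. *)
Lemma integral_a1_expR (a r : R) : 0 < a -> 0 < r ->
  (\int[leb]_(s in Rpos R) (a^-1 * expR (- (s / a)) * a1 r s)%:E =
   (arcsine_const / Num.sqrt a * expR (- (r ^+ 2 / a)))%:E)%E.
Proof.
move=> a0 r0.
have mexp (b c : R) : measurable_fun setT (fun t : R => expR (- (b * t * c))).
  by apply: measurable_expRN; apply: measurable_funM => //; exact: measurable_funM.
pose f (s : R) : \bar R := ((\1_(Rpos R) s)%:E * (a^-1 * expR (- (s / a)) * a1 r s)%:E)%E.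
rewrite integral_RposE.
rewrite (lebesgue_integral_affine (r ^+ 2) (f := f) a0); last 2 first.
- by move=> s; rewrite /f mule_ge0// lee_fin !mulr_ge0 ?invr_ge0 ?expR_ge0 ?a1_ge0// ltW.
- apply: emeasurable_funM; apply/measurable_EFinP; first exact: measurable_indic_Rpos.
  apply: measurable_funM; last exact: measurable_a1.
  apply: measurable_funM => //; have := mexp 1 a^-1.
  by apply: eq_measurable_fun => s _; rewrite mul1r.
have -> : (\int[leb]_t f (a * t + r ^+ 2)%R =
    (a^-1 * expR (- (r ^+ 2 / a)) * (2 / pi / Num.sqrt a))%:E * half_gamma)%E.
  rewrite /half_gamma [in RHS]integral_RposE.
  rewrite -ge0_integralZl; first last.
  - by rewrite lee_fin !mulr_ge0 ?invr_ge0 ?expR_ge0 ?pi_ge0 ?sqrtr_ge0// ltW.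
  - by move=> t _; rewrite mule_ge0// lee_fin divr_ge0 ?expR_ge0 ?sqrtr_ge0.
  - apply: emeasurable_funM; apply/measurable_EFinP; first exact: measurable_indic_Rpos.
    apply: measurable_funM; last by apply: measurable_funV; exact: measurable_sqrt.
    by have := mexp 1 1; apply: eq_measurable_fun => s _; rewrite mul1r mulr1.
  - exact: measurableT.
  apply: eq_integral => t _; rewrite /f !indic_Rpos -!EFinM; congr EFin.
  (* For [t <= 0] one has [s <= r^2], where [a1] vanishes. *)
  have [t0|t0] := ltP 0 t; last first.
    rewrite mul0r mulr0 /a1 ifF ?mulr0//; apply/negbTE; rewrite r0/= -leNgt.
    have rE : Num.sqrt (r ^+ 2) = r by rewrite sqrtr_sqr gtr0_norm.
    by rewrite -[leRHS]rE ler_wsqrtr// gerDr mulr_ge0_le0// ltW.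
  have s0 : 0 < a * t + r ^+ 2 by rewrite addr_gt0 ?mulr_gt0 ?exprn_gt0.
  rewrite s0 !mul1r /a1 r0/= ifT; last first.
    rewrite -{1}(ger0_norm (ltW r0)) -sqrtr_sqr ltr_sqrt//.
    by rewrite ltrDr mulr_gt0.
  rewrite addrK sqrtrM ?(ltW a0)// invfM mulrDl opprD expRD.
  rewrite [a * t]mulrC mulfK ?gt_eqF//.
  by ring.
by rewrite -half_gammaK -!EFinM /arcsine_const; congr EFin; rewrite !mulrA divff ?gt_eqF// mul1r; ring.
Qed.

Definition exp_weight (x : Rd R d) : R := (enorm x)^-1.
Definition gauss_weight (x : Rd R d) : R := arcsine_const / Num.sqrt (enorm x).
Definition square (r : R) : R := r ^+ 2.

Lemma exp_weight_ge0 x : 0 <= exp_weight x.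
Proof. by rewrite invr_ge0 enorm_ge0. Qed.

Lemma measurable_exp_weight : measurable_fun setT exp_weight.
Proof. by apply: measurable_funV; exact: measurable_enorm. Qed.

Lemma gauss_weight_ge0 x : 0 <= gauss_weight x.
Proof. by rewrite divr_ge0 ?sqrtr_ge0// ltW// arcsine_const_gt0. Qed.

Lemma measurable_gauss_weight : measurable_fun setT gauss_weight.
Proof.
apply: measurable_funM => //; apply: measurable_funV.
exact: (measurableT_comp (@measurable_sqrt R) (@measurable_enorm R d)).
Qed.

Lemma measurable_square : measurable_fun setT square.
Proof. exact: measurable_funX. Qed.

(** [a1] spreads mass along the ray it lies on, so for each [x] the claim is an interchange of two
    radial integrals, the inner one being [integral_a1_expR]. *)
Lemma A1_radial rho ups B : rho [set 0] = 0%E -> measurable B ->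
    is_radial exp_weight id rho ups ->
  A1 ups B = radial_mix gauss_weight square rho (fun p => \1_B (ray p)).
Proof.
move=> rho0 mB upsE.
have mB1 : measurable_fun setT (\1_B : Rd R d -> R) by exact: measurable_indic.
have mdir : measurable_fun setT (fun p : Rd R d * R => ray (direction p.1, p.2)).
  apply: (measurableT_comp (@measurable_ray R d)); apply/measurable_fun_pair => //.
  exact: (measurableT_comp (@measurable_direction R d) measurable_fst).
pose H (p : Rd R d * R) := a1 p.2 (enorm p.1) * \1_B (ray (direction p.1, p.2)).
have H0 p : 0 <= H p by rewrite mulr_ge0// a1_ge0.
have mH : measurable_fun setT H.
  apply: measurable_funM; last exact: (measurableT_comp mB1 mdir).
  apply: measurable_a1 => //.
  exact: (measurableT_comp (@measurable_enorm R d) measurable_fst).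
pose g (y : Rd R d) := (\int[leb]_(r in Rpos R) (H (y, r))%:E)%E.
have g0 y : (0 <= g y)%E by apply: integral_ge0 => r _; rewrite lee_fin.
have mg : measurable_fun setT g.
  by apply: measurable_radial_integral => //; exact: measurable_funTS.
pose N : set (Rd R d) := [set~ ((0%R : 'rV[R]_d) : Rd R d)].
have m0 : measurable N by apply: measurableC; exact: measurable_set_zero.
pose f (y : Rd R d) := ((\1_N y)%:E * g y)%E.
have f0 y : (0 <= f y)%E by rewrite /f mule_ge0// lee_fin.
have mf : measurable_fun setT f.
  by apply: emeasurable_funM => //; apply/measurable_EFinP; exact: measurable_indic.
have -> : A1 ups B = (\int[ups]_y f y)%E.
  transitivity (\int[ups]_(y in N) g y)%E.
    apply: eq_integral => y _.
    by apply: eq_integral => r _; rewrite /H/ray/direction/= scalerA.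
  exact: (integral_mul_indic _ _ m0).
have mid : measurable_fun setT (@id R) by exact: measurable_id.
rewrite (integral_radial exp_weight_ge0 measurable_exp_weight mid upsE f0 mf).
have mfr : measurable_fun setT (fun p : Rd R d * R => f (ray p)).
  exact: (measurableT_comp mf (@measurable_ray R d)).
have f0r (p : Rd R d * R) : (0 <= f (ray p))%E by exact: f0.
have mBr := measurable_indic_ray mB.
apply: (integral_off0 rho0).
- exact: (measurable_radial_inner exp_weight_ge0 measurable_exp_weight mid f0r mfr).
- exact: (measurable_radial_mix gauss_weight_ge0 measurable_gauss_weight measurable_square
    (fun p => ler0n _ _) mBr).
move=> x x0; have e0 : 0 < enorm x by rewrite enorm_gt0.
have mR := measurable_Rpos (R := R).
pose E (s r : R) := exp_weight x * expR (- (s / enorm x)) * a1 r s.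
have E0 s r : 0 <= E s r by rewrite !mulr_ge0 ?expR_ge0 ?exp_weight_ge0 ?a1_ge0.
have mE : measurable_fun setT (fun p : R * R => E p.1 p.2).
  apply: measurable_funM; last exact: measurable_a1.
  apply: measurable_funM => //.
  by apply: measurable_expRN; exact: measurable_funM.
have mBx : measurable_fun setT (fun r : R => \1_B (ray (direction x, r)) : R).
  exact: (measurable_section (direction x) mBr).
pose T (p : R * R) : \bar R := ((\1_(Rpos R) p.1)%:E * ((\1_(Rpos R) p.2)%:E *
  (E p.1 p.2 * \1_B (ray (direction x, p.2)))%:E))%E.
have T0 p : (0 <= T p)%E by rewrite /T !mule_ge0// lee_fin mulr_ge0.
have mT : measurable_fun setT T.
  apply: emeasurable_funM.
    by apply/measurable_EFinP; exact: (measurableT_comp (@measurable_indic_Rpos R) measurable_fst).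
  apply: emeasurable_funM; apply/measurable_EFinP.
    exact: (measurableT_comp (@measurable_indic_Rpos R) measurable_snd).
  apply: measurable_funM => //; exact: (measurableT_comp mBx measurable_snd).
transitivity (\int[leb]_s \int[leb]_r T (s, r))%E.
  rewrite [LHS]integral_RposE; apply: eq_integral => s _.
  rewrite /T/= indic_Rpos; case: ltP => [s0|_]; last first.
    by rewrite mul0e; apply/esym/integral0_eq => r _; rewrite mul0e.
  rewrite mul1e /f indicE mem_set; last first.
    by apply/eqP; rewrite -enorm_gt0 enorm_ray.
  rewrite mul1e /g /H integral_RposE -ge0_integralZl; first last.
  - by rewrite lee_fin mulr_ge0 ?expR_ge0 ?exp_weight_ge0.
  - by move=> r _; rewrite mule_ge0// lee_fin mulr_ge0// a1_ge0.
  - apply: emeasurable_funM; apply/measurable_EFinP; first exact: measurable_indic_Rpos.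
    exact: (measurable_section _ mH).
  - exact: measurableT.
  apply: eq_integral => r _; rewrite /= enorm_ray// direction_ray// mul1e -!EFinM /E.
  by congr EFin; ring.
rewrite (swap_integral_leb mT T0).
rewrite [RHS]integral_RposE.
apply: eq_integral => r _; rewrite /T/= indic_Rpos; case: ltP => [r0|_]; last first.
  by rewrite mul0e; apply/integral0_eq => s _; rewrite mul0e mule0.
rewrite mul1e.
have -> : (gauss_weight x * \1_B (ray (direction x, r)) * expR (- (square r / enorm x)))%:E =
   ((\1_B (ray (direction x, r)))%:E * \int[leb]_(s in Rpos R) (E s r)%:E)%E.
  by rewrite integral_a1_expR// -EFinM /gauss_weight /square; congr EFin; ring.
rewrite integral_RposE -ge0_integralZl; first last.
- by rewrite lee_fin.
- by move=> s _; rewrite mule_ge0// lee_fin.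
- apply: emeasurable_funM; apply/measurable_EFinP; first exact: measurable_indic_Rpos.
  have mp : measurable_fun setT (fun s : R => (s, r)) by apply/measurable_fun_pair.
  exact: (measurableT_comp mE mp).
- exact: measurableT.
by apply: eq_integral => s _; rewrite mul1e -!EFinM; congr EFin; ring.
Qed.

(** Here an integral over [rho] has to be interchanged with one over [u]. Weighting [rho] by
    [min(1, |x|)], positive off the origin, gives a finite measure, and the inverse weight goes into
    the integrand. The rest is the scaling [r = |x| u]. *)
Lemma Ups0_radial rho B : levy_measure1 rho -> measurable B ->
  Ups0 rho B = radial_mix exp_weight id rho (fun p => \1_B (ray p)).
Proof.
move=> [[rho0 _] rho1] mB.
have mR := measurable_Rpos (R := R).
have mB1 : measurable_fun setT (\1_B : Rd R d -> R) by exact: measurable_indic.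
have mBr := measurable_indic_ray mB.
pose w (x : Rd R d) : R := Num.min 1 (enorm x).
have w0 x : 0 <= w x by rewrite /w le_min ler01 enorm_ge0.
have w_gt0 x : x != 0 -> 0 < w x by move=> x0; rewrite /w lt_min ltr01 enorm_gt0.
have mw : measurable_fun setT w.
  by apply: measurable_minr => //; exact: measurable_enorm.
have [m [m0 mE]] := weighted_measure rho w0 mw.
have mtot : (m setT < +oo)%E.
  rewrite -(integral_indicT m measurableT) mE//; last first.
    by apply/measurable_EFinP; exact: measurable_indic.
  by apply: le_lt_trans rho1; apply: eq_lee;
    apply: eq_integral => x _; rewrite indicT mule1.
pose fm : {finite_measure set (Rd R d) -> \bar R} := mfrestr measurableT mtot.
have fmE (f : Rd R d -> \bar R) : (forall x, 0 <= f x)%E -> measurable_fun setT f ->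
    (\int[fm]_x f x = \int[rho]_x ((w x)%:E * f x))%E.
  move=> f0 mf; rewrite -mE//; apply: eq_measure_integral => A mA _.
  by rewrite /fm/= /mfrestr/= /mrestr setIT.
pose T (p : Rd R d * R) : \bar R := ((\1_(Rpos R) p.2)%:E *
  ((w p.1)^-1 * \1_B (ray p) * expR (- p.2))%:E)%E.
have T0 p : (0 <= T p)%E by rewrite /T mule_ge0// lee_fin !mulr_ge0 ?invr_ge0 ?expR_ge0.
have mT : measurable_fun setT T.
  apply: emeasurable_funM; apply/measurable_EFinP.
    exact: (measurableT_comp (@measurable_indic_Rpos R) measurable_snd).
  apply: measurable_funM.
    apply: measurable_funM => //; apply: measurable_funV.
    exact: (measurableT_comp mw measurable_fst).
  by apply: measurable_expRN.
have mTu u : measurable_fun setT (fun x => T (x, u)).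
  have mp : measurable_fun setT (fun x : Rd R d => (x, u)) by apply/measurable_fun_pair.
  exact: (measurableT_comp mT mp).
transitivity (\int[leb]_u \int[fm]_x T (x, u))%E.
  rewrite /Ups0 [LHS]integral_RposE; apply: eq_integral => u _.
  rewrite (fmE _ (fun x => T0 (x, u)) (mTu u)).
  pose A : set (Rd R d) := [set x : Rd R d | B (u *: (x : 'rV[R]_d) : Rd R d)].
  have mu : measurable_fun setT (fun x : Rd R d => ray (x, u)).
    by apply: (measurableT_comp (@measurable_ray R d)); apply/measurable_fun_pair.
  have mA : measurable A by rewrite -[X in measurable X]setTI; exact: (mu measurableT B mB).
  have mA1 : measurable_fun setT (\1_A : Rd R d -> R) by exact: measurable_indic.
  rewrite -/A -(integral_indicT rho mA) muleC -muleA muleC -ge0_integralZl; first last.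
  - by rewrite -EFinM lee_fin mulr_ge0// expR_ge0.
  - by move=> x _; rewrite lee_fin.
  - exact/measurable_EFinP.
  - exact: measurableT.
  apply: (integral_off0 rho0).
  - by apply: emeasurable_funM; [exact: measurable_cst | exact/measurable_EFinP].
  - by apply: emeasurable_funM => //; exact/measurable_EFinP.
  move=> x x0; rewrite /T/= -!EFinM; congr EFin.
  have -> : \1_B (ray (x, u)) = \1_A x :> R by rewrite !indicE.
  transitivity (w x / w x * (\1_(Rpos R) u * \1_A x * expR (- u))); last by ring.
  by rewrite divff ?gt_eqF ?w_gt0//; ring.
rewrite -(@fubini_tonelli _ _ _ _ _ fm leb T mT T0).
rewrite (fmE (fun x => \int[leb]_y T (x, y))%E); last 2 first.
- by move=> x; exact: integral_ge0.
- exact: (measurable_integral_leb mT T0).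
have mid : measurable_fun setT (@id R) by exact: measurable_id.
have mk := measurable_radial_kernel measurable_exp_weight mid mBr.
apply: (integral_off0 rho0).
- apply: emeasurable_funM; first exact/measurable_EFinP.
  exact: (measurable_integral_leb mT T0).
- exact: (measurable_radial_mix exp_weight_ge0 measurable_exp_weight mid
    (fun p => ler0n _ _) mBr).
move=> x x0; have e0 : 0 < enorm x by rewrite enorm_gt0.
have f0 r : (0 <= (exp_weight x * \1_B (ray (direction x, r)) *
    expR (- (r / enorm x)))%:E)%E.
  by rewrite lee_fin mulr_ge0 ?expR_ge0// mulr_ge0// exp_weight_ge0.
have mf := measurable_section (x : Rd R d) mk.
have mf' : measurable_fun setT (fun r => (exp_weight x * \1_B (ray (direction x, r)) *
    expR (- (r / enorm x)))%:E : \bar R) by exact/measurable_EFinP.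
rewrite (integral_Rpos_scale e0 f0 mf').
rewrite -ge0_integralZl; first last.
- by rewrite lee_fin.
- by move=> u _; exact: T0.
- exact: (measurable_section (x : Rd R d) mT).
- exact: measurableT.
rewrite -ge0_integralZl; first last.
- by rewrite lee_fin ltW.
- by move=> u _; exact: f0.
- apply: measurable_funTS.
  have mM : measurable_fun setT (fun u : R => enorm x * u) by exact: measurable_funM.
  exact: (measurableT_comp mf' mM).
- exact: mR.
rewrite [RHS]integral_RposE.
apply: eq_integral => u _; rewrite /T/= muleCA; congr (_ * _)%E.
rewrite -!EFinM; congr EFin.
have -> : ray (direction x, enorm x * u) = ray (x, u).
  by rewrite /ray/direction/= scalerA mulrAC mulfV ?gt_eqF// mul1r.
rewrite /exp_weight [enorm x * u]mulrC mulfK ?gt_eqF// !mulrA.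
by rewrite !divff ?gt_eqF ?w_gt0.
Qed.

End transforms.

(** * Comparison of radial integrals with [min(1, s)] *)

Section bounds.
Context {R : realType}.
Local Notation leb := (@lebesgue_measure R).

Lemma expr_expR_bounded n (u : R) : 0 < u -> exists2 C : R, 0 <= C &
  forall x : R, 0 <= x -> x ^+ n * expR (- (u * x)) <= C.
Proof.
move=> u0; have [C [v [C0 v0 Cv]]] := expr_expR n u0.
exists C => // x x0; apply: le_trans (Cv x x0) _.
by rewrite ler_piMr// -expR0 ler_expR oppr_le0 mulr_ge0// ltW.
Qed.

(** With [y = 1/s]: for [s >= 1] the left side is [(1 + y) e^(-u y)], and for [s < 1], after
    division by [s], it is [(y + y^2) e^(-u y)]; both are bounded. *)
Lemma weight_expR_bound (u : R) : 0 < u -> exists2 K : R, 0 <= K &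
  forall s : R, 0 < s -> (1 + s^-1) * expR (- (u / s)) <= K * Num.min 1 s.
Proof.
move=> u0.
have [C0 C00 H0] := expr_expR_bounded 0 u0.
have [C1 C10 H1] := expr_expR_bounded 1 u0.
have [C2 C20 H2] := expr_expR_bounded 2 u0.
exists (C0 + C1 + C2) => [|s s0]; first by rewrite !addr_ge0.
have y0 : 0 <= s^-1 by rewrite invr_ge0 ltW.
have h0 := H0 _ y0; have h1 := H1 _ y0; have h2 := H2 _ y0.
have e0 := expR_ge0 (- (u * s^-1)).
rewrite minEle; case: ifPn => _.
  rewrite mulr1 mulrDl mul1r; move: h0 h1; rewrite expr0 expr1 mul1r; lra.
rewrite -ler_pdivrMr//; move: h1 h2; rewrite expr1 expr2; nra.
Qed.

Let mexp (a b : R) : measurable_fun setT (fun t : R => expR (- (a * t ^+ 2 + b * t))).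
Proof.
by apply: measurable_expRN; apply: measurable_funD; apply: measurable_funM => //; exact: measurable_funX.
Qed.

Let mmin1 : measurable_fun setT (fun r : R => Num.min 1 r).
Proof. exact: measurable_minr. Qed.

Let min_ge0 (s : R) : 0 <= s -> 0 <= Num.min 1 s.
Proof. by move=> s0; rewrite le_min ler01. Qed.

(** Only [s < r < 2 s] is kept: there [r / s < 2] and [min(1, r) >= min(1, s)], on an interval of
    length [s]. *)
Lemma exp_inner_ge (s : R) : 0 < s -> ((expR (- 2) * Num.min 1 s)%:E <=
  \int[leb]_(r in Rpos R) (s^-1 * Num.min 1 r * expR (- (r / s)))%:E)%E.
Proof.
move=> s0.
have -> : expR (- 2) * Num.min 1 s = (2 * s - s) * (s^-1 * Num.min 1 s * expR (- 2)).
  by field; rewrite gt_eqF.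
apply: le_integral_Rpos.
- exact: ltW.
- by lra.
- by rewrite !mulr_ge0 ?expR_ge0 ?min_ge0 ?invr_ge0 ?ltW.
- by move=> r r0; rewrite !mulr_ge0 ?expR_ge0 ?min_ge0 ?invr_ge0 ?ltW.
- apply: measurable_funTS; apply: measurable_funM; first exact: measurable_funM.
  have := mexp 0 s^-1; apply: eq_measurable_fun => t _.
  by rewrite mul0r add0r mulrC.
- move=> r /andP[sr rs]; apply: ler_pM.
  + by rewrite mulr_ge0 ?min_ge0 ?invr_ge0 ?ltW.
  + exact: expR_ge0.
  + apply: ler_wpM2l; first by rewrite invr_ge0 ltW.
    by apply: le_min2 => //; exact: ltW.
  + by rewrite ler_expR lerN2 ler_pdivrMr// ltW.
Qed.

(** Only [sqrt s < r < 2 sqrt s] is kept, where [s < r^2 < 4 s]. *)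
Lemma gauss_inner_ge (c s : R) : 0 <= c -> 0 < s -> ((c * expR (- 4) * Num.min 1 s)%:E <=
  \int[leb]_(r in Rpos R) (c / Num.sqrt s * Num.min 1 (r ^+ 2) * expR (- (r ^+ 2 / s)))%:E)%E.
Proof.
move=> c0 s0; have q0 : 0 < Num.sqrt s by rewrite sqrtr_gt0.
have qs : Num.sqrt s ^+ 2 = s by rewrite sqr_sqrtr// ltW.
have -> : c * expR (- 4) * Num.min 1 s =
    (2 * Num.sqrt s - Num.sqrt s) * (c / Num.sqrt s * Num.min 1 s * expR (- 4)).
  by field; rewrite gt_eqF.
apply: le_integral_Rpos.
- exact: ltW.
- by lra.
- by rewrite !mulr_ge0 ?expR_ge0 ?min_ge0 ?invr_ge0 ?(ltW q0)// ltW.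
- by move=> r r0; rewrite !mulr_ge0 ?expR_ge0 ?min_ge0 ?invr_ge0 ?sqr_ge0 ?(ltW q0)// ltW.
- apply: measurable_funTS; apply: measurable_funM.
    apply: measurable_funM => //; apply: measurable_minr => //; exact: measurable_funX.
  have := mexp s^-1 0; apply: eq_measurable_fun => t _.
  by rewrite mul0r addr0 mulrC.
- move=> r /andP[sr rs]; have r0 : 0 < r by apply: lt_trans sr.
  apply: ler_pM.
  + by rewrite !mulr_ge0 ?min_ge0 ?invr_ge0 ?(ltW q0)// ltW.
  + exact: expR_ge0.
  + apply: ler_wpM2l; first by rewrite mulr_ge0// invr_ge0 ltW.
    by apply: le_min2 => //; rewrite -[leLHS]qs ler_sqr ?nnegrE ?ltW.
  + rewrite ler_expR lerN2 ler_pdivrMr//.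
    have -> : 4 * s = (2 * Num.sqrt s) ^+ 2 by rewrite exprMn qs -natrX.
    by rewrite ler_sqr ?nnegrE ?ltW ?mulr_gt0.
Qed.

(** Half of the exponent absorbs the growth: [min(1, r) <= min(1, s) (1 + r/s)] and
    [(1 + r/s) e^(-r/(2s)) <= 2]. The other half integrates to at most [2 s], which gives the
    constant [4]. *)
Lemma exp_inner_le (s : R) : 0 < s ->
  (\int[leb]_(r in Rpos R) (s^-1 * Num.min 1 r * expR (- (r / s)))%:E <=
   (4 * Num.min 1 s)%:E)%E.
Proof.
move=> s0.
apply: (@le_trans _ _ (\int[leb]_(r in Rpos R)
    ((2 * Num.min 1 s / s)%:E * (expR (- ((2 * s)^-1 * r)))%:E))%E).
  apply: ge0_le_integral.
  - exact: measurable_Rpos.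
  - move=> r; rewrite in_Rpos => r0.
    by rewrite lee_fin !mulr_ge0 ?expR_ge0 ?min_ge0 ?invr_ge0 ?ltW.
  - apply/measurable_EFinP/measurable_funTS; apply: measurable_funM; first exact: measurable_funM.
    have := mexp 0 s^-1; apply: eq_measurable_fun => t _.
    by rewrite mul0r add0r mulrC.
  - apply: measurable_funTS; apply: emeasurable_funM => //; apply/measurable_EFinP.
    have := mexp 0 (2 * s)^-1; apply: eq_measurable_fun => t _.
    by rewrite mul0r add0r.
  - move=> r; rewrite in_Rpos => r0; rewrite -EFinM lee_fin.
    have h : Num.min 1 r <= Num.min 1 s * (1 + r / s).
      rewrite !minEle; case: ifPn => r1; case: ifPn => s1.
      - by rewrite mul1r lerDl divr_ge0 ?ltW.
      - by rewrite mulrDr mulr1 mulrCA divff ?gt_eqF// mulr1 (le_trans r1)// lerDr ltW.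
      - rewrite mul1r -[leLHS]addr0 lerD ?divr_ge0 ?ltW//.
        by rewrite ltNge.
      - by rewrite mulrDr mulr1 mulrCA divff ?gt_eqF// mulr1 lerDr ltW.
    pose q := expR (- ((2 * s)^-1 * r)).
    have q0 : 0 < q by exact: expR_gt0.
    have eq : expR (- (r / s)) = q * q.
      by rewrite /q -expRD; congr expR; field; rewrite gt_eqF.
    have e2 : (1 + r / s) * q <= 2.
      have := expR_ge1Dx ((2 * s)^-1 * r).
      have -> : r / s = 2 * ((2 * s)^-1 * r) by field; rewrite gt_eqF.
      rewrite -ler_pdivlMr// /q expRN invrK; lra.
    have -> : 2 * Num.min 1 s / s * q = s^-1 * Num.min 1 s * 2 * q by ring.
    rewrite eq mulrA; apply: ler_wpM2r; first exact: ltW.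
    rewrite -!mulrA; apply: ler_wpM2l; first by rewrite invr_ge0 ltW.
    apply: (@le_trans _ _ (Num.min 1 s * (1 + r / s) * q)); first by rewrite ler_wpM2r// ltW.
    by rewrite -mulrA; apply: ler_wpM2l => //; apply: min_ge0; exact: ltW.
rewrite ge0_integralZl; first last.
- by rewrite lee_fin !mulr_ge0 ?min_ge0 ?invr_ge0 ?ltW.
- by move=> t _; rewrite lee_fin expR_ge0.
- apply/measurable_funTS/measurable_EFinP.
  have := mexp 0 (2 * s)^-1; apply: eq_measurable_fun => t _.
  by rewrite mul0r add0r.
- exact: measurable_Rpos.
have s2 : 0 < (2 * s)^-1 by rewrite invr_gt0 mulr_gt0.
have k0 : (0 <= (2 * Num.min 1 s / s)%:E)%E.
  by rewrite lee_fin !mulr_ge0 ?min_ge0 ?invr_ge0 ?ltW.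
apply: le_trans (lee_wpmul2l k0 (integral_Rpos_expR_le s2)) _.
rewrite -EFinM lee_fin le_eqVlt; apply/orP; left; apply/eqP.
by field; rewrite gt_eqF.
Qed.

End bounds.

(** * Representations of Levy measures *)

Section representations.
Context {R : realType} {d : nat}.
Local Notation leb := (@lebesgue_measure R).
Implicit Types (rho nu lam : {measure set (Rd R d) -> \bar R}) (w : Rd R d -> R)
  (theta : R -> R).

Lemma measurable_min1_enorm : measurable_fun setT (fun x : Rd R d => Num.min 1 (enorm x)).
Proof. by apply: measurable_minr => //; exact: measurable_enorm. Qed.

Lemma measurable_min1_enorm2 :
  measurable_fun setT (fun x : Rd R d => Num.min 1 (enorm x ^+ 2)).
Proof.
by apply: measurable_minr => //; apply: measurable_funX; exact: measurable_enorm.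
Qed.

Lemma min1_enorm_ge0 (x : Rd R d) : 0 <= Num.min 1 (enorm x).
Proof. by rewrite le_min ler01 enorm_ge0. Qed.

Lemma min1_enorm2_ge0 (x : Rd R d) : 0 <= Num.min 1 (enorm x ^+ 2).
Proof. by rewrite le_min ler01 sqr_ge0. Qed.

Lemma levy_measure1_intro rho : rho [set 0] = 0%E ->
  (\int[rho]_x (Num.min 1 (enorm x))%:E < +oo)%E -> levy_measure1 rho.
Proof.
move=> rho0 rho1; split => //; split => //; apply: le_lt_trans rho1.
apply: ge0_le_integral => //.
- by move=> x _; rewrite lee_fin min1_enorm2_ge0.
- by apply/measurable_EFinP; exact: measurable_min1_enorm2.
- by apply/measurable_EFinP; exact: measurable_min1_enorm.
- move=> x _; rewrite lee_fin !minEle.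
  have := enorm_ge0 x; case: ifPn => e2; case: ifPn => e1 e0 //.
  + move: e2; rewrite leNgt => /negP; apply: contra_notT => _.
    by rewrite expr_lt1// ltNge.
  + by move: e2; rewrite -ltNge => /ltW.
  + by move: e1; rewrite -ltNge => /ltW e1; rewrite expr2 ler_piMr.
Qed.

Lemma measurable_outside : measurable [set x : Rd R d | 1 < enorm x].
Proof.
rewrite -[X in measurable X]setTI.
have := @measurable_enorm R d measurableT _ (measurable_itv `]1, +oo[).
by congr measurable; congr (_ `&` _); apply/seteqP; split => x /=; rewrite in_itv/= andbT.
Qed.

Lemma levy_measure_outside nu : levy_measure nu ->
  (nu [set x : Rd R d | (1 < enorm x)%R] < +oo)%E.
Proof.
move=> [_ nu2].
have mB := measurable_outside.
rewrite -integral_indicT//; apply: le_lt_trans nu2; apply: ge0_le_integral => //.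
- by apply/measurable_EFinP; exact: measurable_indic.
- by apply/measurable_EFinP; exact: measurable_min1_enorm2.
- move=> x _; rewrite lee_fin indicE; case: (boolP (x \in _)) => [|_].
    by rewrite inE/= => /ltW x1; rewrite le_min mulr1n lexx/= expr2 mulr_ege1.
  by rewrite min1_enorm2_ge0.
Qed.

Lemma radial_lower_bound nu rho w theta (f : Rd R d -> R) (delta : R) :
    (forall x, 0 <= w x) -> measurable_fun setT w -> measurable_fun setT theta ->
    is_radial w theta rho nu ->
    (forall x, 0 <= f x) -> measurable_fun setT f ->
    rho [set 0] = 0%E -> 0 < delta ->
    (forall x, x != 0 -> ((delta * Num.min 1 (enorm x))%:E <= \int[leb]_(r in Rpos R)
      (w x * f (ray (direction x, r)) * expR (- (theta r / enorm x)))%:E)%E) ->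
    (\int[nu]_y (f y)%:E < +oo)%E ->
  levy_measure1 rho.
Proof.
move=> w0 mw mt nuE f0 mf rho0 delta0 lb fin; apply: levy_measure1_intro => //.
have mfr : measurable_fun setT (fun p : Rd R d * R => f (ray p)).
  exact: (measurableT_comp mf (@measurable_ray R d)).
pose I (x : Rd R d) := (\int[leb]_(r in Rpos R)
      (w x * f (ray (direction x, r)) * expR (- (theta r / enorm x)))%:E)%E.
have I0 x : (0 <= I x)%E.
  by apply: integral_ge0 => r _; rewrite lee_fin !mulr_ge0 ?expR_ge0.
have mI : measurable_fun setT I.
  exact: (measurable_radial_mix w0 mw mt (fun p => f0 (ray p)) mfr).
have le : (delta%:E * \int[rho]_x (Num.min 1 (enorm x))%:E <= \int[nu]_y (f y)%:E)%E.
  rewrite (integral_radialR w0 mw mt nuE f0 mf) -ge0_integralZl; first last.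
  - by rewrite lee_fin ltW.
  - by move=> x _; rewrite lee_fin min1_enorm_ge0.
  - by apply/measurable_EFinP; exact: measurable_min1_enorm.
  - exact: measurableT.
  rewrite /radial_mix -/(I _).
  have -> : (\int[rho]_x (delta%:E * (Num.min 1 (enorm x))%:E) =
      \int[rho]_x (delta * Num.min 1 (enorm x))%:E)%E by [].
  apply: ae_ge0_le_integral => //.
  - by move=> x _; rewrite lee_fin mulr_ge0 ?min1_enorm_ge0// ltW.
  - apply/measurable_EFinP; apply: measurable_funM => //; exact: measurable_min1_enorm.
  - by move=> x _; exact: I0.
  - by apply: ae_off0 => // x x0 _; exact: lb.
have : (delta%:E * \int[rho]_x (Num.min 1 (enorm x))%:E < +oo)%E by exact: le_lt_trans fin.
have : (0 <= \int[rho]_x (Num.min 1 (enorm x))%:E)%E.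
  by apply: integral_ge0 => x _; rewrite lee_fin min1_enorm_ge0.
case: (\int[rho]_x _)%E => [r _ _|_|//]; first by rewrite ltry.
by rewrite gt0_muley ?lte_fin.
Qed.

(** The weight is moved into the mixing measure; its bound by [c (1 + 1/|x|)] makes the Laplace
    integrals finite through [weight_expR_bound]. Positive radial mass comes from [g xi 1 = 1] and
    monotonicity: [g xi (theta r) >= 1] for [0 < r < 1]. *)
Lemma radial_polar_decomp nu rho w theta (c : R) :
    (forall x, 0 <= w x) -> measurable_fun setT w -> measurable_fun setT theta ->
    (forall r : R, 0 < r -> 0 < theta r) -> (forall r, 0 < r < 1 -> theta r <= 1) ->
    0 <= c -> (forall x, x != 0 -> w x <= c * (1 + (enorm x)^-1)) ->
    levy_measure1 rho ->
    is_radial w theta rho nu ->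
  exists lam g, [/\ polar_decomp_density nu lam (fun xi r => g xi (theta r)),
    measurable_fun (sphere R d `*` Rpos R) (fun p : Rd R d * R => g p.1 p.2) &
    forall xi, sphere R d xi -> completely_monotone (g xi)].
Proof.
move=> w0 mw mt t0 t1 c0 wc [[rho0 _] rho1] nuE.
have [rho' [rho'0 rho'E]] := weighted_measure rho w0 mw.
have fin (u : R) : 0 < u -> (\int[rho']_x (expR (- (u / enorm x)))%:E < +oo)%E.
  move=> u0; have [K K0 HK] := weight_expR_bound u0.
  have me : measurable_fun setT (fun x : Rd R d => expR (- (u / enorm x))).
    apply: measurable_expRN; apply: measurable_funM => //; apply: measurable_funV.
    exact: measurable_enorm.
  rewrite rho'E//; last exact/measurable_EFinP.
  apply: (@le_lt_trans _ _ (\int[rho]_x ((c * K)%:E * (Num.min 1 (enorm x))%:E))%E).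
    apply: ae_ge0_le_integral => //.
    - by move=> x _; rewrite mule_ge0// lee_fin ?expR_ge0.
    - by apply: emeasurable_funM; apply/measurable_EFinP.
    - by move=> x _; rewrite -EFinM lee_fin !mulr_ge0 ?min1_enorm_ge0.
    - apply: emeasurable_funM => //; apply/measurable_EFinP; exact: measurable_min1_enorm.
    - apply: ae_off0 => // x x0 _.
      rewrite -!EFinM lee_fin -mulrA; have s0 : 0 < enorm x by rewrite enorm_gt0.
      apply: le_trans (ler_wpM2l c0 (HK _ s0)); rewrite mulrA.
      by apply: ler_wpM2r; [exact: expR_ge0 | exact: wc].
  rewrite ge0_integralZl; first last.
  - by rewrite lee_fin mulr_ge0.
  - by move=> x _; rewrite lee_fin min1_enorm_ge0.
  - by apply/measurable_EFinP; exact: measurable_min1_enorm.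
  - exact: measurableT.
  by rewrite lte_mul_pinfty// lee_fin mulr_ge0.
have [lam [g [lamS cmg g1 mg gE]]] := mixture_to_polar (rho'0 rho0) fin mt t0.
exists lam, g; split => //; last first.
  by apply: measurable_funTS.
split => //; split; last split.
- by move=> xi r _ r0; apply: (completely_monotone_ge0 (cmg _)); exact: t0.
- move=> xi _; apply: (@lt_le_trans _ _ ((1 - 0) * 1)%:E); first by rewrite subr0 mul1r lte_fin.
  apply: le_integral_Rpos => //.
  + by move=> r r0; apply: (completely_monotone_ge0 (cmg _)); exact: t0.
  + apply: measurable_funTS; exact: (measurableT_comp (measurable_section xi mg) mt).
  + move=> r /[dup] /andP[r0 _] /t1 tr; rewrite -(g1 xi).
    by apply: (completely_monotone_nincr (cmg xi)) => //; exact: t0.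
- move=> B mB; rewrite nuE//.
  have mBr := measurable_indic_ray mB.
  rewrite -(radial_mix_reweight w0 mw (w1 := fun=> 1) (w2 := w) _ _ w0 mw mt _ mBr rho0 rho'E)//; last first.
    by move=> x _; rewrite mulr1.
  by rewrite -gE.
Qed.

Lemma completely_monotone0 : completely_monotone (fun=> 0 : R).
Proof.
apply: (completely_monotone_intro (F := fun _ _ => 0)) => n r _.
by rewrite mulr0.
Qed.

(** The mass of [nu] outside the unit ball is the finiteness required by [polar_to_mixture]; its
    mixing measure, of weight [1], is then divided by [w]. *)
Lemma polar_to_radial nu lam g w theta :
    levy_measure nu -> (forall x, 0 <= w x) -> measurable_fun setT w ->
    (forall x, x != 0 -> 0 < w x) -> measurable_fun setT theta ->
    (forall r : R, 0 < r -> 0 < theta r) ->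
    polar_decomp_density nu lam (fun xi r => g xi (theta r)) ->
    measurable_fun (sphere R d `*` Rpos R) (fun p : Rd R d * R => g p.1 p.2) ->
    (forall xi, sphere R d xi -> completely_monotone (g xi)) ->
  exists rho, rho [set 0] = 0%E /\ is_radial w theta rho nu.
Proof.
move=> nuL w0 mw wpos mt t0 [lamS [_ [_ nuE]]] mg cmg.
have mS := @measurable_sphere R d.
(* [g] is controlled on the sphere only; the zero function is completely monotone and extends it to
   every [xi]. *)
pose h (xi : Rd R d) (u : R) := if xi \in sphere R d then g xi u else 0.
have cmh xi : completely_monotone (h xi).
  have [xiS|xiS] := boolP (xi \in sphere R d).
    rewrite (_ : h xi = g xi); last by apply/funext => u; rewrite /h xiS.
    by apply: cmg; rewrite inE in xiS.
  rewrite (_ : h xi = fun=> 0); first exact: completely_monotone0.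
  by apply/funext => u; rewrite /h (negbTE xiS).
have mh : measurable_fun ([set: Rd R d] `*` Rpos R) (fun p : Rd R d * R => h p.1 p.2).
  have mST : measurable (sphere R d `*` Rpos R : set (Rd R d * measurableTypeR R)).
    by apply: measurableX => //; exact: measurable_Rpos.
  have /(measurable_restrictT _ mST) /(measurable_funTS (D := [set: Rd R d] `*` Rpos R)) := mg.
  apply: eq_measurable_fun => -[xi r]; rewrite in_setX => /andP[_ /= rR].
  by rewrite patchE in_setX/= rR andbT.
have restrict (F : Rd R d * R -> R) :
    (\int[lam]_(xi in sphere R d) \int[leb]_(r in Rpos R) (F (xi, r) * g xi (theta r))%:E =
     \int[lam]_(xi in sphere R d) \int[leb]_(r in Rpos R) (F (xi, r) * h xi (theta r))%:E)%E.
  apply: eq_integral => xi xiS; apply: eq_integral => r _; by rewrite /h xiS.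
have fin : (\int[lam]_(xi in sphere R d) \int[leb]_(r in Rpos R)
     (\1_(`]1, +oo[%classic : set R) r * h xi (theta r))%:E < +oo)%E.
  rewrite -(restrict (fun p => \1_(`]1, +oo[%classic : set R) p.2)).
  have := levy_measure_outside nuL; rewrite nuE; last exact: measurable_outside.
  apply: le_lt_trans; apply: eq_lee; apply: eq_integral => xi; rewrite inE => xiS; apply: eq_integral_Rpos => r r0.
  congr ((_ * _)%:E); rewrite !indicE; congr (nat_of_bool _)%:R.
  apply/idP/idP; rewrite !inE/= in_itv/= andbT enormZ (_ : enorm xi = 1)// mulr1 gtr0_norm//.
have [rho0 [rho00 rho0E]] := polar_to_mixture cmh mh mt t0 fin.
have wV0 x : 0 <= (w x)^-1 by rewrite invr_ge0.
have mwV : measurable_fun setT (fun x => (w x)^-1) by exact: measurable_funV.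
have [rho [rhoz rhoE]] := weighted_measure rho0 wV0 mwV.
exists rho; split=> [|B mB]; first exact: rhoz.
have mBr := measurable_indic_ray mB.
have B0 (p : Rd R d * R) : 0 <= \1_B (ray p) :> R by [].
have one0 (x : Rd R d) : (0 : R) <= 1 by [].
rewrite nuE// (radial_mix_reweight wV0 mwV w0 mw one0 (measurable_cst (1:R)) mt B0 mBr rho00 rhoE).
  by rewrite -(rho0E _ B0 mBr) -(restrict (fun p => \1_B (ray p))).
by move=> x x0; rewrite mulVf// gt_eqF// wpos.
Qed.

End representations.

(** * Uniqueness *)

Section uniqueness.
Context {R : realType} {d : nat}.
Local Notation leb := (@lebesgue_measure R).
Implicit Types (rho nu : {measure set (Rd R d) -> \bar R}).

Lemma integral_gauss_itv (s a b : R) : 0 < s -> a < b ->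
  (\int[leb]_(r in `[a, b]) (2 * r * expR (- (r ^+ 2 / s)))%:E =
   (s * (expR (- (a ^+ 2 / s)) - expR (- (b ^+ 2 / s))))%:E)%E.
Proof.
move=> s0 ab.
pose F (r : R) := - s * expR (- (r ^+ 2 / s)).
have dE (r : R) : is_derive r 1 (fun r : R => expR (- (r ^+ 2 / s)))
    (expR (- (r ^+ 2 / s)) * - (2 * r / s)).
  have h1 : is_derive r (1:R) (fun r : R => - (r ^+ 2 / s)) (- (2 * r / s)).
    by apply: is_derive_eq; rewrite /GRing.scale/=; ring.
  exact: (@is_derive1_comp _ expR _ r _ _ (is_derive_expR _) h1).
have dF (r : R) : is_derive r 1 F (2 * r * expR (- (r ^+ 2 / s))).
  have h3 := is_deriveZ (- s) (dE r).
  by apply: is_derive_eq; rewrite /GRing.scale/=; field; rewrite gt_eqF.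
have cF : continuous F.
  move=> r; apply: differentiable_continuous; apply/derivable1_diffP.
  by have [] := dF r.
have cE : continuous (fun r : R => expR (- (r ^+ 2 / s))).
  move=> r; apply: differentiable_continuous; apply/derivable1_diffP.
  by have [] := dE r.
have cf : continuous (fun r : R => 2 * r * expR (- (r ^+ 2 / s))).
  move=> r; apply: (@cvgM R R); first by apply: (@cvgM R R); [exact: cvg_cst | exact: cvg_id].
  exact: cE.
rewrite (@continuous_FTC2 _ _ F)//.
- by rewrite -EFinB; congr EFin; rewrite /F; ring.
- exact: continuous_subspaceT.
- split.
  + by move=> r _; have [] := dF r.
  + by apply: cvg_at_right_filter; exact: cF.
  + by apply: cvg_at_left_filter; exact: cF.
- by move=> r _; rewrite derive1E; have [_ ->] := dF r.
Qed.

Let X (x : Rd R d) : R := expR (- (enorm x)^-1).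
(** With [s = |x|], the integral of [2 r e^(-r^2/s)] over the [j]-th shell is
    [s (X^(j+1) - X^(j+2))]; [v] collects the factors free of [j], leaving [X^j]. *)
Let v (x : Rd R d) : R := gauss_weight x * enorm x * (1 - X x) * X x.

Let mX : measurable_fun setT X.
Proof.
by apply: measurable_expRN; apply: measurable_funV; exact: measurable_enorm.
Qed.

Let X01 x : 0 <= X x <= 1.
Proof. by rewrite expR_ge0 -expR0 ler_expR oppr_le0 invr_ge0 enorm_ge0. Qed.

Let v_ge0 x : 0 <= v x.
Proof.
have /andP[X0 X1] := X01 x.
apply: mulr_ge0 => //; apply: mulr_ge0; last by rewrite subr_ge0.
by apply: mulr_ge0; [exact: gauss_weight_ge0 | exact: enorm_ge0].
Qed.

Let mv : measurable_fun setT v.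
Proof.
apply: measurable_funM => //; apply: measurable_funM; last exact: measurable_funB.
by apply: measurable_funM; [exact: measurable_gauss_weight | exact: measurable_enorm].
Qed.

(** Off the origin [v] is [arcsine_const] times [sqrt s (1 - X) X]. For large [s] one uses
    [1 - X <= 1/s], for small [s] the inequality [X <= s]. *)
Let v_le x : v x <= arcsine_const * Num.min 1 (enorm x).
Proof.
have [->|x0] := eqVneq x 0.
  have e0 : enorm (0 : Rd R d) = 0 by apply/eqP; rewrite enorm_eq0.
  by rewrite /v e0 mulr0 !mul0r mulr_ge0 ?(ltW arcsine_const_gt0).
have s0 : 0 < enorm x by rewrite enorm_gt0.
rewrite /v /gauss_weight /X; set s := enorm x in s0 *.
have q0 : 0 < Num.sqrt s by rewrite sqrtr_gt0.
have -> : arcsine_const / Num.sqrt s * s = arcsine_const * Num.sqrt s.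
  by rewrite -{2}(sqr_sqrtr (ltW s0)); field; rewrite gt_eqF.
rewrite -2!mulrA; apply: ler_wpM2l; first exact: (ltW arcsine_const_gt0).
rewrite mulrA.
set z := expR (- s^-1).
have z0 : 0 <= z by exact: expR_ge0.
have y0 : 0 < s^-1 by rewrite invr_gt0.
have z1 : z <= 1 by rewrite -expR0 ler_expR oppr_le0 ltW.
have zs : z <= s.
  rewrite /z expRN invf_ple ?posrE ?expR_gt0//.
  by apply: le_trans (expR_ge1Dx _); rewrite lerDr.
have z1s : 1 - z <= s^-1.
  by have := expR_ge1Dx (- s^-1); rewrite -/z; lra.
rewrite minEle; case: ifPn => s1.
  have q1 : Num.sqrt s * s^-1 <= 1.
    rewrite -{2}(sqr_sqrtr (ltW s0)) expr2 invfM mulrA divff ?gt_eqF// mul1r.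
    by rewrite invf_le1// -sqrtr1 ler_wsqrtr.
  apply: mulr_ile1 => //; first by rewrite mulr_ge0 ?(ltW q0)// subr_ge0.
  by apply: le_trans q1; rewrite ler_wpM2l// ltW.
have q1 : Num.sqrt s <= 1 by rewrite -[leRHS]sqrtr1 ler_wsqrtr// ltW// ltNge.
rewrite -[leRHS]mul1r; apply: ler_pM => //; first by rewrite mulr_ge0 ?(ltW q0)// subr_ge0.
by apply: mulr_ile1 => //; rewrite ?(ltW q0) ?subr_ge0// lerBlDr lerDl.
Qed.

Let v_gt0 x : x != 0 -> 0 < v x.
Proof.
move=> x0; have s0 : 0 < enorm x by rewrite enorm_gt0.
apply: mulr_gt0; last exact: expR_gt0.
apply: mulr_gt0; last by rewrite subr_gt0 /X -expR0 ltr_expR oppr_lt0 invr_gt0.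
by rewrite mulr_gt0// divr_gt0 ?arcsine_const_gt0// sqrtr_gt0.
Qed.

(* The shell of radii between [sqrt (j + 1)] and [sqrt (j + 2)], rather than
   [sqrt j] and [sqrt (j + 1)], provides the factor [X] that makes the weight [v]
   integrable near the origin. *)
Let moments nu rho (C : set (Rd R d)) j : levy_measure1 rho ->
    is_radial gauss_weight square rho nu ->
    measurable C ->
  (\int[rho]_x (v x * (\1_C (direction x) * X x ^+ j))%:E =
   \int[nu]_y (\1_C (direction y) * (\1_(`[Num.sqrt j.+1%:R, Num.sqrt j.+2%:R]%classic : set R)
     (enorm y) * (2 * enorm y)))%:E)%E.
Proof.
move=> [[rho0 _] _] nuE mC.
pose J : set R := `[Num.sqrt j.+1%:R, Num.sqrt j.+2%:R]%classic.
have mJ : measurable (J : set (measurableTypeR R)) by exact: measurable_itv.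
have JR r : J r -> 0 < r.
  by rewrite /J/= in_itv/= => /andP[+ _]; apply: lt_le_trans; rewrite sqrtr_gt0 ltr0n.
pose f (y : Rd R d) := \1_C (direction y) * (\1_J (enorm y) * (2 * enorm y)).
have f0 y : 0 <= f y by rewrite !mulr_ge0 ?enorm_ge0.
have mC1 : measurable_fun setT (\1_C : Rd R d -> R) by exact: measurable_indic.
have mJ1 : measurable_fun setT (\1_J : R -> R) by exact: measurable_indic.
have mCd := measurableT_comp mC1 (@measurable_direction R d).
have me := @measurable_enorm R d.
have mf : measurable_fun setT f.
  apply: measurable_funM => //; apply: measurable_funM; last exact: measurable_funM.
  exact: (measurableT_comp mJ1 me).
have mfr := measurableT_comp mf (@measurable_ray R d).
rewrite (integral_radialR gauss_weight_ge0 measurable_gauss_weight measurable_square nuE f0 mf).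
apply: (integral_off0 rho0).
- apply/measurable_EFinP; apply: measurable_funM => //; apply: measurable_funM => //.
  exact: measurable_funX.
- exact: (measurable_radial_mix gauss_weight_ge0 measurable_gauss_weight measurable_square
    (fun p => f0 (ray p)) mfr).
move=> x x0; have s0 : 0 < enorm x by rewrite enorm_gt0.
pose h (r : R) := 2 * r * expR (- (r ^+ 2 / enorm x)).
have h0 r : (0 <= (\1_J r)%:E * (h r)%:E)%E.
  rewrite indicE; case: (boolP (r \in J)) => [|_]; last by rewrite mul0e.
  by rewrite inE => /JR r0; rewrite mul1e lee_fin !mulr_ge0 ?expR_ge0// ltW.
have mh : measurable_fun setT (fun r => (\1_J r)%:E * (h r)%:E : \bar R)%E.
  apply: emeasurable_funM; apply/measurable_EFinP => //.
  apply: measurable_funM; first exact: measurable_funM.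
  by apply: measurable_expRN; apply: measurable_funM => //; exact: measurable_funX.
pose c := gauss_weight x * \1_C (direction x).
have c0 : 0 <= c by apply: mulr_ge0; [exact: gauss_weight_ge0 | exact: ler0n].
transitivity (\int[leb]_r (c%:E * ((\1_J r)%:E * (h r)%:E)))%E; last first.
  rewrite [RHS]integral_RposE.
  apply: eq_integral => r _; rewrite indic_Rpos; case: ltP => [r0|r0].
    rewrite mul1e /f enorm_ray// direction_ray// -!EFinM /c /h /square; congr EFin.
    by ring.
  rewrite [\1_J r]indicE memNset ?mul0e ?mule0// => /JR.
  by rewrite ltNge r0.
rewrite ge0_integralZl; first last.
- by rewrite lee_fin.
- by move=> r _; exact: h0.
- exact: mh.
- exact: measurableT.
rewrite -(integral_mul_indic _ _ mJ) /h integral_gauss_itv//; last first.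
  by rewrite ltr_sqrt ?ltr0n// ltr_nat.
rewrite !sqr_sqrtr ?ler0n// -EFinM; congr EFin.
rewrite -!mulrN !expRM_natl /c /v -/(X x) !exprS.
by ring.
Qed.

(** [nu] determines the joint moments of direction and [X] under the finite measure [v rho], hence
    their joint law. Off the origin [x] is a function of that pair and [v x > 0], so [rho] is
    recovered. *)
Lemma gauss_radial_unique nu rho1 rho2 : levy_measure1 rho1 -> levy_measure1 rho2 ->
    is_radial gauss_weight square rho1 nu ->
    is_radial gauss_weight square rho2 nu ->
  forall B, measurable B -> rho1 B = rho2 B.
Proof.
move=> L1 L2 E1 E2 B mB.
have mB1 : measurable_fun setT (\1_B : Rd R d -> R) by exact: measurable_indic.
have fin1 : (\int[rho1]_x (v x)%:E < +oo)%E.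
  apply: (@le_lt_trans _ _ (\int[rho1]_x (arcsine_const%:E * (Num.min 1 (enorm x))%:E))%E).
    apply: ge0_le_integral.
    - exact: measurableT.
    - by move=> x _; rewrite lee_fin.
    - exact/measurable_EFinP.
    - apply: emeasurable_funM => //; apply/measurable_EFinP; exact: measurable_min1_enorm.
    - by move=> x _; rewrite -EFinM lee_fin.
  rewrite ge0_integralZl; first last.
  - by rewrite lee_fin ltW// arcsine_const_gt0.
  - by move=> x _; rewrite lee_fin min1_enorm_ge0.
  - by apply/measurable_EFinP; exact: measurable_min1_enorm.
  - exact: measurableT.
  by case: L1 => _; apply: lte_mul_pinfty => //; rewrite lee_fin ltW// arcsine_const_gt0.
(* [S] and [K] express [|x|] and [1 / v x] as functions of [z = X x]. *)
pose S (z : R) := (- ln z)^-1.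
have mS : measurable_fun setT S.
  by apply: measurable_funV; apply: measurable_funN; exact: (@measurable_ln R).
pose K (z : R) := (arcsine_const / Num.sqrt (S z) * S z * (1 - z) * z)^-1.
have mK : measurable_fun setT K.
  apply: measurable_funV; apply: measurable_funM => //; apply: measurable_funM; last exact: measurable_funB.
  apply: measurable_funM => //; apply: measurable_funM => //; apply: measurable_funV.
  exact: (measurableT_comp (@measurable_sqrt R) mS).
(* The absolute value keeps [F] nonnegative at values of [z] that [X] does not take. *)
pose F (p : Rd R d * R) : \bar R := (\1_B (ray (p.1, S p.2)) * `|K p.2|)%:E.
have F0 p : (0 <= F p)%E by rewrite lee_fin mulr_ge0.
have mF : measurable_fun setT F.
  apply/measurable_EFinP; apply: measurable_funM.
    apply: (measurableT_comp mB1); apply: (measurableT_comp (@measurable_ray R d)).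
    by apply/measurable_fun_pair => //; exact: (measurableT_comp mS measurable_snd).
  apply: (measurableT_comp (@normr_measurable R setT)).
  exact: (measurableT_comp mK measurable_snd).
have FE rho : levy_measure1 rho ->
    rho B = (\int[rho]_x ((v x)%:E * F (direction x, X x)))%E.
  move=> [[rho0 _] _]; rewrite -(integral_indicT rho mB); apply: (integral_off0 rho0).
  - exact/measurable_EFinP.
  - apply: emeasurable_funM; first exact/measurable_EFinP.
    have mp : measurable_fun setT (fun x : Rd R d => (direction x, X x)).
      by apply/measurable_fun_pair => //; exact: measurable_direction.
    exact: (measurableT_comp mF mp).
  move=> x x0; have s0 : 0 < enorm x by rewrite enorm_gt0.
  have SX : S (X x) = enorm x by rewrite /S /X expRK opprK invrK.
  have KX : K (X x) = (v x)^-1 by rewrite /K SX.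
  rewrite /F /= KX SX gtr0_norm ?invr_gt0 ?v_gt0// -EFinM; congr EFin.
  rewrite mulrCA divff ?gt_eqF ?v_gt0// mulr1; congr (\1_B _).
  by rewrite /ray/direction/= scalerA divff ?scale1r// gt_eqF.
rewrite !FE//.
apply: (joint_moment_unique v_ge0 v_ge0 mv mv (@measurable_direction R d)
  (@measurable_direction R d) mX mX X01 X01 fin1) => // C j mC.
by rewrite (moments j L1 E1 mC) (moments j L2 E2 mC).
Qed.

End uniqueness.

(** * The theorem *)

Section equivalences.
Context {R : realType} {d : nat}.
Local Notation leb := (@lebesgue_measure R).
Implicit Types (rho nu nut ups : {measure set (Rd R d) -> \bar R}).

Let measurable_idR : measurable_fun setT (@id R).
Proof. exact: measurable_id. Qed.

(** Integrability of [min(1, |y|)] under [nu] passes to [rho] by [exp_inner_ge]; the converse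
    construction below relies on [exp_inner_le]. *)
Lemma levy_B_Ups0 nu : levy_B nu -> levy_measure1 nu ->
  exists rho, levy_measure1 rho /\ forall B, measurable B -> nu B = Ups0 rho B.
Proof.
move=> [nuL [lam [ell [pol [mell cmell]]]]] [_ nu1].
have wpos (x : Rd R d) : x != 0 -> 0 < exp_weight x.
  by move=> x0; rewrite invr_gt0 enorm_gt0.
have [rho [rho0 nuE]] := polar_to_radial (theta := id) nuL (@exp_weight_ge0 R d)
  (@measurable_exp_weight R d) wpos measurable_idR (fun r r0 => r0) pol mell cmell.
have rho1 : levy_measure1 rho.
  apply: (radial_lower_bound (@exp_weight_ge0 R d) (@measurable_exp_weight R d)
    measurable_idR nuE (@min1_enorm_ge0 R d) (@measurable_min1_enorm R d) rho0
    (expR_gt0 (- 2)) _ nu1) => x x0.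
  have s0 : 0 < enorm x by rewrite enorm_gt0.
  apply: le_trans (exp_inner_ge s0) _; apply: eq_lee.
  by apply: eq_integral_Rpos => r r0; rewrite enorm_ray.
exists rho; split => // B mB; rewrite nuE//.
by rewrite (Ups0_radial rho1 mB).
Qed.

Lemma Ups0_levy_B rho ups : levy_measure1 rho ->
    (forall B, measurable B -> ups B = Ups0 rho B) ->
  levy_B ups /\ levy_measure1 ups.
Proof.
move=> rhoL upsE; have [[rho0 _] rho1] := rhoL.
have upsR : is_radial exp_weight id rho ups.
  by move=> B mB; rewrite upsE// (Ups0_radial rhoL mB).
have ups0 : ups [set 0] = 0%E.
  have m0 := @measurable_set_zero R d.
  have mI : measurable_fun setT (\1_[set 0] : Rd R d -> R) by exact: measurable_indic.
  have mIr := measurableT_comp mI (@measurable_ray R d).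
  rewrite upsR//; transitivity (\int[rho]_x cst 0%E x)%E; last by rewrite integral0.
  apply: (integral_off0 rho0).
  - exact: (measurable_radial_mix (@exp_weight_ge0 R d) (@measurable_exp_weight R d)
      measurable_idR (fun p => ler0n _ _) mIr).
  - exact: measurable_cst.
  move=> x x0; apply: integral0_eq => r; rewrite in_Rpos => r0.
  rewrite indicE memNset ?mulr0 ?mul0r// => /eqP.
  by rewrite -enorm_eq0 enorm_ray// gt_eqF.
have upsL : levy_measure1 ups.
  apply: levy_measure1_intro => //.
  rewrite (integral_radialR (@exp_weight_ge0 R d) (@measurable_exp_weight R d)
    measurable_idR upsR (@min1_enorm_ge0 R d) (@measurable_min1_enorm R d)).
  apply: (@le_lt_trans _ _ (\int[rho]_x (4%:E * (Num.min 1 (enorm x))%:E))%E).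
    have mm := measurableT_comp (@measurable_min1_enorm R d) (@measurable_ray R d).
    apply: ae_ge0_le_integral.
    - exact: measurableT.
    - move=> x _; apply: integral_ge0 => r _; rewrite lee_fin; apply: mulr_ge0; last exact: expR_ge0.
      by apply: mulr_ge0; [exact: exp_weight_ge0 | exact: min1_enorm_ge0].
    - exact: (measurable_radial_mix (@exp_weight_ge0 R d) (@measurable_exp_weight R d)
        measurable_idR (fun p => min1_enorm_ge0 (ray p)) mm).
    - by move=> x _; rewrite mule_ge0// lee_fin min1_enorm_ge0.
    - by apply: emeasurable_funM => //; apply/measurable_EFinP; exact: measurable_min1_enorm.
    - apply: ae_off0 => // x x0 _.
      have s0 : 0 < enorm x by rewrite enorm_gt0.
      apply: le_trans (exp_inner_le s0); apply: eq_lee.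
      by apply: eq_integral_Rpos => r r0; rewrite enorm_ray.
  rewrite ge0_integralZl; first last.
  - by rewrite lee_fin.
  - by move=> x _; rewrite lee_fin min1_enorm_ge0.
  - by apply/measurable_EFinP; exact: measurable_min1_enorm.
  - exact: measurableT.
  by apply: lte_mul_pinfty => //; rewrite lee_fin.
split=> //; split; first by case: upsL.
have wle (x : Rd R d) : x != 0 -> exp_weight x <= 1 * (1 + (enorm x)^-1).
  by move=> x0; rewrite mul1r lerDr.
have [lam [ell [h1 h2 h3]]] := radial_polar_decomp (@exp_weight_ge0 R d)
  (@measurable_exp_weight R d) measurable_idR (fun r r0 => r0)
  (fun r r01 => ltW (andP r01).2) ler01 wle rhoL upsR.
by exists lam, ell.
Qed.

Lemma levy_G_A1 nut : levy_G nut -> exists rho, levy_measure1 rho /\ exists ups,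
  (forall B, measurable B -> ups B = Ups0 rho B) /\
  (forall B, measurable B -> nut B = A1 ups B).
Proof.
move=> [nuL [lam [g [pol [mg cmg]]]]].
have wpos (x : Rd R d) : x != 0 -> 0 < gauss_weight x.
  by move=> x0; rewrite divr_gt0 ?arcsine_const_gt0// sqrtr_gt0 enorm_gt0.
have sq0 (r : R) : 0 < r -> 0 < square r by move=> r0; exact: exprn_gt0.
have [rho [rho0 nuE]] := polar_to_radial (theta := @square R) nuL (@gauss_weight_ge0 R d)
  (@measurable_gauss_weight R d) wpos (@measurable_square R) sq0 pol mg cmg.
have rhoL : levy_measure1 rho.
  have delta0 : 0 < @arcsine_const R * expR (- 4).
    by rewrite mulr_gt0 ?arcsine_const_gt0 ?expR_gt0.
  apply: (radial_lower_bound (@gauss_weight_ge0 R d) (@measurable_gauss_weight R d)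
    (@measurable_square R) nuE (@min1_enorm2_ge0 R d) (@measurable_min1_enorm2 R d) rho0
    delta0 _ (proj2 nuL)) => x x0.
  have s0 : 0 < enorm x by rewrite enorm_gt0.
  apply: le_trans (gauss_inner_ge (ltW (@arcsine_const_gt0 R)) s0) _.
  apply: eq_lee.
  by apply: eq_integral_Rpos => r r0; rewrite enorm_ray.
exists rho; split => //.
(* [Ups0 rho] is a mere set function; its radial form provides an actual measure agreeing with
   it. *)
have [ups upsI] := radial_measure rho (@exp_weight_ge0 R d) (@measurable_exp_weight R d)
  measurable_idR.
have upsR : is_radial exp_weight id rho ups.
  move=> B mB; have mI : measurable_fun setT (fun x : Rd R d => (\1_B x)%:E : \bar R).
    by apply/measurable_EFinP; exact: measurable_indic.
  have I0 (x : Rd R d) : (0 <= (\1_B x)%:E :> \bar R)%E by rewrite lee_fin.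
  rewrite -(integral_indicT ups mB) (upsI _ I0 mI).
  apply: eq_integral => x _; apply: eq_integral => r _; rewrite -EFinM; congr EFin.
  by ring.
exists ups; split => B mB; first by rewrite upsR// (Ups0_radial rhoL mB).
by rewrite nuE// (A1_radial rho0 mB upsR).
Qed.

Lemma A1_Ups0_radial nut rho ups : levy_measure1 rho ->
    (forall B, measurable B -> ups B = Ups0 rho B) ->
    (forall B, measurable B -> nut B = A1 ups B) ->
  is_radial gauss_weight square rho nut.
Proof.
move=> rhoL upsE nutE B mB; rewrite nutE//.
apply: A1_radial => //; first by have [[]] := rhoL.
by move=> C mC; rewrite upsE// (Ups0_radial rhoL mC).
Qed.

(** [nut] is given as a Lévy measure, by the triplet in the application, so only its polar
    decomposition is to be found. *)
Lemma A1_levy_G nut rho ups : levy_measure nut -> levy_measure1 rho ->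
    (forall B, measurable B -> ups B = Ups0 rho B) ->
    (forall B, measurable B -> nut B = A1 ups B) ->
  levy_G nut.
Proof.
move=> nutL rhoL upsE nutE; split => //.
have nutR := A1_Ups0_radial rhoL upsE nutE.
have sq0 (r : R) : 0 < r -> 0 < square r by move=> r0; exact: exprn_gt0.
have sq1 (r : R) : 0 < r < 1 -> square r <= 1.
  by move=> /andP[r0 r1]; rewrite expr_le1 ?ltW.
have wle (x : Rd R d) : x != 0 -> gauss_weight x <= arcsine_const * (1 + (enorm x)^-1).
  move=> x0; apply: ler_wpM2l; first exact: (ltW arcsine_const_gt0).
  have s0 : 0 < enorm x by rewrite enorm_gt0.
  have q0 : 0 < Num.sqrt (enorm x) by rewrite sqrtr_gt0.
  (* With [t = |x|^(-1/2)] the claim is [t <= 1 + t^2], a consequence of [(t - 1)^2 >= 0]. *)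
  rewrite -{2}(sqr_sqrtr (ltW s0)) -exprVn.
  set t := (Num.sqrt (enorm x))^-1; have := sqr_ge0 (t - 1); nra.
have [lam [g [h1 h2 h3]]] := radial_polar_decomp (@gauss_weight_ge0 R d)
  (@measurable_gauss_weight R d) (@measurable_square R) sq0 sq1
  (ltW (@arcsine_const_gt0 R)) wle rhoL nutR.
by exists lam, g.
Qed.

Lemma Ups0_unique nut rho1 rho2 ups1 ups2 :
    levy_measure1 rho1 -> levy_measure1 rho2 ->
    (forall B, measurable B -> ups1 B = Ups0 rho1 B) ->
    (forall B, measurable B -> ups2 B = Ups0 rho2 B) ->
    (forall B, measurable B -> nut B = A1 ups1 B) ->
    (forall B, measurable B -> nut B = A1 ups2 B) ->
  forall B, measurable B -> rho1 B = rho2 B.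
Proof.
move=> L1 L2 U1 U2 N1 N2.
exact: (gauss_radial_unique L1 L2 (A1_Ups0_radial L1 U1 N1) (A1_Ups0_radial L2 U2 N2)).
Qed.

End equivalences.

Theorem theorem3p5 (R : realType) (d : nat) (mut : probability (Rd R d) R)
    (Sigmat : 'M[R]_d) (nut : {measure set (Rd R d) -> \bar R})
    (gammat : 'rV[R]_d) :
  ID_triplet mut Sigmat nut gammat ->
  (* (a) <-> (b) *)
  (in_G mut Sigmat nut gammat <->
     exists nu : {measure set (Rd R d) -> \bar R},
       levy_B nu /\ levy_measure1 nu /\
       (forall B, measurable B -> nut B = A1 nu B)) /\
  (* (a) <-> (c) *)
  (in_G mut Sigmat nut gammat <->
     exists rho : {measure set (Rd R d) -> \bar R},
       levy_measure1 rho /\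
       exists ups : {measure set (Rd R d) -> \bar R},
         (forall B, measurable B -> ups B = Ups0 rho B) /\
         (forall B, measurable B -> nut B = A1 ups B)) /\
  (* uniqueness of nu in (b) *)
  (forall nu1 nu2 : {measure set (Rd R d) -> \bar R},
     levy_B nu1 -> levy_measure1 nu1 ->
     levy_B nu2 -> levy_measure1 nu2 ->
     (forall B, measurable B -> nut B = A1 nu1 B) ->
     (forall B, measurable B -> nut B = A1 nu2 B) ->
     forall B, measurable B -> nu1 B = nu2 B) /\
  (* uniqueness of rho in (c) *)
  (forall rho1 rho2 ups1 ups2 : {measure set (Rd R d) -> \bar R},
     levy_measure1 rho1 -> levy_measure1 rho2 ->
     (forall B, measurable B -> ups1 B = Ups0 rho1 B) ->
     (forall B, measurable B -> ups2 B = Ups0 rho2 B) ->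
     (forall B, measurable B -> nut B = A1 ups1 B) ->
     (forall B, measurable B -> nut B = A1 ups2 B) ->
     forall B, measurable B -> rho1 B = rho2 B).
Proof.
move=> ID; have nutL : levy_measure nut by have [_ [_ []]] := ID.
split; [|split; [|split]].
- split=> [[_ /levy_G_A1[rho [rhoL [ups [upsE nutE]]]]]|[nu [nuB [nu1 nutE]]]].
    by have [upsB ups1] := Ups0_levy_B rhoL upsE; exists ups.
  have [rho [rhoL nuE]] := levy_B_Ups0 nuB nu1.
  split; [exact: ID | exact: (A1_levy_G nutL rhoL nuE nutE)].
- split=> [[_ /levy_G_A1//]|[rho [rhoL [ups [upsE nutE]]]]].
  split; [exact: ID | exact: (A1_levy_G nutL rhoL upsE nutE)].
(* Each measure in (b) is [Ups0] of some measure in (c), so uniqueness in (b) reduces to uniqueness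
   in (c). *)
- move=> nu1 nu2 B1 L1 B2 L2 N1 N2 B mB.
  have [rho1 [rhoL1 U1]] := levy_B_Ups0 B1 L1.
  have [rho2 [rhoL2 U2]] := levy_B_Ups0 B2 L2.
  have rhoE := Ups0_unique rhoL1 rhoL2 U1 U2 N1 N2.
  rewrite U1// U2//; apply: eq_integral => u _; congr (_ * _)%E; apply: rhoE.
  have mu : measurable_fun setT (fun x : Rd R d => ray (x, u)).
    by apply: (measurableT_comp (@measurable_ray R d)); apply/measurable_fun_pair.
  by rewrite -[X in measurable X]setTI; exact: (mu measurableT B mB).
- exact: Ups0_unique.
Qed.
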